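(* Let $d\ge 1$, let $m\in\mathbb{N}_0^d$ be a nonzero multi-index, $|m|=\sum_{i=1}^d m_i$, and let $1<r<\infty$, $1\le q\le\infty$, $0<G<\infty$ and $s>0$ with $s-\frac{d}{r}>0$. Let $X_1,\dots,X_n$ be i.i.d. random vectors on $\mathbb{T}^d$ with probability density $f$, where $f\in\mathcal{B}^{s+|m|}_{r,q}(G)$, let $f^{(m)}=D^mf$, and let $\widehat f^{(m)}$ be the hard or the soft thresholding needlet estimator of $f^{(m)}$ (defined in the context). Then, for $1\le p<\infty$, $$\sup_{f\in\mathcal{B}^{s+|m|}_{r,q}(G)}\mathbb{E}\left[\left\|\widehat f^{(m)}-f^{(m)}\right\|_{L^p(\mathbb{T}^d)}^p\right]\gtrsim n^{-\alpha(s,|m|,p,r)},$$ where $$\alpha(s,|m|,p,r)=\begin{cases}\dfrac{ps}{2(s+|m|)+d} & \text{if } r\ge\dfrac{(2|m|+d)p}{2(s+|m|)+d},\\[3mm] \dfrac{p\left(s+d\left(\frac1p-\frac1r\right)\right)}{2\left[(s+|m|)+d\left(\frac12-\frac1r\right)\right]} & \text{if } r<\dfrac{(2|m|+d)p}{2(s+|m|)+d},\end{cases}$$ and, for $p=\infty$, $$\sup_{f\in\mathcal{B}^{s+|m|}_{r,q}(G)}\mathbb{E}\left[\left\|\widehat f^{(m)}-f^{(m)}\right\|_{L^\infty(\mathbb{T}^d)}\right]\gtrsim n^{-\alpha(s,|m|,\infty,r)},\qquad \alpha(s,|m|,\infty,r)=\frac{s-\frac dr}{2\left[(s+|m|)-d\left(\frac1r-\frac12\right)\right]}.$$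 The suprema are over probability densities $f$ on $\mathbb{T}^d$ belonging to the indicated Besov ball, and $\gtrsim$ means inequality up to a positive multiplicative constant independent of $n\ge 2$.
   Context: Torus. $\mathbb{T}^d$ is the $d$-dimensional torus with coordinates $\vartheta=(\vartheta_1,\dots,\vartheta_d)\in[0,2\pi)^d$ and Lebesgue measure $\rho(\mathrm{d}\vartheta)=\prod_i \mathrm{d}\vartheta_i$; densities are with respect to $\rho$. For $\ell\in\mathbb{Z}^d$ set $S_\ell(\vartheta)=(2\pi)^{-d/2}e^{\mathrm{i}\langle\ell,\vartheta\rangle}$ and $\varepsilon_\ell=\left(\sum_{i=1}^d|\ell_i|^2\right)^{1/2}$. $D^m=\partial^{|m|}/(\partial\vartheta_1^{m_1}\cdots\partial\vartheta_d^{m_d})$, and $\langle f,g\rangle_{\mathbb{T}^d}=\int_{\mathbb{T}^d}f\,\overline g\,\mathrm{d}\rho$. Needlets. Fix a scale parameter $B>1$ and a function $b:\mathbb{R}\to[0,\infty)$ that is $C^\infty$, supported in $[B^{-1},B]$, with $\sum_{j\ge0}b^2(c/B^j)=1$ for all $c>1$. Let $\Lambda_j^d=\{\ell\in\mathbb{Z}^d:\varepsilon_\ell\in(B^{j-1},B^{j+1})\}$. For each $j\ge0$ fix cubature points and weights $(\xi_{j,k},\lambda_{j,k})$, $k=1,\dots,K_j$, with $\xi_{j,k}\in\mathbb{T}^d$, $\lambda_{j,k}>0$, such that: the cubature is exact, i.e. $\sum_{k=1}^{K_j}\lambda_{j,k}S_\ell(\xi_{j,k})\overline{S_{\ell'}(\xi_{j,k})}=\delta_\ell^{\ell'}$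 for all $\ell,\ell'\in\Lambda_j^d$; and $\mathbb{T}^d$ is partitioned into $K_j$ pixels, the $k$-th centered at $\xi_{j,k}$ with area $\lambda_{j,k}$ and diameter $\lesssim B^{-j}$, with $\lambda_{j,k}\approx B^{-jd}$ and $K_j\approx B^{jd}$ uniformly in $j,k$. The needlets are $$\psi_{j,k}(\vartheta)=\sqrt{\lambda_{j,k}}\sum_{\ell\in\Lambda_j^d}b\left(\frac{\varepsilon_\ell}{B^j}\right)\overline{S_\ell(\xi_{j,k})}\,S_\ell(\vartheta),$$ which are real-valued, and $\psi_{j,k}^{(m)}=D^m\psi_{j,k}$. The needlet coefficients of $f$ are $\beta_{j,k}=\langle f,\psi_{j,k}\rangle_{\mathbb{T}^d}$. Besov spaces. Let $\mathcal{P}_t$ be the space of (trigonometric) polynomials of degree at most $t$ on $\mathbb{T}^d$, and $G_t(f;r)=\inf_{g\in\mathcal{P}_t}\|f-g\|_{L^r(\mathbb{T}^d)}$. For $\sigma>0$, the Besov space $\mathcal{B}^{\sigma}_{r,q}$ consists of all $f\in L^r(\mathbb{T}^d)$ with $\left(\sum_{j\ge0}\left(B^{j\sigma}G_{B^j}(f;r)\right)^q\right)^{1/q}<\infty$ (supremum over $j$ if $q=\infty$), with norm $$\|f\|_{\mathcal{B}^{\sigma}_{r,q}}=\left\|\left(B^{j[\sigma+d(\frac12-\frac1r)]}\left\|(\beta_{j,k})_{k=1,\dots,K_j}\right\|_{\ell^r}\right)_{j\ge0}\right\|_{\ell^q}.$$ The Besov ball of radius $G>0$ is $\mathcal{B}^{\sigma}_{r,q}(G)=\{f\in\mathcal{B}^{\sigma}_{r,q}:\|f\|_{\mathcal{B}^{\sigma}_{r,q}}\le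 G\}$. Estimator. With $X_1,\dots,X_n$ i.i.d. with density $f$, put $$\widehat\beta^{(m)}_{j,k}=\frac{(-1)^{|m|}}{n}\sum_{i=1}^n\overline{\psi^{(m)}_{j,k}(X_i)},\qquad \widehat f^{(m)}(\vartheta)=\sum_{j=0}^{J_{n,m}-1}\sum_{k=1}^{K_j}\eta\left(\widehat\beta^{(m)}_{j,k},\tau_{j,m,n}\right)\psi_{j,k}(\vartheta),$$ where $J_{n,m}=\left\lfloor\frac{1}{d+2|m|}\log_B\frac{n}{\log n}\right\rfloor$, $\tau_{j,m,n}=\kappa B^{j|m|}\sqrt{\frac{\log n}{n}}$ with threshold constant $\kappa>0$, and $\eta$ is either the hard threshold $\eta_{\rm hard}(u,a)=u$ if $|u|\ge a$ and $0$ otherwise, or the soft threshold $\eta_{\rm soft}(u,a)=\max(|u|-a,0)\,\mathrm{sign}(u)$. *)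

(* Defs.v *)
From HB Require Import structures.
From mathcomp Require Import all_boot all_order all_algebra.
From mathcomp Require Import complex.
From mathcomp Require Import all_classical all_reals all_analysis.

Set Implicit Arguments.
Unset Strict Implicit.
Unset Printing Implicit Defensive.

Import Order.TTheory GRing.Theory Num.Theory.
Import numFieldNormedType.Exports.

Local Open Scope classical_set_scope.
Local Open Scope ring_scope.
Local Open Scope complex_scope.

(* The product sigma-algebra on R^d, generated by the coordinates. *)
Section rV_measurable.
Context (R : realType) (d : nat).

Let coord (i : 'I_d) (x : 'rV[R]_d) : measurableTypeR R := x 0 i.

Let rV_set0 : g_sigma_preimage coord set0.
Proof. exact: sigma_algebra0. Qed.

Let rV_setC A : g_sigma_preimage coord A -> g_sigma_preimage coord (~` A).
Proof. exact: sigma_algebraC. Qed.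

Let rV_bigcup (F : (set 'rV[R]_d)^nat) :
  (forall i, g_sigma_preimage coord (F i)) ->
  g_sigma_preimage coord (\bigcup_i F i).
Proof. exact: sigma_algebra_bigcup. Qed.

HB.instance Definition _ :=
  @isMeasurable.Build (measure_tuple_display (R.-ocitv.-measurable).-sigma)
    'rV[R]_d (g_sigma_preimage coord) rV_set0 rV_setC rV_bigcup.

Lemma measurable_coord (i : 'I_d) :
  measurable_fun [set: 'rV[R]_d] (fun x : 'rV[R]_d => x 0 i).
Proof.
move=> _ Y mY; rewrite setTI; apply: sub_sigma_algebra => /=.
rewrite -bigcup_seq/=; exists i => /=; first by rewrite mem_index_enum.
by exists Y => //; rewrite setTI.
Qed.

End rV_measurable.

Lemma measurable_fun_rV (R : realType) (d : nat) (disp : measure_display)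
    (T : measurableType disp) (f : T -> 'rV[R]_d) :
  (forall i, measurable_fun [set: T] (fun t => f t 0 i)) ->
  measurable_fun [set: T] f.
Proof.
move=> mf _ Y mY; rewrite setTI; move: Y mY.
have -> : measurable = g_sigma_preimage
    (fun (i : 'I_d) (x : 'rV[R]_d) => (x 0 i : measurableTypeR R)) by [].
apply: smallest_sub.
  split; first by rewrite /= preimage_set0.
  - by move=> A mA /=; rewrite setTD preimage_setC; exact: measurableC.
  - by move=> F mF /=; rewrite preimage_bigcup; exact: bigcup_measurable.
rewrite -bigcup_seq => A [/= i _ [B mB <-]].
by rewrite setTI -[X in measurable X]setTI; exact: mf.
Qed.

(* The fundamental domain [0, 2 pi)^d of the torus, with the wrap-around
   (flat) distance. *)
Definition torus (R : realType) (d : nat) : set 'rV[R]_d :=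
  [set x | forall i, 0 <= x 0 i < 2 * pi].

Definition torus_dist (R : realType) (d : nat) (x y : 'rV[R]_d) : R :=
  Num.sqrt (\sum_(i < d)
    Num.min `|x 0 i - y 0 i| (2 * pi - `|x 0 i - y 0 i|) ^+ 2).

Definition circle_measure (R : realType) : set (measurableTypeR R) -> \bar R :=
  mrestr (@lebesgue_measure R) (measurable_itv `[0, 2 * pi[).

HB.instance Definition _ (R : realType) := Measure.on (@circle_measure R).

Lemma circle_measure_fin (R : realType) : fin_num_fun (@circle_measure R).
Proof.
move=> A mA; rewrite ge0_fin_numE//.
apply: (@le_lt_trans _ _ (lebesgue_measure `[(0:R), 2 * pi[)).
  by apply: le_measure; rewrite ?inE//=; exact: measurableI.
by rewrite lebesgue_measure_itv/=; case: ifP; rewrite ?ltry// -EFinD ltry.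
Qed.

HB.instance Definition _ (R : realType) :=
  @Measure_isFinite.Build _ _ R (@circle_measure R) (@circle_measure_fin R).

Section torus_measure_step.
Context (R : realType) (d : nat).
Variable mu : {finite_measure set 'rV[R]_d -> \bar R}.

Definition rV_cons (z : measurableTypeR R * 'rV[R]_d) : 'rV[R]_d.+1 :=
  \row_i (if unlift ord0 i is Some j then z.2 0 j else z.1).

Lemma measurable_rV_cons : measurable_fun setT rV_cons.
Proof.
apply: measurable_fun_rV => i; under eq_fun do rewrite mxE.
case: (unlift ord0 i) => [j|]; last exact: measurable_fst.
by apply: (measurableT_comp (measurable_coord j)); exact: measurable_snd.
Qed.

Let measurable_preimage (A : set 'rV[R]_d.+1) :
  measurable A -> measurable (rV_cons @^-1` A).
Proof.
by move=> mA; rewrite -[X in measurable X]setTI; exact: measurable_rV_cons.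
Qed.

Definition torus_step : set 'rV[R]_d.+1 -> \bar R :=
  pushforward (@circle_measure R \x mu)%E rV_cons.

Let torus_step0 : torus_step set0 = 0%E.
Proof. by rewrite /torus_step /pushforward preimage_set0 measure0. Qed.

Let torus_step_ge0 A : (0 <= torus_step A)%E.
Proof. by apply: integral_ge0 => x _; exact: measure_ge0. Qed.

Let torus_step_sigma_additive : semi_sigma_additive torus_step.
Proof.
move=> F mF tF mUF; rewrite /torus_step /pushforward preimage_bigcup.
apply: measure_semi_sigma_additive.
- by move=> n; exact: measurable_preimage.
- apply/trivIsetP => /= i j _ _ ij; rewrite -preimage_setI.
  by move/trivIsetP : tF => /(_ _ _ _ _ ij) ->//; rewrite preimage_set0.
- by rewrite -preimage_bigcup; exact: measurable_preimage.
Qed.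

HB.instance Definition _ := isMeasure.Build _ _ _ torus_step
  torus_step0 torus_step_ge0 torus_step_sigma_additive.

Let torus_step_fin : fin_num_fun torus_step.
Proof.
move=> A mA; rewrite ge0_fin_numE//.
apply: (@le_lt_trans _ _ ((@circle_measure R \x mu)%E setT)).
  apply: (@le_measure _ _ _ (@circle_measure R \x mu)%E); rewrite ?inE//.
  exact: measurable_preimage.
rewrite -setXTT product_measure1E//.
by rewrite -ge0_fin_numE ?mule_ge0// fin_numM//; exact: fin_num_measure.
Qed.

HB.instance Definition _ :=
  @Measure_isFinite.Build _ _ R torus_step torus_step_fin.

End torus_measure_step.

(* Lebesgue measure on the torus, as a measure on R^d carried by
   [0, 2 pi)^d: the d-fold product of Lebesgue measure on [0, 2 pi). *)
Fixpoint torus_measure (R : realType) (d : nat) :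
    {finite_measure set 'rV[R]_d -> \bar R} :=
  match d with
  | 0%N => \d_(0 : 'rV[R]_0)
  | d'.+1 => torus_step (torus_measure R d')
  end.

Lemma torus_measure_box (R : realType) (d : nat)
    (A : 'I_d -> set (measurableTypeR R)) :
  (forall i, measurable (A i)) ->
  torus_measure R d [set x : 'rV[R]_d | forall i, A i (x 0 i)] =
  (\prod_(i < d) lebesgue_measure (A i `&` `[0%R, (2 * pi)%R[))%E.
Proof.
elim: d A => [|d IHd] A mA.
  by rewrite big_ord0 /= diracE mem_set// => -[].
rewrite big_ord_recl /= /torus_step /pushforward.
have -> : @rV_cons R d @^-1` [set x : 'rV[R]_d.+1 | forall i, A i (x 0 i)] = A ord0 `*`
    [set x : 'rV[R]_d | forall i : 'I_d, A (lift ord0 i) (x 0 i)].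
  apply/seteqP; split => [[t x]/= tx|[t x]/= [A0 Ax] i].
    split; first by have := tx ord0; rewrite mxE unlift_none.
    by move=> i; have := tx (lift ord0 i); rewrite mxE liftK.
  by rewrite mxE; case: unliftP => [j ->|->].
have mbox : measurable [set x : 'rV[R]_d | forall i, A (lift ord0 i) (x 0 i)].
  rewrite (_ : [set _ | _] = \bigcap_(i in [set: 'I_d])
      ((fun x : 'rV[R]_d => x 0 i) @^-1` A (lift ord0 i))); last first.
    by apply/seteqP; split => [x Ax i _|x Ax i]; exact: Ax.
  apply: fin_bigcap_measurable => // i _.
  by have := @measurable_coord R d i measurableT _ (mA (lift ord0 i));
    rewrite setTI.
rewrite product_measure1E//; congr (_ * _)%E.
exact: (IHd (fun i => A (lift ord0 i))).
Qed.

Definition multi_norm (d : nat) (m : 'I_d -> nat) : nat := \sum_(i < d) m i.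

Definition partial (R : realType) (d : nat) (i : 'I_d) (g : 'rV[R]_d -> R) :
    'rV[R]_d -> R :=
  fun x => 'D_(delta_mx 0 i) g x.

(* D^m = d_0^(m 0) o ... o d_(d-1)^(m (d-1)); the partial derivatives commute
   on all the functions D^m is applied to. *)
Definition Dmulti (R : realType) (d : nat) (m : 'I_d -> nat)
    (g : 'rV[R]_d -> R) : 'rV[R]_d -> R :=
  foldr (fun i h => iter (m i) (partial i) h) g (enum 'I_d).

Fixpoint Ck (R : realType) (d : nat) (k : nat) (g : 'rV[R]_d -> R) : Prop :=
  continuous g /\
  if k is k'.+1 then
    forall i : 'I_d, (forall x, derivable g x (delta_mx 0 i)) /\
      Ck k' (partial i g)
  else True.

Definition periodic2pi (R : realType) (d : nat) (g : 'rV[R]_d -> R) : Prop :=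
  forall x (i : 'I_d), g (x + (2 * pi) *: delta_mx 0 i) = g x.

(* [g] is D^m f for a function f on the torus known up to a null set: f is
   a.e. equal to a C^|m| function on the torus, whose derivative is g.
   Such a version f0 is unique on the torus, and exists for every f in
   B^(s+|m|)_(r,q) as soon as s > d/r (Sobolev embedding). *)
Definition is_Dmulti (R : realType) (d : nat) (m : 'I_d -> nat)
    (f g : 'rV[R]_d -> R) : Prop :=
  exists f0 : 'rV[R]_d -> R,
    [/\ periodic2pi f0, Ck (multi_norm m) f0,
        {ae torus_measure R d, forall x, f x = f0 x}
      & g = Dmulti m f0].

Definition torus_exp (R : realType) (d : nat) (l : 'rV[int]_d)
    (x : 'rV[R]_d) : R[i] :=
  let t := \sum_(i < d) (l 0 i)%:~R * x 0 i in
  ((2 * pi) `^ (- (d%:R / 2)))%:C * (cos t +i* sin t).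

Definition freq_norm (R : realType) (d : nat) (l : 'rV[int]_d) : R :=
  Num.sqrt (\sum_(i < d) (l 0 i)%:~R ^+ 2).

Definition freq_band (R : realType) (d : nat) (B : R) (j : nat) :
    set 'rV[int]_d :=
  [set l | B ^ (j%:Z - 1) < freq_norm R l < B ^ (j%:Z + 1)].

(* A scale B, a window b, and for each level j a cubature (xi, lambda) with its
   pixels.  "Pixel k is centred at xi_k" is read as: xi_k lies in pixel k.  Two-sided bounds hold uniformly in (j, k). *)
Record needlet_system (R : realType) (d : nat) := NeedletSystem {
  ndB : R;
  ndb : R -> R;
  ndK : nat -> nat;
  ndxi : forall j, 'I_(ndK j) -> 'rV[R]_d;
  ndlam : forall j, 'I_(ndK j) -> R;
  ndpix : forall j, 'I_(ndK j) -> set 'rV[R]_d;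
  ndB_gt1 : 1 < ndB;
  ndb_ge0 : forall x, 0 <= ndb x;
  ndb_smooth : forall (k : nat) x, derivable (derive1n k ndb) x 1;
  ndb_support : forall x, ndb x != 0 -> ndB^-1 <= x <= ndB;
  ndb_unity : forall c, 1 < c ->
    (fun n : nat => \sum_(0 <= j < n) ndb (c / ndB ^+ j) ^+ 2) @ \oo --> (1 : R);
  ndxi_torus : forall j k, torus (@ndxi j k);
  ndlam_gt0 : forall j k, 0 < @ndlam j k;
  nd_exact : forall j (l l' : 'rV[int]_d),
    freq_band ndB j l -> freq_band ndB j l' ->
    \sum_(k < ndK j) (@ndlam j k)%:C * torus_exp l (@ndxi j k) *
      (torus_exp l' (@ndxi j k))^* = (l == l')%:R;
  ndpix_measurable : forall j k, measurable (@ndpix j k);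
  ndpix_disjoint : forall j, trivIset setT (@ndpix j);
  ndpix_cover : forall j, \bigcup_(k in [set: 'I_(ndK j)]) @ndpix j k = @torus R d;
  ndpix_center : forall j k, @ndpix j k (@ndxi j k);
  ndpix_area : forall j k, torus_measure R d (@ndpix j k) = (@ndlam j k)%:E;
  ndpix_diam : exists2 C : R, 0 < C & forall j k x y,
    @ndpix j k x -> @ndpix j k y -> torus_dist x y <= C / ndB ^+ j;
  ndlam_bounds : exists c C : R, [/\ 0 < c, 0 < C & forall j k,
    c / ndB ^+ (j * d) <= @ndlam j k <= C / ndB ^+ (j * d)];
  ndK_bounds : exists c C : R, [/\ 0 < c, 0 < C & forall j,
    c * ndB ^+ (j * d) <= (ndK j)%:R <= C * ndB ^+ (j * d)] }.

Arguments ndxi {R d} n {j} k.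
Arguments ndlam {R d} n {j} k.
Arguments ndpix {R d} n {j} k.

(* The sum is real, since freq_band and freq_norm are invariant under
   l |-> - l; taking the real part only changes the type. *)
Definition needlet (R : realType) (d : nat) (N : needlet_system R d)
    (j : nat) (k : 'I_(ndK N j)) (x : 'rV[R]_d) : R :=
  complex.Re ((Num.sqrt (ndlam N k))%:C *
    \sum_(l \in freq_band (ndB N) j)
      ((ndb N (freq_norm R l / ndB N ^+ j))%:C *
        (torus_exp l (ndxi N k))^* * torus_exp l x)).

Definition needlet_coef (R : realType) (d : nat) (N : needlet_system R d)
    (f : 'rV[R]_d -> R) (j : nat) (k : 'I_(ndK N j)) : R :=
  (\int[torus_measure R d]_x (f x * needlet k x))%R.

(* Trigonometric polynomials of degree at most t: frequencies of Euclidean norm at most t. *)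
Definition trig_poly (R : realType) (d : nat) (t : R) :
    set ('rV[R]_d -> R[i]) :=
  [set g | exists a : 'rV[int]_d -> R[i],
    g = fun x => \sum_(l \in [set l | freq_norm R l <= t]) (a l * torus_exp l x)].

(* complex.Re only turns the complex modulus, of type R[i], into an element
   of R. *)
Definition approx_error (R : realType) (d : nat) (t : R) (f : 'rV[R]_d -> R)
    (r : R) : \bar R :=
  ereal_inf [set Lnorm (torus_measure R d) r%:E
      (fun x => (complex.Re `|(f x)%:C - g x|)%:E) | g in trig_poly t].

Definition besov (R : realType) (d : nat) (N : needlet_system R d)
    (sigma r : R) (q : \bar R) (f : 'rV[R]_d -> R) : Prop :=
  [/\ measurable_fun setT f,
      (Lnorm (torus_measure R d) r%:E (EFin \o f) < +oo)%E
    & (Lnorm (@counting nat R) q (fun j : nat =>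
        (ndB N `^ (j%:R * sigma))%:E * approx_error (ndB N ^+ j) f r) < +oo)%E].

Definition besov_norm (R : realType) (d : nat) (N : needlet_system R d)
    (sigma r : R) (q : \bar R) (f : 'rV[R]_d -> R) : \bar R :=
  Lnorm (@counting nat R) q (fun j : nat =>
    (ndB N `^ (j%:R * (sigma + d%:R * (2^-1 - r^-1))) *
      (\sum_(k < ndK N j) `|needlet_coef f k| `^ r) `^ r^-1)%:E).

Definition besov_ball (R : realType) (d : nat) (N : needlet_system R d)
    (sigma r : R) (q : \bar R) (G : R) : set ('rV[R]_d -> R) :=
  [set f | besov N sigma r q f /\ (besov_norm N sigma r q f <= G%:E)%E].

(* Functions on the torus are functions on R^d of which only the values on
   [0, 2 pi)^d matter. *)
Record density (R : realType) (d : nat) := Density {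
  dens :> 'rV[R]_d -> R;
  dens_measurable : measurable_fun setT dens;
  dens_ge0 : forall x, torus x -> 0 <= dens x;
  dens_int1 : (\int[torus_measure R d]_x (dens x)%:E = 1)%E }.

Record iid_sample (R : realType) (d n : nat) (f : 'rV[R]_d -> R) := IidSample {
  smp_disp : measure_display;
  smp_space : measurableType smp_disp;
  smp_prob : probability smp_space R;
  smp : 'I_n -> {RV smp_prob >-> 'rV[R]_d};
  smp_law : forall i (A : set 'rV[R]_d), measurable A ->
    smp_prob (smp i @^-1` A) = (\int[torus_measure R d]_(x in A) (f x)%:E)%E;
  smp_indep : forall A : 'I_n -> set 'rV[R]_d, (forall i, measurable (A i)) ->
    smp_prob (\bigcap_(i in [set: 'I_n]) (smp i @^-1` A i)) =
    (\prod_(i < n) smp_prob (smp i @^-1` A i))%E }.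

Definition hard_threshold (R : realType) (u a : R) : R :=
  if a <= `|u| then u else 0.

Definition soft_threshold (R : realType) (u a : R) : R :=
  Num.max (`|u| - a) 0 * Num.sg u.

Section estimator.
Context (R : realType) (d : nat) (N : needlet_system R d) (m : 'I_d -> nat).
Context (kappa : R) (eta : R -> R -> R) (n : nat).

Definition coef_estimator (x : 'I_n -> 'rV[R]_d) (j : nat)
    (k : 'I_(ndK N j)) : R :=
  (-1) ^+ multi_norm m / n%:R *
  \sum_(i < n) Dmulti m (needlet k) (x i).

Definition threshold (j : nat) : R :=
  kappa * ndB N ^+ (j * multi_norm m) * Num.sqrt (ln n%:R / n%:R).

Definition cutoff : nat :=
  Num.truncn ((d + 2 * multi_norm m)%:R^-1 * (ln (n%:R / ln n%:R) / ln (ndB N))).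

Definition density_estimator (x : 'I_n -> 'rV[R]_d) (t : 'rV[R]_d) : R :=
  \sum_(0 <= j < cutoff) \sum_(k < ndK N j)
    eta (coef_estimator x k) (threshold j) * needlet k t.

Definition Lp_loss (p : \bar R) (g : 'rV[R]_d -> R) (x : 'I_n -> 'rV[R]_d) :
    \bar R :=
  Lnorm (torus_measure R d) p (fun t => (density_estimator x t - g t)%:E).

Definition Lp_risk (p : R) (f : 'rV[R]_d -> R) (X : iid_sample n f)
    (g : 'rV[R]_d -> R) : \bar R :=
  (\int[smp_prob X]_w (Lp_loss p%:E g (fun i => smp X i w) `^ p))%E.

Definition Loo_risk (f : 'rV[R]_d -> R) (X : iid_sample n f)
    (g : 'rV[R]_d -> R) : \bar R :=
  (\int[smp_prob X]_w Lp_loss +oo g (fun i => smp X i w))%E.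

End estimator.

Definition rate (R : realType) (s m d p r : R) : R :=
  if (2 * m + d) * p / (2 * (s + m) + d) <= r
  then p * s / (2 * (s + m) + d)
  else p * (s + d * (p^-1 - r^-1)) / (2 * ((s + m) + d * (2^-1 - r^-1))).

Definition rate_oo (R : realType) (s m d r : R) : R :=
  (s - d / r) / (2 * ((s + m) - d * (r^-1 - 2^-1))).

(* Main.v *)
(* Since [|eta u tau| <= u^2 / tau], a threshold [tau_j ~ B^(j|m|) (log n / n)^(1/2)]
   suppresses all coefficients of the size [B^(j|m|) n^(-1/2)] of the noise, so one bad
   density for each [n] suffices.  Take [f = (2 pi)^(-d) + gamma h], where [h] is a wave packet
   of frequencies [|l| ~ B^j0]: a single frequency in the dense regime, all of them with
   coefficients [b (|l| / B^j0)] in the sparse regime, where [h] has height [B^(j0 d)] and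
   is concentrated at the scale [B^(-j0)].  The largest [gamma] for which the coefficients
   of [gamma h] have size [n^(-1/2)] and [f] stays in the Besov ball fixes [B^j0] as a power
   of [n].  As the estimator misses most of [gamma D^m h], testing its error against
   [D^m h] bounds all the risks from below.  The sparse packet is localized by
   [|h x| <= K B^(j0 d) prod_i (1 + (B^j0 sin (x_i / 2))^2)^(-1)], which follows from
   [2 d] summations by parts in one coordinate.  For the finitely many small [n], the level
   [j0] is taken beyond the cutoff of the estimator. *)

Require Import Defs.
From HB Require Import structures.
From mathcomp Require Import all_boot all_order all_algebra.
From mathcomp Require Import complex.
From mathcomp Require Import all_classical all_reals all_analysis.
From mathcomp Require Import measurable_realfun ess_sup_inf.
From mathcomp Require Import ring lra zify.

Import Order.TTheory GRing.Theory Num.Theory.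
Import numFieldNormedType.Exports.

Local Open Scope classical_set_scope.
Local Open Scope ring_scope.

Set Implicit Arguments.
Unset Strict Implicit.
Unset Printing Implicit Defensive.

(** * Bounded measurable functions *)

(** A coefficient at noise size has second moment of order [B^(2 j mm) / n], so its thresholded
    value has mean absolute value of order at most [B^(j mm) / (n log n)^(1/2)]. This is smaller
    than the signal by the factor [(log n)^(-1/2)], which for large [n] beats every constant of the
    needlets, of the threshold and of the packets. Hence second moments suffice and no deviation
    inequality occurs. Both regimes fit one scheme: a packet of height [V] carried by a set of
    measure [1 / V], with [V = 1] or [V = B^(j0 d)]. The Besov norm, the noise and the risks depend
    on the packet only through [V], its level and one constant. The obstacle is that this constant
    must be uniform in the level although needlet coefficients are values at cubature points, which
    an [L^1] bound does not control. A single frequency has bounded values, but the sparse packet is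
    as high as [B^(j0 d)]. It is therefore bounded by an integrable weight that varies by a bounded
    factor on each pixel, so that cubature sums compare with integrals. *)

Lemma eq_ler (R : numDomainType) (x y : R) : x = y -> x <= y.
Proof. by move=> ->. Qed.

Section bounded_measurable.
Context d (T : measurableType d) (R : realType).
Implicit Types f g : T -> R.

(** The integrands and the estimated coefficients lie in this algebra. On a finite measure space its
    members are integrable, so integrals can be computed in [R] with membership as the only side
    condition. *)
Definition bounded_meas f :=
  measurable_fun setT f /\ exists M, forall x, `|f x| <= M.

Lemma bounded_meas_cst (c : R) : bounded_meas (fun=> c).
Proof. by split=> //; exists `|c|. Qed.

Lemma bounded_measD f g : bounded_meas f -> bounded_meas g ->
  bounded_meas (fun x => f x + g x).
Proof.
move=> [mf [M fM]] [mg [M' gM]]; split; first exact: measurable_funD.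
by exists (M + M') => x; rewrite (le_trans (ler_normD _ _))// lerD.
Qed.

Lemma bounded_measM f g : bounded_meas f -> bounded_meas g ->
  bounded_meas (fun x => f x * g x).
Proof.
move=> [mf [M fM]] [mg [M' gM]]; split; first exact: measurable_funM.
by exists (M * M') => x; rewrite normrM ler_pM.
Qed.

Lemma bounded_measZ (c : R) f : bounded_meas f -> bounded_meas (fun x => c * f x).
Proof. exact: bounded_measM (bounded_meas_cst c). Qed.

Lemma bounded_measN f : bounded_meas f -> bounded_meas (fun x => - f x).
Proof.
by move=> [mf [M fM]]; split; [exact: measurable_funN|exists M => x; rewrite normrN].
Qed.

Lemma bounded_measB f g : bounded_meas f -> bounded_meas g ->
  bounded_meas (fun x => f x - g x).
Proof. by move=> bf /bounded_measN; exact: bounded_measD. Qed.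

Lemma bounded_meas_norm f : bounded_meas f -> bounded_meas (fun x => `|f x|).
Proof.
move=> [mf [M fM]]; split; first exact: measurableT_comp.
by exists M => x; rewrite normr_id.
Qed.

Lemma bounded_meas_sum (I : eqType) (s : seq I) (P : pred I) (F : I -> T -> R) :
  (forall i, i \in s -> P i -> bounded_meas (F i)) ->
  bounded_meas (fun x => \sum_(i <- s | P i) F i x).
Proof.
elim: s => [_|i s IH bF].
  by under eq_fun do rewrite big_nil; exact: bounded_meas_cst.
under eq_fun do rewrite big_cons.
have bs : bounded_meas (fun x => \sum_(j <- s | P j) F j x).
  by apply: IH => j js; apply: bF; rewrite inE js orbT.
case Pi : (P i); last exact: bs.
by apply: bounded_measD => //; apply: bF; rewrite ?inE ?eqxx.
Qed.

Lemma bounded_measX f n : bounded_meas f -> bounded_meas (fun x => f x ^+ n).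
Proof.
move=> bf; elim: n => [|n IH].
  by under eq_fun do rewrite expr0; exact: bounded_meas_cst.
by under eq_fun do rewrite exprS; exact: bounded_measM.
Qed.

Variable mu : {finite_measure set T -> \bar R}.

Lemma bounded_meas_integrable f : bounded_meas f -> mu.-integrable setT (EFin \o f).
Proof.
move=> [mf [M fM]]; apply: measurable_bounded_integrable => //.
- by rewrite ltey_eq fin_num_measure.
- exists M; split; first exact: num_real.
  by move=> y My x _ /=; rewrite (le_trans (fM x))// ltW.
Qed.

Lemma bounded_integral f : bounded_meas f ->
  (\int[mu]_x (f x)%:E)%E = (\int[mu]_x f x)%:E.
Proof.
move=> bf; rewrite /Rintegral fineK//.
exact: integrable_fin_num (bounded_meas_integrable bf).
Qed.

Lemma bounded_integralD f g : bounded_meas f -> bounded_meas g ->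
  \int[mu]_x (f x + g x) = \int[mu]_x f x + \int[mu]_x g x.
Proof. by move=> bf bg; rewrite RintegralD//; exact: bounded_meas_integrable. Qed.

Lemma bounded_integralB f g : bounded_meas f -> bounded_meas g ->
  \int[mu]_x (f x - g x) = \int[mu]_x f x - \int[mu]_x g x.
Proof. by move=> bf bg; rewrite RintegralB//; exact: bounded_meas_integrable. Qed.

Lemma bounded_integralZ (c : R) f : bounded_meas f ->
  \int[mu]_x (c * f x) = c * \int[mu]_x f x.
Proof. by move=> bf; rewrite RintegralZl//; exact: bounded_meas_integrable. Qed.

Lemma bounded_integral_sum (I : eqType) (s : seq I) (P : pred I)
    (F : I -> T -> R) : (forall i, i \in s -> P i -> bounded_meas (F i)) ->
  \int[mu]_x (\sum_(i <- s | P i) F i x) = \sum_(i <- s | P i) \int[mu]_x F i x.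
Proof.
elim: s => [_|i s IH bF].
  by under eq_Rintegral do rewrite big_nil; rewrite Rintegral_cst// mul0r big_nil.
under eq_Rintegral do rewrite big_cons.
have bF' j : j \in s -> P j -> bounded_meas (F j).
  by move=> js; apply: bF; rewrite inE js orbT.
rewrite big_cons; case: ifPn => [Pi|_]; last exact: IH.
rewrite bounded_integralD ?IH//; last exact: bounded_meas_sum.
by apply: bF; rewrite ?inE ?eqxx.
Qed.

Lemma bounded_le_integral f g : bounded_meas f -> bounded_meas g ->
  (forall x, f x <= g x) -> \int[mu]_x f x <= \int[mu]_x g x.
Proof.
by move=> bf bg fg; apply: le_Rintegral => //; exact: bounded_meas_integrable.
Qed.

Lemma bounded_le_norm_integral f : bounded_meas f ->
  `|\int[mu]_x f x| <= \int[mu]_x `|f x|.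
Proof.
by move=> bf; apply: le_normr_Rintegral => //; exact: bounded_meas_integrable.
Qed.

Lemma bounded_integral_norm_le f (M : R) : bounded_meas f ->
  (forall x, `|f x| <= M) -> `|\int[mu]_x f x| <= M * fine (mu setT).
Proof.
move=> bf fM; rewrite (le_trans (bounded_le_norm_integral bf))//.
rewrite -Rintegral_cst//; apply: bounded_le_integral => //.
- exact: bounded_meas_norm.
- exact: bounded_meas_cst.
Qed.

End bounded_measurable.
Arguments bounded_meas_cst {d T R}.

Lemma bounded_meas_comp d d' (T : measurableType d) (T' : measurableType d')
    (R : realType) (f : T' -> R) (h : T -> T') :
  measurable_fun setT h -> bounded_meas f -> bounded_meas (fun x => f (h x)).
Proof.
move=> mh [mf [M fM]]; split; last by exists M => x; exact: fM.
exact: (measurableT_comp mf mh).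
Qed.

Lemma bounded_integral_pushforward d d' (T : measurableType d)
    (T' : measurableType d') (R : realType)
    (mu : {finite_measure set T -> \bar R}) (h : T -> T') (f : T' -> R) :
  measurable_fun setT h -> bounded_meas f ->
  (\int[pushforward mu h]_y (f y)%:E)%E = (\int[mu]_x f (h x))%:E.
Proof.
move=> mh bf; rewrite integral_pushforward//=; last 2 first.
- by apply/measurable_EFinP; exact: bf.1.
- exact: (bounded_meas_integrable mu (bounded_meas_comp mh bf)).
by rewrite preimage_setT bounded_integral//; exact: bounded_meas_comp.
Qed.

Section fubini_bounded.
Context d d' (X : measurableType d) (Y : measurableType d') (R : realType).
Variables (m1 : {finite_measure set X -> \bar R}).
Variables (m2 : {finite_measure set Y -> \bar R}).
Variable f : X * Y -> R.
Hypothesis bf : bounded_meas f.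

Lemma bounded_meas_prodr y : bounded_meas (fun x => f (x, y)).
Proof.
by apply: (@bounded_meas_comp _ _ _ _ _ f (fun x => (x, y))) => //; exact: pair2_measurable.
Qed.

Lemma bounded_integrable_prod : (m1 \x m2)%E.-integrable setT (EFin \o f).
Proof.
have [mf [M fM]] := bf; apply: measurable_bounded_integrable => //=.
- rewrite -setXTT product_measure1E//.
  by rewrite -ge0_fin_numE ?mule_ge0// fin_numM// fin_num_measure.
- exists M; split; first exact: num_real.
  by move=> y My x _ /=; rewrite (le_trans (fM x))// ltW.
Qed.

Lemma bounded_meas_fubini : bounded_meas (fun y => \int[m1]_x f (x, y)).
Proof.
have [_ [M fM]] := bf; split.
  apply/measurable_EFinP => /=.
  rewrite (_ : EFin \o _ = fun y => (\int[m1]_x (f (x, y))%:E)%E); last first.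
    apply/funext => y /=; rewrite bounded_integral//.
    exact: bounded_meas_prodr.
  exact: (measurable_fubini_G bounded_integrable_prod).
exists (M * fine (m1 setT)) => y.
by apply: bounded_integral_norm_le => //; exact: bounded_meas_prodr.
Qed.

Lemma bounded_fubini :
  (\int[m1 \x m2]_z (f z)%:E)%E = (\int[m2]_y (\int[m1]_x f (x, y)))%:E.
Proof.
rewrite -(integral21_prod_meas1 bounded_integrable_prod) -bounded_integral; last first.
  exact: bounded_meas_fubini.
apply: eq_integral => y _ /=; rewrite /fubini_G bounded_integral//.
exact: bounded_meas_prodr.
Qed.

End fubini_bounded.

(** * Integration on the torus *)

Section circle.
Context (R : realType).
Local Notation circ := (@circle_measure R).
Local Notation leb := (@lebesgue_measure R).

Lemma continuous_bounded_meas (f : R -> R) (M : R) :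
  continuous f -> (forall x, `|f x| <= M) ->
  bounded_meas (f : measurableTypeR R -> R).
Proof.
by move=> cf fM; split; [exact: continuous_measurable_fun | exists M].
Qed.

Lemma bounded_meas_integrable_itv (f : measurableTypeR R -> R) (i : interval R) :
  [set` i] `<=` `[0, 2 * pi] -> bounded_meas f -> leb.-integrable [set` i] (EFin \o f).
Proof.
move=> iD [mf [M fM]]; have mi := measurable_itv i; apply: measurable_bounded_integrable => //=.
- apply: (@le_lt_trans _ _ (leb `[0, 2 * pi])); first by apply: le_measure; rewrite ?inE.
  by rewrite lebesgue_measure_itv/=; case: ifP; rewrite ?ltry// -EFinD ltry.
- exact: measurable_funTS.
- exists M; split; first exact: num_real.
  by move=> y My x _ /=; rewrite (le_trans (fM x))// ltW.
Qed.

(** The fundamental theorem of calculus wants the closed interval; the added end point is a null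
    set. *)
Lemma circle_integral (f : measurableTypeR R -> R) : bounded_meas f ->
  \int[circ]_t f t = \int[leb]_(t in `[0, 2 * pi]) f t.
Proof.
move=> bf; have mD := measurable_itv `[(0:R), 2 * pi[.
have mf : measurable_fun setT f by case: bf.
rewrite -(@Rintegral_itv_bndo_bndc _ (BLeft 0) (2 * pi) f); last first.
  apply: bounded_meas_integrable_itv bf => x /=.
  by rewrite !in_itv/= => /andP[-> /ltW].
rewrite /Rintegral; congr fine.
rewrite (@negligible_integral _ _ _ circ setT (~` `[0, 2 * pi[%classic)
  (EFin \o f))//.
- rewrite setTD setCK; apply: eq_measure_integral => A mA AD.
  by rewrite /= /circle_measure /mrestr setIidl.
- exact: measurableC.
- exact: bounded_meas_integrable.
- by rewrite /= /circle_measure /mrestr setICl measure0.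
Qed.

Lemma circle_setT : fine (circ setT) = 2 * pi.
Proof.
rewrite /circle_measure /mrestr setTI lebesgue_measure_itv/= lte_fin.
by rewrite mulr_gt0 ?pi_gt0// -EFinB subr0.
Qed.

Lemma integral_is_derive (F f : R -> R) (a b : R) : a < b ->
  (forall x : R, is_derive x (1 : R) F (f x)) -> continuous f ->
  \int[leb]_(t in `[a, b]) f t = F b - F a.
Proof.
move=> ab dF cf; rewrite /Rintegral (@continuous_FTC2 _ f F)//.
- exact: continuous_subspaceT.
- have cF : continuous F.
    by move=> x; apply/differentiable_continuous/derivable1_diffP; case: (dF x).
  split=> [x _||]; first by case: (dF x).
  + exact: cvg_at_right_filter (cF a).
  + exact: cvg_at_left_filter (cF b).
- by move=> x _; rewrite derive1E derive_val.
Qed.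

Lemma circle_integral_derive (F f : R -> R) (M : R) :
  (forall x : R, is_derive x (1 : R) F (f x)) -> continuous f -> (forall x, `|f x| <= M) ->
  \int[circ]_t f t = F (2 * pi) - F 0.
Proof.
move=> dF cf fM; rewrite circle_integral; last exact: continuous_bounded_meas cf fM.
by rewrite (integral_is_derive (F := F))// mulr_gt0 ?pi_gt0.
Qed.

Lemma cosDint2pi (k : int) (x : R) : cos (x + k%:~R * (2 * pi)) = cos x.
Proof.
have H (n : nat) (y : R) : cos (y + n%:R * (2 * pi)) = cos y.
  elim: n => [|n IH]; first by rewrite mul0r addr0.
  rewrite -natr1 mulrDl mul1r addrA [X in _ + X]mulr_natl.
  by rewrite cosD2pi IH.
case: k => [n|n]; first by rewrite -pmulrn H.
by rewrite NegzE mulrNz mulNr -(H n.+1 (x - _)) -pmulrn subrK.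
Qed.

Lemma sinDint2pi (k : int) (x : R) : sin (x + k%:~R * (2 * pi)) = sin x.
Proof. by rewrite -!cosBpihalf addrAC cosDint2pi. Qed.

Lemma continuous_affine (k c : R) : continuous (fun t : R => k * t + c).
Proof. by move=> t; apply: cvgD; [apply: cvgMr; exact: cvg_id|exact: cvg_cst]. Qed.

Lemma is_derive_affine (k c x : R) : is_derive x (1 : R) (fun t : R => k * t + c) k.
Proof.
rewrite -[X in is_derive _ _ _ X]addr0.
apply: (@is_deriveD _ _ _ (fun t : R => k * t) (cst c)).
rewrite -[X in is_derive _ _ _ X]mulr1.
exact: (@is_deriveZ _ _ _ id k x 1 1).
Qed.

(** Used with [F = sin] for the orthogonality of the cosines and with [F = atan] for the mass of
    [circle_weight]. *)
Lemma circle_integral_affine (F f : R -> R) (M a b : R) : a != 0 ->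
  (forall x : R, is_derive x (1 : R) F (f x)) -> continuous f -> (forall x, `|f x| <= M) ->
  \int[circ]_t f (a * t + b) = a^-1 * F (a * (2 * pi) + b) - a^-1 * F b.
Proof.
move=> a0 dF cf fM; pose G (t : R) := a^-1 * F (a * t + b).
transitivity (G (2 * pi) - G 0); last by rewrite /G mulr0 add0r.
apply: (@circle_integral_derive G _ M) => [t|t|t]; last exact: fM.
  rewrite -[f _](mulKf a0); apply: is_deriveZ; rewrite [X in is_derive _ _ _ X]mulrC.
  exact: (@is_derive1_comp _ F _ t _ _ (dF _) (is_derive_affine a b t)).
by apply: continuous_comp; [exact: continuous_affine|exact: cf].
Qed.

Lemma circle_integral_cos (k : int) (c : R) :
  \int[circ]_t cos (k%:~R * t + c) = (k == 0)%:R * (2 * pi) * cos c.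
Proof.
have [->|k0] := eqVneq k 0.
  under eq_Rintegral do rewrite mul0r add0r.
  by rewrite Rintegral_cst// circle_setT mul1r mulrC.
rewrite (circle_integral_affine (F := @sin R) (M := 1)) ?intr_eq0//.
- by rewrite [_ + c]addrC sinDint2pi subrr !mul0r.
- exact: continuous_cos.
- exact: cos_max.
Qed.

End circle.

Section torus_integral.
Context (R : realType).

Lemma torus_setT d : fine (torus_measure R d setT) = (2 * pi) ^+ d.
Proof.
have := @torus_measure_box R d (fun=> setT) (fun=> measurableT).
rewrite (_ : [set x | _] = setT) => [->|]; last by apply/seteqP; split.
rewrite (eq_bigr (fun=> (2 * pi)%:E)) => [|i _].
  by rewrite -(big_mkord xpredT (fun=> (2 * pi)%:E)) prodEFin prodr_const_nat subn0.
rewrite setTI lebesgue_measure_itv/= lte_fin.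
by rewrite mulr_gt0 ?pi_gt0// -EFinB subr0.
Qed.

Lemma bounded_meas_rV_cons d (f : 'rV[R]_d.+1 -> R) : bounded_meas f ->
  bounded_meas (fun z : measurableTypeR R * 'rV[R]_d => f (rV_cons z)).
Proof. exact: bounded_meas_comp (@measurable_rV_cons R d). Qed.

Lemma torus_integralS d (f : 'rV[R]_d.+1 -> R) : bounded_meas f ->
  \int[torus_measure R d.+1]_x f x =
  \int[torus_measure R d]_x \int[@circle_measure R]_t f (rV_cons (t, x)).
Proof.
move=> bf; have bg := bounded_meas_rV_cons bf.
rewrite {1}/Rintegral /= /torus_step.
transitivity (fine (\int[pushforward (@circle_measure R \x torus_measure R d)%E
    (@rV_cons R d)]_x (f x)%:E)%E).
  by congr fine; apply: eq_measure_integral.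
rewrite integral_pushforward//=; last 3 first.
- exact: measurable_rV_cons.
- by apply/measurable_EFinP; exact: bf.1.
- exact: bounded_integrable_prod bg.
by rewrite preimage_setT bounded_fubini.
Qed.

Definition freq_dot d (l : 'rV[int]_d) (x : 'rV[R]_d) : R :=
  \sum_(i < d) (l 0 i)%:~R * x 0 i.

Lemma measurable_freq_dot d (l : 'rV[int]_d) : measurable_fun setT (freq_dot l).
Proof.
apply: measurable_sum => i; apply: measurable_funM => //.
exact: measurable_coord.
Qed.

Lemma bounded_meas_cos d (l : 'rV[int]_d) (c : R) :
  bounded_meas (fun x => cos (freq_dot l x + c)).
Proof.
split; last by exists 1 => x; exact: cos_max.
apply: (@measurableT_comp _ _ _ _ _ _ (@cos R)).
  by apply: continuous_measurable_fun; exact: continuous_cos.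
by apply: measurable_funD => //; exact: measurable_freq_dot.
Qed.

Lemma torus_integral_cos d (l : 'rV[int]_d) (c : R) :
  \int[torus_measure R d]_x cos (freq_dot l x + c) =
  (l == 0)%:R * (2 * pi) ^+ d * cos c.
Proof.
elim: d l c => [|d IH] l c.
  rewrite (_ : l == 0); last by apply/eqP/rowP => -[].
  under eq_Rintegral do rewrite /freq_dot big_ord0 add0r.
  by rewrite Rintegral_cst// torus_setT mul1r mulrC.
rewrite torus_integralS; last exact: bounded_meas_cos.
pose l' : 'rV[int]_d := \row_j l 0 (lift ord0 j).
have dotE t x : freq_dot l (rV_cons (t, x)) = (l 0 ord0)%:~R * t + freq_dot l' x.
  rewrite /freq_dot big_ord_recl mxE unlift_none; congr (_ + _).
  by apply: eq_bigr => j _; rewrite !mxE liftK.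
under eq_Rintegral => x _.
  under eq_Rintegral do rewrite dotE -addrA.
  rewrite circle_integral_cos.
  over.
rewrite bounded_integralZ; last exact: bounded_meas_cos.
rewrite IH.
transitivity ((l 0 ord0 == 0)%:R * (l' == 0)%:R * (2 * pi) ^+ d.+1 * cos c).
  by rewrite exprS; ring.
congr (_ * _ * _).
rewrite -natrM mulnb; congr (_ %:R); congr nat_of_bool.
apply/andP/eqP => [[/eqP l0 /eqP l0']|l0].
  by apply/rowP => i; case: (unliftP ord0 i) => [j ->|->]; rewrite ?mxE//;
    have /rowP/(_ j) := l0'; rewrite !mxE.
by split; apply/eqP; [rewrite l0 mxE|apply/rowP => j; rewrite /l' l0 !mxE].
Qed.

Lemma bounded_meas_torus_prod (w : R -> R) n :
  bounded_meas (w : measurableTypeR R -> R) ->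
  bounded_meas (fun x : 'rV[R]_n => \prod_(i < n) w (x 0 i)).
Proof.
move=> bw; elim: n => [|n IH].
  by under eq_fun do rewrite big_ord0; exact: bounded_meas_cst.
under eq_fun do rewrite big_ord_recr /=.
apply: bounded_measM; last first.
  exact: bounded_meas_comp (@measurable_coord R _ _) bw.
pose pr (x : 'rV[R]_n.+1) : 'rV[R]_n := \row_i x 0 (widen_ord (leqnSn n) i).
have mpr : measurable_fun setT pr.
  apply: measurable_fun_rV => i; under eq_fun do rewrite mxE.
  exact: measurable_coord.
have := bounded_meas_comp mpr IH; congr bounded_meas.
by apply/funext => x; apply: eq_bigr => i _; rewrite mxE.
Qed.

Lemma torus_integral_prod d (w : R -> R) :
  bounded_meas (w : measurableTypeR R -> R) ->
  \int[torus_measure R d]_x (\prod_(i < d) w (x 0 i)) =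
  (\int[@circle_measure R]_t w t) ^+ d.
Proof.
move=> bw; have bp n := bounded_meas_torus_prod n bw.
elim: d => [|d IH].
  under eq_Rintegral do rewrite big_ord0.
  by rewrite Rintegral_cst// torus_setT mul1r !expr0.
rewrite torus_integralS//.
have E (x : 'rV[R]_d) :
    \int[@circle_measure R]_t (\prod_(i < d.+1) w (rV_cons (t, x) 0 i)) =
    (\int[@circle_measure R]_t w t) * \prod_(i < d) w (x 0 i).
  rewrite mulrC -(bounded_integralZ _ (\prod_(i < d) w (x 0 i)) bw).
  apply: eq_Rintegral => t _.
  rewrite big_ord_recl mxE unlift_none mulrC; congr (_ * _).
  by apply: eq_bigr => i _; rewrite mxE liftK.
under eq_Rintegral do rewrite E.
by rewrite bounded_integralZ// IH exprS.
Qed.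

(** Jordan's inequality with a weaker constant. On [[0, 1]] the mean value theorem gives the slope
    [cos 1]; beyond [1] the sine increases while [u <= 2], which costs the factor [1 / 2]. *)
Lemma sin_ge_linear (u : R) : 0 <= u <= pi / 2 -> cos 1 / 2 * u <= sin u.
Proof.
have c1 := @cos1_gt0 R.
have small (v : R) : 0 <= v <= 1 -> cos 1 * v <= sin v.
  move=> /andP[v0 v1]; move: v0; rewrite le_eqVlt => /predU1P[<-|v0].
    by rewrite mulr0 sin0.
  have [z] := MVT v0 (fun x _ => is_derive_sin x)
    (continuous_subspaceT (@continuous_sin R)).
  rewrite in_itv/= => /andP[z0 zv]; rewrite sin0 !subr0 => ->.
  rewrite ler_wpM2r ?(ltW v0)//.
  have pi2 := @pihalf_ge1 R.
  have z1 : z < 1 by rewrite (lt_le_trans zv).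
  by rewrite ltW// ltr_cos ?in_itv//=; apply/andP; split; lra.
have pi2 := @pihalf_02 R; have pi1 := @pihalf_ge1 R.
move=> /andP[u0 u2]; have [u1|u1] := leP u 1.
  by rewrite (le_trans _ (small _ _)) ?u0// ler_wpM2r//; lra.
have s1 : cos 1 <= sin 1 :> R by rewrite (le_trans _ (small 1 _)) ?mulr1 ?lexx ?ler01.
have : sin 1 < sin u by rewrite ltr_sin ?in_itv/=//; apply/andP; split; lra.
move/ltW; apply: le_trans; apply: le_trans s1.
rewrite mulrAC ler_pdivrMr// ler_wpM2l ?(ltW c1)//; lra.
Qed.

Lemma circle_integral_le (f g : measurableTypeR R -> R) :
  bounded_meas f -> bounded_meas g ->
  (forall t, 0 <= t <= 2 * pi -> f t <= g t) ->
  \int[@circle_measure R]_t f t <= \int[@circle_measure R]_t g t.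
Proof.
move=> bf bg fg; rewrite !circle_integral//.
apply: le_Rintegral; [exact: measurable_itv|exact: bounded_meas_integrable_itv..|].
by move=> t /=; rewrite in_itv/=; exact: fg.
Qed.

(** A periodic version of [(1 + (A t)^2)^-1]: a bump of height [1] and width [1 / A] around the
    point [0] of the circle. *)
Definition circle_weight (A : R) (t : R) : R := (1 + (A * sin (t / 2)) ^+ 2)^-1.

Lemma invr_oneDsqr_le1 (u : R) : 0 <= (1 + u ^+ 2)^-1 <= 1.
Proof.
have u2 := sqr_ge0 u; rewrite invr_ge0 invf_le1; last by lra.
by apply/andP; split; lra.
Qed.

Lemma bounded_meas_invr_oneDsqr (f : R -> R) : continuous f ->
  bounded_meas ((fun t => (1 + f t ^+ 2)^-1) : measurableTypeR R -> R).
Proof.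
move=> cf; apply: (@continuous_bounded_meas _ _ 1) => [t|t].
  apply: cvgV; first by rewrite gt_eqF//; have := sqr_ge0 (f t); lra.
  apply: cvgD; first exact: cvg_cst.
  by rewrite expr2; under eq_fun do rewrite expr2; apply: cvgM; exact: cf.
by have /andP[u0 u1] := invr_oneDsqr_le1 (f t); rewrite ger0_norm.
Qed.

Lemma bounded_meas_circle_weight A :
  bounded_meas (circle_weight A : measurableTypeR R -> R).
Proof.
apply: bounded_meas_invr_oneDsqr => t.
apply: cvgM; first exact: cvg_cst.
apply: continuous_comp; last exact: continuous_sin.
by apply: cvgM; [exact: cvg_id|exact: cvg_cst].
Qed.

Lemma circle_weight_gt0 A t : 0 < circle_weight A t.
Proof. by rewrite invr_gt0; have := sqr_ge0 (A * sin (t / 2)); lra. Qed.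

(** On [[0, pi]] the weight lies below [(1 + (k t)^2)^-1], on [[pi, 2 pi]] below its reflection. The
    primitive [atan] is bounded, and the scaling by [k] gives the factor [1 / A]. *)
Lemma circle_weight_integral : exists2 C : R, 0 < C &
  forall A, 0 < A -> \int[@circle_measure R]_t circle_weight A t <= C / A.
Proof.
have c1 := @cos1_gt0 R; have pi0 := @pi_gt0 R.
(* The constant of [sin_ge_linear], read at [u = t / 2]. *)
pose c : R := cos 1 / 4.
have c0 : 0 < c by rewrite /c; lra.
exists (2 * pi / c) => [|A A0]; first by rewrite divr_gt0 ?mulr_gt0.
pose k := A * c; have k0 : 0 < k by rewrite mulr_gt0.
pose g1 (t : R) := (1 + (k * t + 0) ^+ 2)^-1.
pose g2 (t : R) := (1 + (- k * t + k * (2 * pi)) ^+ 2)^-1.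
have b1 := bounded_meas_invr_oneDsqr (@continuous_affine R k 0).
have b2 := bounded_meas_invr_oneDsqr (@continuous_affine R (- k) (k * (2 * pi))).
have atan_int (a b : R) : a != 0 ->
    \int[@circle_measure R]_t ((1 + (a * t + b) ^+ 2)^-1) =
    a^-1 * atan (a * (2 * pi) + b) - a^-1 * atan b.
  move=> a0; apply: (circle_integral_affine (F := @atan R)
    (f := fun t : R => (1 + t ^+ 2)^-1) (M := 1)) => // t.
    apply: cvgV; first by rewrite gt_eqF//; have := sqr_ge0 t; lra.
    by apply: cvgD; [exact: cvg_cst|exact: exprn_continuous].
  by have /andP[u0 u1] := invr_oneDsqr_le1 t; rewrite ger0_norm.
have atan_le (x : R) : atan x <= pi / 2 by exact/ltW/atan_ltpi2.
have pt t : 0 <= t <= 2 * pi -> circle_weight A t <= g1 t + g2 t.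
  move=> /andP[t0 t2].
  have key (u : R) : 0 <= u <= pi / 2 -> (1 + (A * sin u) ^+ 2)^-1 <= (1 + (k * (2 * u)) ^+ 2)^-1.
    move=> u01; have /andP[u0 _] := u01; have := sin_ge_linear u01 => su.
    have k2 : 0 <= k * (2 * u) by rewrite !mulr_ge0// ltW.
    have kA : k * (2 * u) <= A * sin u.
      rewrite /k -mulrA ler_wpM2l ?(ltW A0)//; apply: le_trans su.
      by rewrite /c; apply: eq_ler; field.
    have sq : (k * (2 * u)) ^+ 2 <= (A * sin u) ^+ 2.
      by rewrite ler_sqr ?nnegrE// (le_trans k2).
    by rewrite lef_pV2 ?posrE; [lra| |]; have := sqr_ge0 (k * (2 * u)); lra.
  have p1 : 0 <= g1 t by have /andP[] := invr_oneDsqr_le1 (k * t + 0).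
  have p2 : 0 <= g2 t.
    by have /andP[] := invr_oneDsqr_le1 (- k * t + k * (2 * pi)).
  have [tp|tp] := leP t pi.
    have : circle_weight A t <= g1 t.
      apply: (le_trans (key (t / 2) _)); first by apply/andP; split; lra.
      by rewrite /g1 addr0 [2 * _]mulrC divfK.
    by lra.
  have : circle_weight A t <= g2 t.
    have -> : circle_weight A t = (1 + (A * sin (pi - t / 2)) ^+ 2)^-1.
      by rewrite /circle_weight sinB sinpi cospi mul0r mulN1r sub0r opprK.
    apply: (le_trans (key (pi - t / 2) _)); first by apply/andP; split; lra.
    rewrite /g2; apply: eq_ler; congr (_ + _ ^+ _)^-1.
    by field.
  by lra.
have := circle_integral_le (bounded_meas_circle_weight A) (bounded_measD b1 b2) pt.
move=> /le_trans; apply.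
rewrite bounded_integralD// !atan_int ?oppr_eq0 ?gt_eqF//.
rewrite [k * (2 * pi) + 0]addr0 mulNr addNr atan0 !mulr0 subr0 sub0r.
rewrite invrN mulNr opprK.
have kV : 0 < k^-1 by rewrite invr_gt0.
have h : k^-1 * atan (k * (2 * pi)) <= k^-1 * (pi / 2).
  by rewrite ler_wpM2l// ltW.
rewrite (le_trans (lerD h h))//.
have -> : 2 * pi / c / A = k^-1 * (2 * pi).
  rewrite /k -/c; clearbody c; field.
  by rewrite !gt_eqF.
by rewrite -mulrDr ler_wpM2l ?(ltW kV)//; lra.
Qed.

End torus_integral.

(** * Trigonometric polynomials and needlets *)

Section indicator_sums.
Context (R : realType) (I : eqType).
Implicit Types (s : seq I) (a : I).

Lemma sum_indicator s (F : I -> R) a : uniq s ->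
  \sum_(i <- s) (i == a)%:R * F i = (a \in s)%:R * F a.
Proof.
move=> us; have [sa|sa] := boolP (a \in s).
  by rewrite (bigD1_seq a)//= eqxx big1 ?addr0// => i /negbTE ->; rewrite mul0r.
rewrite mul0r big_seq big1// => i si.
by case: eqP => [e|]; rewrite ?mul0r//; move: sa; rewrite -e si.
Qed.

Lemma sum_indicator_le1 s a : uniq s -> \sum_(i <- s) (i == a)%:R <= 1 :> R.
Proof.
move=> /(sum_indicator (fun=> 1) a); under eq_bigr do rewrite mulr1.
by move=> ->; rewrite mulr1; case: (a \in s).
Qed.

End indicator_sums.

Section continuity.
Context (R : realType) (T : topologicalType).
Implicit Types f g : T -> R.

Lemma continuous_add f g : continuous f -> continuous g ->
  continuous (fun x => f x + g x).
Proof. by move=> cf cg x; apply: cvgD; [exact: cf|exact: cg]. Qed.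

Lemma continuous_scal (k : R) f : continuous f -> continuous (fun x => k * f x).
Proof. by move=> cf x; apply: cvgM; [exact: cvg_cst|exact: cf]. Qed.

Lemma continuous_sum_seq (I : Type) (r : seq I) (F : I -> T -> R) :
  (forall i, continuous (F i)) -> continuous (fun x => \sum_(i <- r) F i x).
Proof.
move=> cF; elim: r => [|i r IH].
  have -> : (fun x : T => \sum_(i <- [::]) F i x) = cst 0.
    by apply/funext => x; rewrite big_nil.
  exact: cst_continuous.
have -> : (fun x => \sum_(j <- i :: r) F j x) =
    (fun x => F i x + \sum_(j <- r) F j x).
  by apply/funext => x; rewrite big_cons.
exact: continuous_add.
Qed.

End continuity.

Section trigonometric_polynomials.
Context (R : realType) (d : nat).
Implicit Types (s : seq 'rV[int]_d) (a c : 'rV[int]_d -> R) (l : 'rV[int]_d).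
Local Notation vec := 'rV[R]_d.

(** Real form with a phase for each frequency: a partial derivative multiplies the amplitude by
    [l_i] and advances the phase by [pi / 2], so the family is closed under [Dmulti]. *)
Definition tpoly s a c (x : vec) : R :=
  \sum_(l <- s) a l * cos (freq_dot l x + c l).

Definition freq_mono (m : 'I_d -> nat) l : R :=
  \prod_(i < d) (l 0 i)%:~R ^+ m i.

Lemma freq_dotD l (x y : vec) : freq_dot l (x + y) = freq_dot l x + freq_dot l y.
Proof.
by rewrite /freq_dot -big_split/=; apply: eq_bigr => i _; rewrite mxE mulrDr.
Qed.

Lemma freq_dotZ l (k : R) (x : vec) : freq_dot l (k *: x) = k * freq_dot l x.
Proof.
by rewrite /freq_dot mulr_sumr; apply: eq_bigr => i _; rewrite mxE mulrCA.
Qed.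

Lemma freq_dot_delta l i : freq_dot l (delta_mx 0 i : vec) = (l 0 i)%:~R.
Proof.
rewrite /freq_dot (bigD1 i)//= mxE !eqxx mulr1 big1 ?addr0// => j ji.
by rewrite mxE (negbTE ji) andbF mulr0.
Qed.

Lemma freq_dotN l (x : vec) : freq_dot (- l) x = - freq_dot l x.
Proof.
by rewrite /freq_dot -sumrN; apply: eq_bigr => i _; rewrite mxE mulrNz mulNr.
Qed.

Lemma freq_dotDl l l' (x : vec) : freq_dot (l + l') x = freq_dot l x + freq_dot l' x.
Proof.
by rewrite /freq_dot -big_split/=; apply: eq_bigr => i _; rewrite mxE intrD mulrDl.
Qed.

Lemma freq_dot0 (x : vec) : freq_dot 0 x = 0.
Proof. by rewrite /freq_dot big1// => i _; rewrite mxE mul0r. Qed.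

Lemma is_derive_line (f : vec -> R) (x v : vec) (f' : R) :
  is_derive (0 : R) (1 : R) (fun h => f (h *: v + x)) f' -> is_derive x v f f'.
Proof.
move=> [df <-].
have E : (fun h : R => h^-1 *: ((f \o shift x) (h *: v) - f x)) =
    (fun h : R => h^-1 *: (((fun h => f (h *: v + x)) \o shift (0 : R)) (h *: (1 : R)) -
      f (0 *: v + x))).
  apply/funext => h /=; rewrite scale0r add0r.
  by rewrite /GRing.scale /= mulr1 addr0.
by split; rewrite /derivable /derive E.
Qed.

Lemma is_derive_tpoly s a c i (x : vec) :
  is_derive x (delta_mx 0 i : vec) (tpoly s a c)
    (tpoly s (fun l => a l * (l 0 i)%:~R) (fun l => c l + pi / 2) x).
Proof.
apply: is_derive_line.
rewrite /tpoly; elim: s => [|l s IH].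
  under eq_fun do rewrite big_nil; rewrite big_nil.
  exact: is_derive_cst.
under eq_fun do rewrite big_cons; rewrite big_cons.
apply: (@is_deriveD _ _ _ (fun h : R => a l * cos (freq_dot l (h *: delta_mx 0 i + x) + c l))).
  rewrite -mulrA; apply: is_deriveZ.
  under eq_fun do rewrite freq_dotD freq_dotZ freq_dot_delta -addrA mulrC.
  rewrite addrA cosDpihalf mulrC -[X in - sin X]add0r -[X in - sin (X + _)](mulr0 (l 0 i)%:~R).
  exact: (@is_derive1_comp _ (@cos R) _ 0 _ _ (is_derive_cos _)
      (is_derive_affine (l 0 i)%:~R (freq_dot l x + c l) 0)).
Qed.

Lemma partial_tpoly s a c i : partial i (tpoly s a c) =
  tpoly s (fun l => a l * (l 0 i)%:~R) (fun l => c l + pi / 2).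
Proof.
by apply/funext => x; rewrite /partial; have := is_derive_tpoly s a c i x => -[].
Qed.

Lemma eq_tpoly s a a' c c' : {in s, forall l, a l = a' l} ->
  {in s, forall l, c l = c' l} -> tpoly s a c = tpoly s a' c'.
Proof.
move=> aa cc; apply/funext => x; apply: eq_big_seq => l ls.
by rewrite aa// cc.
Qed.

Lemma iter_partial_tpoly k s a c i : iter k (partial i) (tpoly s a c) =
  tpoly s (fun l => a l * (l 0 i)%:~R ^+ k) (fun l => c l + k%:R * (pi / 2)).
Proof.
elim: k => [|k IH] /=.
  by apply: eq_tpoly => l _; rewrite ?expr0 ?mulr1// mul0r addr0.
rewrite IH partial_tpoly; apply: eq_tpoly => l _.
  by rewrite exprSr mulrA.
by rewrite -[k.+1%:R]natr1 [in RHS]mulrDl mul1r addrA.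
Qed.

Lemma Dmulti_tpoly (m : 'I_d -> nat) s a c : Dmulti m (tpoly s a c) =
  tpoly s (fun l => a l * freq_mono m l) (fun l => c l + (multi_norm m)%:R * (pi / 2)).
Proof.
rewrite /Dmulti; transitivity (tpoly s (fun l => a l * \prod_(i <- enum 'I_d) (l 0 i)%:~R ^+ m i)
    (fun l => c l + (\sum_(i <- enum 'I_d) m i)%:R * (pi / 2))).
  elim: (enum 'I_d) => [|i e IH] /=.
    by apply: eq_tpoly => l _; rewrite ?big_nil ?mulr1// mul0r addr0.
  rewrite IH iter_partial_tpoly; apply: eq_tpoly => l _; rewrite big_cons.
    by rewrite mulrAC -mulrA.
  by rewrite [in RHS]natrD; ring.
by apply: eq_tpoly => l _; rewrite big_enum.
Qed.

Lemma continuous_freq_dot l : continuous (@freq_dot R d l).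
Proof.
by apply: continuous_sum_seq => i; apply: continuous_scal; exact: coord_continuous.
Qed.

Lemma continuous_tpoly s a c : continuous (tpoly s a c).
Proof.
apply: continuous_sum_seq => l; apply: continuous_scal => x.
apply: continuous_comp; last exact: continuous_cos.
move: x; apply: continuous_add; first exact: continuous_freq_dot.
exact: cst_continuous.
Qed.

Lemma Ck_tpoly k s a c : Ck k (tpoly s a c).
Proof.
elim: k s a c => [|k IH] s a c; split=> //=; try exact: continuous_tpoly.
move=> i; split; last by rewrite partial_tpoly.
by move=> x; have := is_derive_tpoly s a c i x => -[].
Qed.

Lemma periodic_tpoly s a c : periodic2pi (tpoly s a c).
Proof.
move=> x i; apply: eq_big_seq => l _; congr (_ * _).
rewrite freq_dotD freq_dotZ freq_dot_delta addrAC.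
by rewrite [2 * pi * _]mulrC cosDint2pi.
Qed.

Lemma bounded_meas_tpoly s a c : bounded_meas (tpoly s a c).
Proof.
apply: bounded_meas_sum => l _ _; apply: bounded_measZ; exact: bounded_meas_cos.
Qed.

Lemma tpoly_le s a c x : `|tpoly s a c x| <= \sum_(l <- s) `|a l|.
Proof.
rewrite (le_trans (ler_norm_sum _ _ _))//; apply: ler_sum => l _.
by rewrite normrM -[leRHS]mulr1 ler_wpM2l//; exact: cos_max.
Qed.

Lemma torus_integral_cos2 l l' (c c' : R) :
  \int[torus_measure R d]_x (cos (freq_dot l x + c) * cos (freq_dot l' x + c')) =
  (2 * pi) ^+ d / 2 * ((l' == - l)%:R * cos (c + c') + (l' == l)%:R * cos (c - c')).
Proof.
transitivity (2^-1 * (\int[torus_measure R d]_x (cos (freq_dot (l + l') x + (c + c')) +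
   cos (freq_dot (l - l') x + (c - c'))))).
  rewrite -bounded_integralZ; last first.
    by apply: bounded_measD; exact: bounded_meas_cos.
  apply: eq_Rintegral => x _; rewrite !freq_dotDl freq_dotN.
  have cosE (u v p q : R) : cos (u + p) * cos (v + q) =
      2^-1 * (cos (u + v + (p + q)) + cos (u - v + (p - q))).
    rewrite addrACA [u - v + _](addrACA u) -opprD.
    by rewrite (cosD (u + p) (v + q)) (cosB (u + p) (v + q)); field.
  exact: cosE.
rewrite bounded_integralD; [|exact: bounded_meas_cos..].
rewrite !torus_integral_cos subr_eq0 [l == l']eq_sym.
have -> : (l + l' == 0) = (l' == - l) by rewrite addrC addr_eq0.
by ring.
Qed.

(* Only the frequencies [l' = l] and [l' = - l] interact with [l]. *)
Lemma tpoly_inner s a c s' a' c' : uniq s' ->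
  \int[torus_measure R d]_x (tpoly s a c x * tpoly s' a' c' x) =
  (2 * pi) ^+ d / 2 * \sum_(l <- s) a l *
    ((- l \in s')%:R * (a' (- l) * cos (c l + c' (- l))) +
     (l \in s')%:R * (a' l * cos (c l - c' l))).
Proof.
move=> us'.
transitivity (\int[torus_measure R d]_x (\sum_(l <- s) \sum_(l' <- s')
    ((a l * a' l') * (cos (freq_dot l x + c l) * cos (freq_dot l' x + c' l'))))).
  apply: eq_Rintegral => x _; rewrite /tpoly mulr_suml; apply: eq_bigr => l _.
  by rewrite mulr_sumr; apply: eq_bigr => l' _; rewrite mulrACA.
have bcc l l' : bounded_meas (fun x : vec =>
    cos (freq_dot l x + c l) * cos (freq_dot l' x + c' l')).
  by apply: bounded_measM; exact: bounded_meas_cos.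
rewrite bounded_integral_sum; last first.
  by move=> l _ _; apply: bounded_meas_sum => l' _ _; exact: bounded_measZ.
rewrite mulr_sumr; apply: eq_bigr => l _.
rewrite bounded_integral_sum; last by move=> l' _ _; exact: bounded_measZ.
under eq_bigr do rewrite bounded_integralZ// torus_integral_cos2.
rewrite -(sum_indicator (fun l' => a' l' * cos (c l + c' l')) (- l) us').
rewrite -(sum_indicator (fun l' => a' l' * cos (c l - c' l')) l us').
rewrite -big_split/= !mulr_sumr.
by apply: eq_bigr => l' _; ring.
Qed.

(** The matching frequencies [l] and [- l] contribute at most one half each, since [a'] has an even
    modulus. *)
Lemma tpoly_inner_le s a c s' a' c' : uniq s' ->
  (forall l, `|a' (- l)| = `|a' l|) ->
  `|\int[torus_measure R d]_x (tpoly s a c x * tpoly s' a' c' x)| <=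
  (2 * pi) ^+ d * \sum_(l <- s) `|a l| * `|a' l|.
Proof.
move=> us' ea'; rewrite tpoly_inner// normrM.
have P0 : 0 <= (2 * pi) ^+ d :> R by rewrite exprn_ge0// mulr_ge0 ?pi_ge0.
rewrite ger0_norm; last by rewrite divr_ge0.
rewrite -mulrA ler_wpM2l//.
rewrite mulrC ler_pdivrMr//.
rewrite (le_trans (ler_norm_sum _ _ _))// mulr_suml.
apply: ler_sum => l _; rewrite normrM -mulrA ler_wpM2l//.
have B (b : bool) u v : `|b%:R * (u * cos v)| <= `|u| :> R.
  rewrite !normrM; have := cos_max v; case: b => v1; last first.
    by rewrite normr0 mul0r.
  by rewrite normr1 mul1r -[leRHS]mulr1 ler_wpM2l.
rewrite (le_trans (ler_normD _ _))// mulr_natr mulr2n lerD//.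
by rewrite -(ea' l).
Qed.

Lemma freq_monoN m l : freq_mono m (- l) = (-1) ^+ multi_norm m * freq_mono m l.
Proof.
rewrite /freq_mono /multi_norm expr_sum -big_split/=; apply: eq_bigr => i _.
by rewrite mxE mulrNz [LHS]exprNn.
Qed.

Lemma cos_natpi (n : nat) : cos (n%:R * pi) = (-1) ^+ n :> R.
Proof.
elim: n => [|n IH]; first by rewrite mul0r cos0 expr0.
by rewrite -natr1 mulrDl mul1r cosDpi IH exprSr mulrN1.
Qed.

Lemma tpoly_norm2_ge s (H : 'rV[int]_d -> R) m :
  uniq s -> (forall l, H (- l) = H l) ->
  (2 * pi) ^+ d / 2 * \sum_(l <- s) (H l * freq_mono m l) ^+ 2 <=
  \int[torus_measure R d]_x (Dmulti m (tpoly s H (fun=> 0)) x) ^+ 2.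
Proof.
move=> us eH; rewrite Dmulti_tpoly; under eq_Rintegral do rewrite expr2.
rewrite tpoly_inner//; apply: ler_wpM2l.
  by rewrite divr_ge0// exprn_ge0// mulr_ge0 ?pi_ge0.
rewrite [leRHS]big_seq [leLHS]big_seq.
apply: ler_sum => l ls; rewrite ls mul1r !add0r subrr cos0 mulr1 eH freq_monoN.
have -> : (multi_norm m)%:R * (pi / 2) + (multi_norm m)%:R * (pi / 2) =
  (multi_norm m)%:R * pi :> R by field.
rewrite cos_natpi.
set A := H l * freq_mono m l.
have -> : H l * ((-1) ^+ multi_norm m * freq_mono m l) * (-1) ^+ multi_norm m = A.
  by rewrite mulrCA mulrAC -expr2 -exprM mulnC exprM sqrrN expr1n expr1n mul1r.
rewrite mulrDr mulrCA -!expr2 lerDr mulr_ge0// ?sqr_ge0//.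
Qed.

End trigonometric_polynomials.

Lemma exprn_ge_linear (R : realFieldType) (b : R) (n : nat) : 1 <= b ->
  n%:R * (b - 1) <= b ^+ n.
Proof.
move=> b1; elim: n => [|n IH]; first by rewrite mul0r expr0.
rewrite exprS -natr1; have : 1 <= b ^+ n by rewrite exprn_ege1.
have : 0 <= b - 1 by lra.
by move=> h1 h2; have := ler_wpM2l h1 h2; lra.
Qed.

(** * Lattice points and frequency norms *)

Section lattice.
Context (R : realType) (d : nat).
Implicit Types l : 'rV[int]_d.

(** A duplicate-free list that can carry a whole frequency band. Amplitudes vanish off the band, so
    the surplus frequencies of the cube are harmless. *)
Definition int_box (n : nat) : seq 'rV[int]_d :=
  [seq \row_i ((f i : nat)%:Z - n%:Z) | f : {ffun 'I_d -> 'I_(n.*2.+1)}].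

Lemma mem_int_box n l : (forall i, `|l 0 i| <= n%:Z) -> l \in int_box n.
Proof.
move=> ln; have lt i : (absz (l 0%R i + n%:Z)%R < n.*2.+1)%N.
  by have := ln i; lia.
apply/mapP; exists [ffun i => Ordinal (lt i)]; first by rewrite mem_enum.
by apply/rowP => i; rewrite mxE ffunE /=; have := ln i; lia.
Qed.

Lemma uniq_int_box n : uniq (int_box n).
Proof.
rewrite map_inj_uniq ?enum_uniq// => f g /rowP fg; apply/ffunP => i.
have := fg i; rewrite !mxE => /addIr/eqP; rewrite eqz_nat => /eqP.
exact: val_inj.
Qed.

Lemma size_int_box n : size (int_box n) = (n.*2.+1 ^ d)%N.
Proof. by rewrite size_map -cardE card_ffun !card_ord. Qed.

Lemma sum_int_box_le n (F : 'rV[int]_d -> R) (M : R) :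
  (forall l, F l <= M) -> \sum_(l <- int_box n) F l <= M * (n.*2.+1)%:R ^+ d.
Proof.
move=> FM; apply: (@le_trans _ _ (\sum_(l <- int_box n) M)).
  by apply: ler_sum => l _.
by rewrite big_const_seq count_predT size_int_box iter_addr addr0 -natrX mulr_natr.
Qed.

Lemma freq_norm_ge0 l : 0 <= freq_norm R l.
Proof. exact: sqrtr_ge0. Qed.

Lemma freq_normN l : freq_norm R (- l) = freq_norm R l.
Proof.
by congr Num.sqrt; apply: eq_bigr => i _; rewrite mxE mulrNz sqrrN.
Qed.

Lemma sum_sqr_ge0 l : 0 <= \sum_(i < d) ((l 0 i)%:~R : R) ^+ 2.
Proof. by apply: sumr_ge0 => i _; exact: sqr_ge0. Qed.

Lemma freq_norm_sqr l : freq_norm R l ^+ 2 = \sum_(i < d) ((l 0 i)%:~R : R) ^+ 2.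
Proof. by rewrite sqr_sqrtr// sum_sqr_ge0. Qed.

Lemma coord_le_freq_norm l i : `|(l 0 i)%:~R| <= freq_norm R l.
Proof.
rewrite -ler_sqr ?nnegrE ?normr_ge0 ?freq_norm_ge0// freq_norm_sqr.
rewrite real_normK ?num_real// (bigD1 i)//= lerDl.
by apply: sumr_ge0 => j _; exact: sqr_ge0.
Qed.

Lemma freq_norm_le_mem n l : freq_norm R l <= n%:R -> l \in int_box n.
Proof.
move=> ln; apply: mem_int_box => i.
have := le_trans (coord_le_freq_norm l i) ln.
by rewrite -intr_norm pmulrn ler_int.
Qed.

Lemma freq_norm0 : freq_norm R (0 : 'rV[int]_d) = 0.
Proof.
by rewrite /freq_norm big1 ?sqrtr0// => i _; rewrite mxE expr2 mulr0.
Qed.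

Lemma freq_mono_le (m : 'I_d -> nat) l (t : R) :
  freq_norm R l <= t -> `|freq_mono R m l| <= t ^+ multi_norm m.
Proof.
move=> lt; rewrite /freq_mono normr_prod /multi_norm expr_sum.
apply: ler_prod => i _; rewrite normr_ge0 normrX lerXn2r ?nnegrE//.
- exact: le_trans (freq_norm_ge0 _) lt.
- exact: le_trans (coord_le_freq_norm l i) lt.
Qed.

Lemma freq_mono0 (m : 'I_d -> nat) : (0 < multi_norm m)%N ->
  freq_mono R m (0 : 'rV[int]_d) = 0.
Proof.
move=> m0; have [i mi] : exists i, (0 < m i)%N.
  apply/existsP; move: m0; apply: contraLR; rewrite negb_exists => /forallP m0.
  by rewrite -eqn0Ngt; apply/eqP/big1 => i _; have := m0 i; lia.
by apply/eqP/prodf_eq0; exists i => //; rewrite mxE expr0n eqn0Ngt mi.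
Qed.

Lemma finite_freq_norm_le (t : R) : finite_set [set l : 'rV[int]_d | freq_norm R l <= t].
Proof.
have [n tn] : exists n : nat, t <= n%:R.
  by exists (Num.truncn t).+1; rewrite ltW// truncnS_gt.
apply: (@sub_finite_set _ _ [set` int_box n]); last exact: finite_seq.
by move=> l /= lt; apply: freq_norm_le_mem; exact: le_trans tn.
Qed.

End lattice.
Arguments int_box d n : clear implicits.

(** * Needlets as trigonometric polynomials *)

Section needlet_formulas.
Context (R : realType) (d : nat) (N : needlet_system R d).
Local Notation B := (ndB N).
Local Notation b := (ndb N).

Implicit Types l : 'rV[int]_d.

Lemma ndB_gt0 : 0 < B.
Proof. by rewrite (lt_trans ltr01)// ndB_gt1. Qed.

Lemma ndBX_gt0 j : 0 < B ^+ j.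
Proof. by rewrite exprn_gt0// ndB_gt0. Qed.

Lemma ndBX_ge1 j : 1 <= B ^+ j.
Proof. by rewrite exprn_ege1// ltW// ndB_gt1. Qed.

Lemma ndBX_large (t : R) : exists j1, forall j, (j1 <= j)%N -> t < B ^+ j.
Proof.
have B1 : 0 < B - 1 by rewrite subr_gt0 ndB_gt1.
exists (Num.truncn (t / (B - 1))).+1 => j jj.
apply: lt_le_trans (exprn_ge_linear j (ltW (ndB_gt1 N))).
by rewrite -ltr_pdivrMr//; apply: lt_le_trans (truncnS_gt _) _; rewrite ler_nat.
Qed.

Lemma continuous_ndb : continuous b.
Proof.
move=> x; apply/differentiable_continuous/derivable1_diffP.
by have := @ndb_smooth R d N 0%N x; rewrite derive1n0.
Qed.

Lemma ndb_out x : x <= B^-1 \/ B <= x -> b x = 0.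
Proof.
have B0 := ndB_gt0; have B1 := ndB_gt1 N.
have BV : B^-1 < B by rewrite (lt_trans _ B1)// invf_lt1.
(* at the two end points of the support, [b] vanishes by continuity *)
move=> xB; apply/eqP; apply/negPn/negP => bx.
have := @continuous_ndb x => /(_ [set y | y != 0]).
have oU : open [set y : R | y != 0].
  by rewrite (_ : [set _ | _] = ~` [set 0]); [exact/closed_openC/closed_eq|
    apply/seteqP; split => y /= /eqP].
case=> [|e /= e0 He]; first exact: open_nbhs_nbhs.
case: xB => xB.
- have H : b (x - e / 2) != 0.
    by apply: He; rewrite /= opprD addrA subrr sub0r opprK gtr0_norm; lra.
  by have /andP[+ _] := ndb_support H; lra.
- have H : b (x + e / 2) != 0.
    by apply: He; rewrite /= opprD addrA subrr sub0r normrN gtr0_norm; lra.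
  by have /andP[_ +] := ndb_support H; lra.
Qed.

Lemma ndb_le : exists2 M : R, 0 < M & forall x, b x <= M.
Proof.
have B0 := ndB_gt0; have B1 := ndB_gt1 N.
have BV : B^-1 <= B by rewrite ltW// (lt_trans _ B1)// invf_lt1.
have [c _ cmax] := EVT_max BV (continuous_subspaceT continuous_ndb).
exists (b c + 1) => [|x]; first by rewrite ltr_wpDl// ndb_ge0.
have [xB|xB] := boolP (B^-1 <= x <= B).
  by rewrite (le_trans (cmax x _)) ?in_itv// lerDl.
rewrite ndb_out ?addr_ge0 ?ndb_ge0//.
by move: xB; rewrite negb_and -!ltNge => /orP[/ltW|/ltW]; [left|right].
Qed.

Definition band_mult (j : nat) (l : 'rV[int]_d) : R := b (freq_norm R l / B ^+ j).

Lemma band_multN j l : band_mult j (- l) = band_mult j l.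
Proof. by rewrite /band_mult freq_normN. Qed.

(** The band is open and the support of [b] is only known to lie in a closed interval; [ndb_out]
    disposes of the end points. *)
Lemma band_mult_neq0 j l : band_mult j l != 0 -> freq_band B j l.
Proof.
have B0 := ndB_gt0; have Bj := ndBX_gt0 j.
move=> bl; rewrite /freq_band /= exprzDr ?unitfE ?gt_eqF// exprzDr ?unitfE ?gt_eqF//.
rewrite expr1z -exprnP -invr_expz expr1z.
apply/andP; split; rewrite ltNge; apply/negP => h; move: bl; rewrite /band_mult ndb_out ?eqxx//.
- by left; rewrite ler_pdivrMr// mulrC.
- by right; rewrite ler_pdivlMr// mulrC.
Qed.

Lemma freq_band_sub j l : freq_band B j l ->
  B ^+ j < freq_norm R l * B /\ freq_norm R l < B ^+ j.+1.
Proof.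
have B0 := ndB_gt0.
rewrite /freq_band /= exprzDr ?unitfE ?gt_eqF// exprzDr ?unitfE ?gt_eqF//.
rewrite expr1z -exprnP -invr_expz expr1z => /andP[h1 h2].
by split; [rewrite -ltr_pdivrMr|rewrite exprSr].
Qed.

Definition band_radius (j : nat) : nat := (Num.truncn (B ^+ j.+1)).+1.

Lemma band_radius_ge j : B ^+ j.+1 <= (band_radius j)%:R.
Proof. by rewrite ltW// truncnS_gt. Qed.

Lemma freq_band_box j l : freq_band B j l -> l \in int_box d (band_radius j).
Proof.
move=> /freq_band_sub[_ h]; apply: (@freq_norm_le_mem R).
exact: le_trans (ltW h) (band_radius_ge j).
Qed.

Lemma band_radius_le j : (band_radius j).*2.+1%:R <= (2 * B + 3) * B ^+ j.
Proof.
have h := ndBX_ge1 j; have h1 := ndBX_gt0 j.+1.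
have := truncn_itv (ltW h1) => /andP[+ _].
have -> : (band_radius j).*2.+1%:R = 2 * ((Num.truncn (B ^+ j.+1))%:R + 1) + 1 :> R.
  by rewrite -natr1 -muln2 natrM natr1 mulrC.
rewrite exprS => hB.
have B0 := ndB_gt0; have : 3 <= 3 * B ^+ j by lra.
by lra.
Qed.

Lemma complex_Re_sum (I : Type) (s : seq I) (F : I -> R[i]) :
  complex.Re (\sum_(i <- s) F i) = \sum_(i <- s) complex.Re (F i).
Proof.
elim: s => [|i s IH]; first by rewrite !big_nil.
by rewrite !big_cons -IH; case: (F i); case: (\sum_(_ <- _) _).
Qed.

Definition needlet_phase j (k : 'I_(ndK N j)) (l : 'rV[int]_d) : R :=
  - freq_dot l (ndxi N k).

Definition needlet_mult j (k : 'I_(ndK N j)) (l : 'rV[int]_d) : R :=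
  Num.sqrt (ndlam N k) * ((2 * pi) ^+ d)^-1 * band_mult j l.

(** The real part of [conj (S_l xi) * S_l x] is [(2 pi)^(-d) cos (l . (x - xi))], and the sum over
    the band extends to the cube because [b] vanishes in between. *)
Lemma needletE j (k : 'I_(ndK N j)) : needlet k =
  tpoly (int_box d (band_radius j)) (needlet_mult k) (needlet_phase k).
Proof.
apply/funext => x; rewrite /needlet /tpoly.
have -> : \sum_(l \in freq_band B j)
      ((ndb N (freq_norm R l / ndB N ^+ j))%:C%C *
        (torus_exp l (ndxi N k))^* * torus_exp l x) =
   \sum_(l <- int_box d (band_radius j))
      ((ndb N (freq_norm R l / ndB N ^+ j))%:C%C *
        (torus_exp l (ndxi N k))^* * torus_exp l x).
  rewrite [RHS]fsbig_seq ?uniq_int_box//; apply: fsbig_widen.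
    by move=> l /freq_band_box.
  move=> l [_ /= nl]; rewrite -/(band_mult j l).
  suff -> : band_mult j l = 0 by rewrite !mul0r.
  by apply/eqP/negPn/negP => /band_mult_neq0.
rewrite mulr_sumr complex_Re_sum; apply: eq_bigr => l _.
rewrite /needlet_mult /needlet_phase /torus_exp -/(freq_dot l x) -/(freq_dot l (ndxi N k)).
have P : (2 * pi) `^ (- (d%:R / 2)) * (2 * pi) `^ (- (d%:R / 2)) = ((2 * pi) ^+ d)^-1 :> R.
  have p0 : 0 < 2 * pi :> R by rewrite mulr_gt0 ?pi_gt0.
  rewrite -powRD ?(gt_eqF p0) ?implybT//.
  by rewrite -opprD -splitr powRN powR_mulrn// ltW.
rewrite -P cosB /band_mult /=.
by ring.
Qed.

(** Pairing with a needlet filters by [band_mult] and samples at the cubature point. Sums over the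
    coefficients thus become cubature sums. *)
Lemma needlet_inner j (k : 'I_(ndK N j)) (s : seq 'rV[int]_d) (a c : 'rV[int]_d -> R) :
  \int[torus_measure R d]_x (tpoly s a c x * needlet k x) =
  Num.sqrt (ndlam N k) *
    tpoly s (fun l => a l * band_mult j l) c (ndxi N k).
Proof.
rewrite needletE tpoly_inner ?uniq_int_box// /tpoly !mulr_sumr.
apply: eq_bigr => l _; rewrite /needlet_mult /needlet_phase band_multN freq_dotN.
have P0 : (2 * pi) ^+ d != 0 :> R by rewrite gt_eqF// exprn_gt0// mulr_gt0 ?pi_gt0.
have [bl0|bl] := eqVneq (band_mult j l) 0.
  by rewrite bl0 !(mulr0, mul0r, addr0).
rewrite (freq_band_box (band_mult_neq0 bl)).
rewrite freq_band_box; last by apply: band_mult_neq0; rewrite band_multN.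
rewrite !mul1r !opprK [c l + _]addrC.
move: P0 (cos _) => P0 C; move: ((2 * pi) ^+ d) P0 => P P0.
by field.
Qed.

Lemma Dmulti_needletE (m : 'I_d -> nat) j (k : 'I_(ndK N j)) :
  Dmulti m (needlet k) = tpoly (int_box d (band_radius j))
    (fun l => needlet_mult k l * freq_mono R m l)
    (fun l => needlet_phase k l + (multi_norm m)%:R * (pi / 2)).
Proof. by rewrite needletE Dmulti_tpoly. Qed.

Lemma bounded_meas_needlet j (k : 'I_(ndK N j)) : bounded_meas (needlet k).
Proof. by rewrite needletE; exact: bounded_meas_tpoly. Qed.

Lemma bounded_meas_Dneedlet m j (k : 'I_(ndK N j)) : bounded_meas (Dmulti m (needlet k)).
Proof. by rewrite Dmulti_needletE; exact: bounded_meas_tpoly. Qed.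

Lemma band_mult_mono_le (M : R) (m : 'I_d -> nat) j l : 0 <= M ->
  (forall x, b x <= M) ->
  `|band_mult j l * freq_mono R m l| <= M * B ^+ (j.+1 * multi_norm m).
Proof.
move=> M0 bM; have [->|bl] := eqVneq (band_mult j l) 0.
  by rewrite mul0r normr0 mulr_ge0// ltW// ndBX_gt0.
have [_ /ltW lB] := freq_band_sub (band_mult_neq0 bl).
rewrite normrM exprM ler_pM//; last exact: freq_mono_le.
by rewrite ger0_norm ?ndb_ge0//; exact: bM.
Qed.

Lemma needlet_multE m j (k : 'I_(ndK N j)) l :
  needlet_mult k l * freq_mono R m l =
  Num.sqrt (ndlam N k) * ((2 * pi) ^+ d)^-1 * (band_mult j l * freq_mono R m l).
Proof. by rewrite /needlet_mult mulrA. Qed.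

Lemma abs_needlet_multN m j (k : 'I_(ndK N j)) l :
  `|needlet_mult k (- l) * freq_mono R m (- l)| =
  `|needlet_mult k l * freq_mono R m l|.
Proof.
rewrite /needlet_mult band_multN freq_monoN mulrCA normrM normrX normrN1.
by rewrite expr1n mul1r.
Qed.

Lemma pi2X_gt0 : 0 < (2 * pi) ^+ d :> R.
Proof. by rewrite exprn_gt0// mulr_gt0 ?pi_gt0. Qed.

Lemma Dneedlet_inner_le (m : 'I_d -> nat) (M : R) j (k : 'I_(ndK N j))
    (s : seq 'rV[int]_d) (a c : 'rV[int]_d -> R) :
  0 <= M -> (forall x, b x <= M) ->
  `|\int[torus_measure R d]_x (tpoly s a c x * Dmulti m (needlet k) x)| <=
  Num.sqrt (ndlam N k) * (M * B ^+ (j.+1 * multi_norm m)) * \sum_(l <- s) `|a l|.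
Proof.
move=> M0 bM; rewrite Dmulti_needletE.
rewrite (le_trans (tpoly_inner_le _ _ _ _ (uniq_int_box d _) (abs_needlet_multN m k)))//.
rewrite !mulr_sumr; apply: ler_sum => l _.
rewrite needlet_multE normrM ger0_norm ?mulr_ge0 ?sqrtr_ge0 ?invr_ge0 ?(ltW pi2X_gt0)//.
set x := _ * freq_mono _ _ _.
have -> : (2 * pi) ^+ d * (`|a l| * (Num.sqrt (ndlam N k) / (2 * pi) ^+ d * `|x|)) =
    Num.sqrt (ndlam N k) * `|x| * `|a l|.
  by field; rewrite gt_eqF// pi2X_gt0.
rewrite ler_wpM2r// ler_wpM2l ?sqrtr_ge0//.
exact: band_mult_mono_le.
Qed.

(** At most [((2 B + 3) B^j)^d] frequencies occur, each contributing at most a multiple of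
    [ndlam N k * B^(2 j mm)]. As [ndlam N k] is of order [B^(- j d)], the total is of order
    [B^(2 j mm)]. *)
Lemma Dneedlet_norm2_le (m : 'I_d -> nat) (M : R) j (k : 'I_(ndK N j)) :
  0 <= M -> (forall x, b x <= M) ->
  \int[torus_measure R d]_x (Dmulti m (needlet k) x ^+ 2) <=
  ndlam N k * ((2 * pi) ^+ d)^-1 * (M * B ^+ (j.+1 * multi_norm m)) ^+ 2 *
    ((2 * B + 3) * B ^+ j) ^+ d.
Proof.
move=> M0 bM; under eq_Rintegral do rewrite expr2.
have l0 : 0 <= ndlam N k by rewrite ltW// ndlam_gt0.
rewrite Dmulti_needletE (le_trans (ler_norm _))//.
rewrite (le_trans (tpoly_inner_le _ _ _ _ (uniq_int_box d _) (abs_needlet_multN m k)))//.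
have P0 := pi2X_gt0.
have H l : `|needlet_mult k l * freq_mono R m l| * `|needlet_mult k l * freq_mono R m l| <=
    ndlam N k * ((2 * pi) ^+ d)^-1 ^+ 2 * (M * B ^+ (j.+1 * multi_norm m)) ^+ 2.
  rewrite -expr2 needlet_multE normrM exprMn ger0_norm; last first.
    by rewrite mulr_ge0 ?sqrtr_ge0 ?invr_ge0 ?(ltW P0).
  rewrite exprMn sqr_sqrtr// ler_wpM2l//.
    by rewrite mulr_ge0 ?sqr_ge0.
  by rewrite ler_sqr ?nnegrE// ?mulr_ge0 ?(ltW (ndBX_gt0 _))//; exact: band_mult_mono_le.
have := sum_int_box_le (band_radius j) H.
move=> /(ler_wpM2l (ltW P0))/le_trans; apply.
set X := (_ * _) ^+ 2; have X0 : 0 <= X by exact: sqr_ge0.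
have -> : (2 * pi) ^+ d * (ndlam N k * (2 * pi) ^- d ^+ 2 * X * (band_radius j).*2.+1%:R ^+ d) =
   ndlam N k * (2 * pi) ^- d * X * (band_radius j).*2.+1%:R ^+ d :> R.
  by field; rewrite gt_eqF.
apply: ler_wpM2l.
  by rewrite mulr_ge0// mulr_ge0// invr_ge0 ltW.
apply: lerXn2r; rewrite ?nnegrE ?ler0n//; last exact: band_radius_le.
exact: le_trans (ler0n _ _) (band_radius_le j).
Qed.

End needlet_formulas.

(** * The risk of the estimator *)

Section density_integral.
Context d (T : measurableType d) (R : realType).
Variables (mu nu : {finite_measure set T -> \bar R}) (f : T -> R).
Hypothesis bf : bounded_meas f.
Hypothesis nuE : forall A, measurable A -> nu A = (\int[mu]_(x in A) (f x)%:E)%E.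

(** The law of an observation is given on sets only; uniqueness of the Radon-Nikodym derivative
    carries it over to functions. *)
Lemma bounded_integral_density (g : T -> R) : bounded_meas g ->
  \int[nu]_x g x = \int[mu]_x (g x * f x).
Proof.
move=> bg.
have mf : measurable_fun setT (EFin \o f) by apply/measurable_EFinP; exact: bf.1.
have mg : measurable_fun setT (EFin \o g) by apply/measurable_EFinP; exact: bg.1.
have dom : nu `<< mu.
  apply/null_content_dominatesP => A mA muA0; rewrite /= in muA0 *.
  rewrite nuE//; apply: null_set_integral => //.
  exact: measurable_funTS.
have ir := Radon_Nikodym_integrable (nu := charge_of_finite_measure nu) dom.
have ae : ae_eq mu setT (Radon_Nikodym (charge_of_finite_measure nu) mu) (EFin \o f).
  apply: integral_ae_eq => // E _ mE.
  by rewrite -Radon_Nikodym_integral// -nuE.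
rewrite /Rintegral.
rewrite -(Radon_Nikodym_change_of_variables dom)//; last exact: bounded_meas_integrable.
congr fine; apply: ae_eq_integral => //.
- apply: emeasurable_funM => //; exact: measurable_int ir.
- by apply/measurable_EFinP; apply: measurable_funM; [exact: bg.1|exact: bf.1].
- apply: filterS ae => x /(_ Logic.I) fx _ /=.
  by rewrite fx// EFinM.
Qed.

End density_integral.

(** * Second moments of empirical means *)

Section independence.
Context (R : realType) (d n : nat) (f : 'rV[R]_d -> R) (X : iid_sample n f).
Hypothesis bf : bounded_meas f.
Local Notation P := (smp_prob X).
Local Notation mu := (torus_measure R d).
Variable g : 'rV[R]_d -> R.
Hypothesis bg : bounded_meas g.

Lemma bounded_meas_smp i : bounded_meas (fun w => g (smp X i w)).
Proof. exact: (bounded_meas_comp (@measurable_funPT _ _ _ _ (smp X i)) bg). Qed.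

Lemma integral_smp i : \int[P]_w g (smp X i w) = \int[mu]_x (g x * f x).
Proof.
rewrite -(@bounded_integral_density _ _ _ mu (distribution P (smp X i)) f bf)//.
- by rewrite [RHS]/Rintegral /distribution bounded_integral_pushforward.
- by move=> A mA; exact: smp_law.
Qed.

Lemma integral_smp_pair i i' : i != i' ->
  \int[P]_w (g (smp X i w) * g (smp X i' w)) =
  (\int[mu]_x (g x * f x)) ^+ 2.
Proof.
move=> ii'.
have mp : measurable_fun setT (fun w => (smp X i w, smp X i' w)).
  by apply: measurable_fun_pair.
pose G (z : 'rV[R]_d * 'rV[R]_d) := g z.1 * g z.2.
have bG : bounded_meas G.
  apply: bounded_measM; first exact: bounded_meas_comp measurable_fst bg.
  exact: bounded_meas_comp measurable_snd bg.
pose law i := distribution P (smp X i).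
have E : (\int[law i \x law i']_z (G z)%:E)%E =
    (\int[pushforward P (fun w => (smp X i w, smp X i' w))]_z (G z)%:E)%E.
  pose mpm := isMeasurableFun.Build _ _ _ _ _ mp.
  pose mpf : {mfun _ >-> _} := HB.pack (fun w => (smp X i w, smp X i' w)) mpm.
  apply: (@eq_measure_integral _ _ _ _ (distribution P mpf)) => A mA _.
  apply: product_measure_unique => // A1 A2 mA1 mA2.
  rewrite /= /distribution /pushforward /=.
  (* Independence is stated for [n] sets at once; all but two are taken to be the whole space. *)
  pose A' k := if k == i then A1 else if k == i' then A2 else setT.
  have mA' k : measurable (A' k).
    by rewrite /A'; case: (k == i) => //; case: (k == i').
  have := smp_indep X mA'.
  rewrite (bigD1 i)//= (bigD1 i')/=; last by rewrite eq_sym.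
  rewrite [X in (_ * (_ * X))%E]big1; last first.
    move=> k /andP[/negbTE ki /negbTE ki'].
    by rewrite /A' ki ki' preimage_setT probability_setT.
  rewrite mule1 /A' !eqxx [i' == i]eq_sym (negbTE ii') => <-; congr (P _).
  apply/seteqP; split => w /=.
    move=> [w1 w2] k _; rewrite /A'; case: ifPn => [/eqP->//|_].
    by case: ifPn => [/eqP->//|_].
  move=> H; have := H i Logic.I; have := H i' Logic.I.
  by rewrite /= !eqxx [i' == i]eq_sym (negbTE ii').
have := E; rewrite bounded_integral_pushforward// bounded_fubini// => -[<-].
transitivity (\int[law i']_y (g y * \int[law i]_x g x)).
  apply: eq_Rintegral => y _; rewrite -bounded_integralZ//.
  by apply: eq_Rintegral => x _; rewrite mulrC.
under eq_Rintegral do rewrite mulrC.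
have lawE k : \int[law k]_x g x = \int[mu]_x (g x * f x).
  rewrite -(integral_smp k).
  by rewrite [LHS]/Rintegral /law /distribution bounded_integral_pushforward.
by rewrite bounded_integralZ// !lawE expr2.
Qed.

(** Of the [n^2] products the [n] diagonal ones give the first term, and the others factor by
    independence. Rounding their number up to [n^2] adds a square. *)
Lemma empirical_mean_norm2_le : (0 < n)%N -> (forall x, 0 <= f x) ->
  \int[P]_w ((n%:R^-1 * \sum_(i < n) g (smp X i w)) ^+ 2) <=
  n%:R^-1 * (\int[mu]_x (g x ^+ 2 * f x)) + (\int[mu]_x (g x * f x)) ^+ 2.
Proof.
move=> n0 f0; have nR : 0 < n%:R :> R by rewrite ltr0n.
have bY := bounded_meas_smp.
have E w : (n%:R^-1 * \sum_(i < n) g (smp X i w)) ^+ 2 =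
    n%:R^-1 ^+ 2 * \sum_(i < n) \sum_(i' < n) (g (smp X i w) * g (smp X i' w)).
  rewrite exprMn [X in _ * X]expr2 mulr_suml; congr (_ * _).
  by apply: eq_bigr => i _; rewrite mulr_sumr.
under eq_Rintegral do rewrite E.
have b1 (i : 'I_n) : bounded_meas (fun w => \sum_(i' < n) (g (smp X i w) * g (smp X i' w))).
  by apply: bounded_meas_sum => i' _ _; exact: bounded_measM.
rewrite bounded_integralZ; last by apply: bounded_meas_sum => i _ _.
rewrite bounded_integral_sum; last by move=> i _ _.
set S := \int[mu]_x (g x ^+ 2 * f x); set e := \int[mu]_x (g x * f x).
have row (i : 'I_n) :
    \int[P]_w (\sum_(i' < n) (g (smp X i w) * g (smp X i' w))) <= S + n%:R * e ^+ 2.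
  rewrite bounded_integral_sum; last by move=> i' _ _; exact: bounded_measM.
  rewrite (bigD1 i)//= lerD//.
    have -> : S = \int[P]_w (g (smp X i w) ^+ 2).
      rewrite /S -(@bounded_integral_density _ _ _ mu (distribution P (smp X i)) f bf) //.
      - rewrite [LHS]/Rintegral /distribution bounded_integral_pushforward//.
        exact: bounded_measX.
      - by move=> A mA; exact: smp_law.
      - exact: bounded_measX.
    by under eq_Rintegral do rewrite -expr2.
  apply: (@le_trans _ _ (\sum_(i' < n) e ^+ 2)); last first.
    by rewrite sumr_const card_ord mulr_natl.
  rewrite [leRHS](bigD1 i)//= -[leLHS]add0r lerD ?sqr_ge0// ler_sum// => i' ii'.
  by rewrite integral_smp_pair// eq_sym.
apply: (@le_trans _ _ (n%:R^-1 ^+ 2 * \sum_(i < n) (S + n%:R * e ^+ 2))).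
  by rewrite ler_wpM2l ?sqr_ge0//; apply: ler_sum => i _; exact: row.
rewrite sumr_const card_ord -mulr_natl; apply: eq_ler.
by field; rewrite gt_eqF.
Qed.

End independence.

Section thresholding.
Context (R : realType).

(** The common interface of hard and soft thresholding: the first two properties keep the estimated
    coefficients in [bounded_meas], the third one suppresses the noise. *)
Definition threshold_rule (eta : R -> R -> R) := forall a, 0 < a ->
  [/\ measurable_fun setT (fun u => eta u a),
      forall u, `|eta u a| <= `|u| & forall u, `|eta u a| <= u ^+ 2 / a].

Lemma hard_threshold_rule : threshold_rule (@hard_threshold R).
Proof.
move=> a a0; split.
- apply: measurable_fun_ifT => //.
  by apply: measurable_fun_ler => //; exact: measurableT_comp.
- by move=> u; rewrite /hard_threshold; case: ifP => // _; rewrite normr0.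
- move=> u; rewrite /hard_threshold; case: ifP => [au|_].
    by rewrite ler_pdivlMr// -real_normK ?num_real// expr2 ler_wpM2l.
  by rewrite normr0 divr_ge0 ?sqr_ge0// ltW.
Qed.

Lemma soft_threshold_rule : threshold_rule (@soft_threshold R).
Proof.
move=> a a0.
(* A formula without [sg], from which measurability is immediate. *)
have sE u : soft_threshold u a = Num.max (u - a) 0 - Num.max (- u - a) 0.
  rewrite /soft_threshold; have [u0|u0|->] := ltgtP u 0.
  - rewrite ltr0_norm// ltr0_sg// mulrN1 [Num.max (u - a) 0]max_r ?sub0r//; lra.
  - rewrite gtr0_norm// gtr0_sg// mulr1 [Num.max (- u - a) 0]max_r ?subr0//; lra.
  - by rewrite sgr0 mulr0 oppr0 subrr.
have sle u : `|soft_threshold u a| <= Num.max (`|u| - a) 0.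
  rewrite /soft_threshold normrM normr_sg; set v := Num.max _ _.
  have v0 : 0 <= v by rewrite le_max lexx orbT.
  by rewrite ger0_norm// mulr_natr mulrb; case: (u != 0).
split.
- under eq_fun do rewrite sE.
  apply: measurable_funB; apply: measurable_maxr => //; apply: measurable_funB => //.
- by move=> u; rewrite (le_trans (sle u))// ge_max normr_ge0 andbT; lra.
- move=> u; rewrite (le_trans (sle u))// ge_max divr_ge0 ?sqr_ge0 ?(ltW a0)// andbT.
  rewrite ler_pdivlMr// -[u ^+ 2]real_normK ?num_real//.
  move: `|u| => v; rewrite -subr_ge0.
  have -> : v ^+ 2 - (v - a) * a = (v - a / 2) ^+ 2 + 3 / 4 * a ^+ 2 by field.
  by rewrite addr_ge0 ?sqr_ge0// mulr_ge0 ?sqr_ge0//; lra.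
Qed.

End thresholding.

(** * Lower bounds for integrals and losses *)

Section integral_lower_bound.
Context d (T : measurableType d) (R : realType).
Variable mu : {finite_measure set T -> \bar R}.

Import HBNNSimple.

(** The integral of a nonnegative function is a supremum over simple functions below it, hence
    monotone for an arbitrary [F]. This allows [F] to be the loss as a function of the sample
    point. *)
Lemma bounded_integral_le_ge0 (h : T -> R) (F : T -> \bar R) : bounded_meas h ->
  (forall x, (0 <= F x)%E) -> (forall x, ((h x)%:E <= F x)%E) ->
  ((\int[mu]_x h x)%:E <= \int[mu]_x F x)%E.
Proof.
move=> bh F0 hF; pose h' x := Num.max (h x) 0.
have bh' : bounded_meas h'.
  have [mh [M hM]] := bh; split; first exact: measurable_maxr.
  exists M => x; rewrite /h' /Num.max; case: ifP => // _.
  by rewrite normr0 (le_trans _ (hM x)).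
apply: (@le_trans _ _ (\int[mu]_x (h' x)%:E)%E).
  rewrite bounded_integral// lee_fin bounded_le_integral// => x.
  by rewrite le_max lexx.
rewrite !ge0_integralTE//; last by move=> x; rewrite lee_fin le_max lexx orbT.
apply: ereal_sup_le => _ /= [k kh' <-].
exists k => // x.
rewrite (le_trans (kh' x))// /h' /Num.max; case: ifP => _; first exact: F0.
exact: hF.
Qed.

(** Young's inequality for [u] and [a^(p - 1)] with the exponents [p] and [p / (p - 1)]; the case
    [p = 1], where the second one is infinite, is an identity. *)
Lemma powR_tangent (p a u : R) : 1 <= p -> 0 < a -> 0 <= u ->
  p * a `^ (p - 1) * u - (p - 1) * a `^ p <= u `^ p.
Proof.
rewrite le_eqVlt => /predU1P[<-|p1] a0 u0.
  by rewrite subrr powRr0 mul0r subr0 !mul1r powRr1.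
have p0 : 0 < p by lra.
have q0 : 0 < p / (p - 1) by rewrite divr_gt0//; lra.
have pq : p^-1 + (p / (p - 1))^-1 = 1.
  by field; rewrite !gt_eqF//; lra.
have := conjugate_powR u0 (powR_ge0 a (p - 1)) p0 q0 pq.
rewrite -powRrM.
have -> : (p - 1) * (p / (p - 1)) = p by field; rewrite gt_eqF//; lra.
rewrite -(ler_pM2l p0) mulrDr.
have -> : p * (u `^ p / p) = u `^ p by field; rewrite gt_eqF.
have -> : p * (a `^ p / (p / (p - 1))) = (p - 1) * a `^ p.
  by field; rewrite !gt_eqF//; lra.
by lra.
Qed.

End integral_lower_bound.

Section loss_lower_bound.
Context d (T : measurableType d) (R : realType).
Variable mu : {finite_measure set T -> \bar R}.
Variables (D phi : T -> R) (Phi1 Phioo : R).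
Hypotheses (bD : bounded_meas D) (bphi : bounded_meas phi).
Hypotheses (Phioo_gt0 : 0 < Phioo) (phi_le : forall x, `|phi x| <= Phioo).
Hypotheses (Phi1_gt0 : 0 < Phi1) (phi_int : \int[mu]_x `|phi x| <= Phi1).

Lemma bounded_meas_powR (h : T -> R) (p : R) : 0 <= p -> bounded_meas h ->
  bounded_meas (fun x => `|h x| `^ p).
Proof.
move=> p0 [mh [M hM]]; split.
  apply: (measurableT_comp (measurable_powR p)) => //.
  exact: measurableT_comp.
exists (M `^ p) => x; rewrite ger0_norm ?powR_ge0//.
by rewrite ge0_ler_powR// ?nnegrE// (le_trans _ (hM x)).
Qed.

(* The tangent of [u ^ p] at [a] replaces the Hoelder and Jensen inequalities. *)
Lemma Lnorm_powR_ge (p a : R) : 1 <= p -> 0 < a ->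
  (((p * a `^ (p - 1) * \int[mu]_x (D x * phi x) - (p - 1) * a `^ p * Phi1) / Phioo)%:E <=
   Lnorm mu p%:E (fun x => (D x)%:E) `^ p)%E.
Proof.
move=> p1 a0; have p0 : 0 < p by lra.
rewrite poweR_Lnorm ?gt_eqF//.
rewrite (eq_integral (fun x => (`|D x| `^ p)%:E))//.
rewrite bounded_integral; last by apply: bounded_meas_powR => //; exact: ltW.
rewrite lee_fin ler_pdivrMr//.
have bDp := bounded_meas_powR (ltW p0) bD.
have bn := bounded_meas_norm bphi; have bDn := bounded_meas_norm bD.
apply: (@le_trans _ _ (\int[mu]_x (`|phi x| * `|D x| `^ p))); last first.
  rewrite mulrC -bounded_integralZ//; apply: bounded_le_integral.
  - exact: bounded_measM.
  - exact: bounded_measZ.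
  - by move=> x; rewrite ler_wpM2r ?powR_ge0.
pose c := p * a `^ (p - 1); pose c' := (p - 1) * a `^ p.
have c0 : 0 <= c by rewrite mulr_ge0 ?powR_ge0// ltW.
have c'0 : 0 <= c' by rewrite mulr_ge0 ?powR_ge0//; lra.
apply: (@le_trans _ _ (\int[mu]_x (c * (D x * phi x) - c' * `|phi x|))).
  rewrite bounded_integralB; last 2 first.
  - by apply: bounded_measZ; exact: bounded_measM.
  - exact: bounded_measZ.
  rewrite !bounded_integralZ//; last exact: bounded_measM.
  by rewrite lerB// ler_wpM2l.
apply: bounded_le_integral.
- apply: bounded_measB; apply: bounded_measZ => //; exact: bounded_measM.
- exact: bounded_measM.
- move=> x; apply: (@le_trans _ _ (`|phi x| * (c * `|D x| - c'))).
    have : D x * phi x <= `|phi x| * `|D x|.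
      by rewrite mulrC -normrM ler_norm.
    by move=> /(ler_wpM2l c0); lra.
  by rewrite ler_wpM2l//; exact: powR_tangent.
Qed.

Lemma Lnormoo_ge : (0 < mu setT)%E ->
  ((\int[mu]_x (D x * phi x) / Phi1)%:E <= Lnorm mu +oo (fun x => (D x)%:E))%E.
Proof.
(* At [+oo], [Lnorm] is the essential supremum only if the space has positive measure. *)
move=> mu0; rewrite unlock mu0.
set S := ess_sup _ _.
have S0 : (0 <= S)%E by apply: ess_sup_gee => //; apply: aeW => x /=; rewrite lee_fin.
have : (0 <= S)%E by [].
have := @ess_sup_ge _ _ _ mu (abse \o (fun x => (D x)%:E)).
rewrite -/S; case: (S) => [r| |]//; last by move=> _ _; rewrite leey.
move=> aeS; rewrite lee_fin => r0.
rewrite lee_fin ler_pdivrMr//.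
have bDphi := bounded_measM bD bphi.
have br : bounded_meas (fun x => r * `|phi x|).
  by apply: bounded_measZ; exact: bounded_meas_norm.
apply: (@le_trans _ _ (\int[mu]_x (r * `|phi x|))); last first.
  rewrite bounded_integralZ; last exact: bounded_meas_norm.
  by rewrite ler_wpM2l.
rewrite (le_trans (ler_norm _))// (le_trans (bounded_le_norm_integral _ bDphi))//.
rewrite -lee_fin -!bounded_integral//; last exact: bounded_meas_norm.
apply: ae_ge0_le_integral => //.
- by apply/measurable_EFinP; exact: (bounded_meas_norm bDphi).1.
- by move=> x _; rewrite lee_fin mulr_ge0.
- by apply/measurable_EFinP; exact: br.1.
- apply: filterS aeS => x /= Dr _.
  by rewrite lee_fin normrM ler_wpM2r// -lee_fin.
Qed.

End loss_lower_bound.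

(** * Testing the error of the estimator *)

Section risk_lower_bound.
Context (R : realType) (d : nat) (N : needlet_system R d) (m : 'I_d -> nat).
Context (kappa : R) (eta : R -> R -> R) (n : nat).
Hypotheses (kappa_gt0 : 0 < kappa) (etaP : threshold_rule eta) (n_ge2 : (2 <= n)%N).
Context (f : 'rV[R]_d -> R) (X : iid_sample n f) (g phi : 'rV[R]_d -> R).
Hypotheses (bf : bounded_meas f) (f_ge0 : forall x, 0 <= f x).
Hypotheses (bg : bounded_meas g) (bphi : bounded_meas phi).
Local Notation mu := (torus_measure R d).
Local Notation P := (smp_prob X).
Local Notation tau := (threshold N m kappa n).
Local Notation J := (cutoff N m n).

Lemma smp_integral_cst (c : R) : \int[P]_w c = c.
Proof.
rewrite Rintegral_cst// [X in fine X](_ : _ = 1%E) ?mulr1//.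
exact: probability_setT.
Qed.

Lemma threshold_gt0 j : 0 < tau j.
Proof.
have n1 : 1 < n%:R :> R by rewrite ltr1n.
rewrite /threshold !mulr_gt0 ?ndBX_gt0// sqrtr_gt0 divr_gt0 ?ln_gt0//.
by rewrite (lt_trans ltr01).
Qed.

Definition estimated_coef j (k : 'I_(ndK N j)) w : R :=
  eta (coef_estimator m (fun i => smp X i w) k) (tau j).

Lemma bounded_meas_coef_estimator j (k : 'I_(ndK N j)) :
  bounded_meas (fun w => coef_estimator m (fun i => smp X i w) k).
Proof.
apply: bounded_measZ; apply: bounded_meas_sum => i _ _.
exact: bounded_meas_smp (bounded_meas_Dneedlet m k) i.
Qed.

Lemma bounded_meas_estimated_coef j (k : 'I_(ndK N j)) :
  bounded_meas (estimated_coef k).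
Proof.
have [meta eta_le _] := etaP (threshold_gt0 j).
have [mc [M cM]] := bounded_meas_coef_estimator k.
split; first exact: (measurableT_comp meta mc).
by exists M => w; rewrite (le_trans (eta_le _)).
Qed.

(** Variance plus squared mean of the empirical coefficient, divided by the threshold: the quadratic
    bound on [eta] in expectation. *)
Definition noise_level j (k : 'I_(ndK N j)) : R := (tau j)^-1 *
  (n%:R^-1 * (\int[mu]_x (Dmulti m (needlet k) x ^+ 2 * f x)) +
   (\int[mu]_x (Dmulti m (needlet k) x * f x)) ^+ 2).

Lemma estimated_coef_mean_le j (k : 'I_(ndK N j)) :
  \int[P]_w `|estimated_coef k w| <= noise_level k.
Proof.
have t0 := threshold_gt0 j; have [_ _ eta_sq] := etaP t0.
have bc := bounded_meas_coef_estimator k.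
have bD := bounded_meas_Dneedlet m k.
apply: (@le_trans _ _ (\int[P]_w ((tau j)^-1 *
    (n%:R^-1 * \sum_(i < n) Dmulti m (needlet k) (smp X i w)) ^+ 2))).
  apply: bounded_le_integral.
  - exact/bounded_meas_norm/bounded_meas_estimated_coef.
  - apply/bounded_measZ/bounded_measX/bounded_measZ/bounded_meas_sum => i _ _.
    exact: bounded_meas_smp bD i.
  - move=> w; rewrite (le_trans (eta_sq _))// mulrC /coef_estimator.
    by rewrite -mulrA exprMn -exprM mulnC exprM sqrrN expr1n expr1n mul1r.
rewrite bounded_integralZ; last first.
  apply/bounded_measX/bounded_measZ/bounded_meas_sum => i _ _.
  exact: bounded_meas_smp bD i.
rewrite ler_wpM2l ?invr_ge0 ?(ltW t0)//.
by apply: empirical_mean_norm2_le => //; exact: leq_trans n_ge2.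
Qed.

Local Notation est w := (density_estimator N m kappa eta (fun i => smp X i w)).

Lemma bounded_meas_density_estimator w : bounded_meas (est w).
Proof.
apply: bounded_meas_sum => j _ _; apply: bounded_meas_sum => k _ _.
exact/bounded_measZ/bounded_meas_needlet.
Qed.

(** The error tested against [- phi]. It is affine in the estimated coefficients, so its mean is
    computed term by term, and it is large when the estimator fails to follow [g] in the direction
    [phi]. *)
Definition test_error w : R := \int[mu]_x (g x * phi x) -
  \sum_(0 <= j < J) \sum_(k < ndK N j)
    (\int[mu]_x (phi x * needlet k x)) * estimated_coef k w.

Lemma test_errorE w :
  \int[mu]_x ((est w x - g x) * - phi x) = test_error w.
Proof.
have bn := @bounded_meas_needlet R d N.
transitivity (\int[mu]_x (g x * phi x - est w x * phi x)).
  by apply: eq_Rintegral => x _; ring.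
have be := bounded_meas_density_estimator w.
rewrite bounded_integralB; [|exact: bounded_measM..].
congr (_ - _).
transitivity (\int[mu]_x (\sum_(0 <= j < J) \sum_(k < ndK N j)
    (estimated_coef k w * (phi x * needlet k x)))).
  apply: eq_Rintegral => x _; rewrite /density_estimator mulr_suml.
  apply: eq_bigr => j _; rewrite mulr_suml; apply: eq_bigr => k _.
  by rewrite mulrAC -mulrA.
have bb j (k : 'I_(ndK N j)) :
    bounded_meas (fun x => estimated_coef k w * (phi x * needlet k x)).
  by apply/bounded_measZ/bounded_measM.
rewrite bounded_integral_sum; last by move=> j _ _; apply: bounded_meas_sum.
apply: eq_bigr => j _; rewrite bounded_integral_sum//.
apply: eq_bigr => k _; rewrite bounded_integralZ; last exact: bounded_measM.
by rewrite mulrC.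
Qed.

Lemma bounded_meas_test_error : bounded_meas test_error.
Proof.
apply: bounded_measB; first exact: bounded_meas_cst.
apply: bounded_meas_sum => j _ _; apply: bounded_meas_sum => k _ _.
exact/bounded_measZ/bounded_meas_estimated_coef.
Qed.

Variable L : R.
Hypothesis L_gt0 : 0 < L.
Hypothesis L_le : L + \sum_(0 <= j < J) \sum_(k < ndK N j)
   `|\int[mu]_x (phi x * needlet k x)| * noise_level k <=
   \int[mu]_x (g x * phi x).

(** By linearity only the mean of each [|estimated_coef k|] enters, never the joint law of the
    coefficients. *)
Lemma test_error_mean_ge : L <= \int[P]_w test_error w.
Proof.
have bc j (k : 'I_(ndK N j)) := bounded_meas_estimated_coef k.
rewrite bounded_integralB; [|exact: bounded_meas_cst|]; last first.
  apply: bounded_meas_sum => j _ _; apply: bounded_meas_sum => k _ _.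
  exact/bounded_measZ.
rewrite smp_integral_cst.
rewrite bounded_integral_sum; last first.
  by move=> j _ _; apply: bounded_meas_sum => k _ _; exact/bounded_measZ.
rewrite lerBrDr; apply: le_trans L_le; rewrite lerD2l; apply: ler_sum => j _.
rewrite bounded_integral_sum; last by move=> k _ _; exact/bounded_measZ.
apply: ler_sum => k _; rewrite bounded_integralZ//.
rewrite (le_trans (ler_norm _))// normrM ler_wpM2l//.
rewrite (le_trans _ (estimated_coef_mean_le k))//.
exact: bounded_le_norm_integral.
Qed.

Variables Phi1 Phioo : R.
Hypotheses (Phioo_gt0 : 0 < Phioo) (phi_le : forall x, `|phi x| <= Phioo).
Hypotheses (Phi1_gt0 : 0 < Phi1) (phi_int : \int[mu]_x `|phi x| <= Phi1).

Let bNphi : bounded_meas (fun x => - phi x). Proof. exact: bounded_measN. Qed.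
Let Nphi_le x : `|- phi x| <= Phioo. Proof. by rewrite normrN. Qed.
Let Nphi_int : \int[mu]_x `|- phi x| <= Phi1.
Proof. by under eq_Rintegral do rewrite normrN. Qed.

Lemma Lp_risk_ge (p : R) : 1 <= p ->
  ((L `^ p / (Phioo * Phi1 `^ (p - 1)))%:E <= Lp_risk N m kappa eta p X g)%E.
Proof.
(* This [a] maximizes [p * a^(p - 1) * L - (p - 1) * a^p * Phi1]; the maximum is
   [L^p / Phi1^(p - 1)]. As the tangent bound is affine in [test_error], the expectation passes
   through it. *)
move=> p1; pose a := L / Phi1; have a0 : 0 < a by rewrite divr_gt0.
have bt := bounded_meas_test_error.
pose c := p * a `^ (p - 1); pose c' := (p - 1) * a `^ p * Phi1.
have c0 : 0 <= c by rewrite mulr_ge0 ?powR_ge0//; lra.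
apply: (@le_trans _ _ (\int[P]_w (Phioo^-1 * (c * test_error w - c')))%:E); last first.
  apply: bounded_integral_le_ge0.
  - apply: bounded_measZ; apply: bounded_measB; last exact: bounded_meas_cst.
    exact: bounded_measZ.
  - by move=> w; exact: poweR_ge0.
  - move=> w; rewrite -test_errorE mulrC.
    apply: Lnorm_powR_ge => //.
    by apply: bounded_measB => //; exact: bounded_meas_density_estimator.
rewrite lee_fin bounded_integralZ; last first.
  by apply: bounded_measB; [exact: bounded_measZ|exact: bounded_meas_cst].
rewrite bounded_integralB; [|exact: bounded_measZ|exact: bounded_meas_cst].
rewrite bounded_integralZ// smp_integral_cst.
rewrite invfM mulrA [L `^ p / _]mulrC -mulrA ler_wpM2l ?invr_ge0 ?(ltW Phioo_gt0)//.
have := ler_wpM2l c0 test_error_mean_ge.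
suff -> : L `^ p / Phi1 `^ (p - 1) = c * L - c' by move=> h; rewrite lerB.
have aL : L = a * Phi1 by rewrite /a divfK// gt_eqF.
have powS (x : R) : 0 < x -> x `^ p = x `^ (p - 1) * x.
  move=> x0; rewrite -[X in _ = _ * X](powRr1 (ltW x0)) -powRD ?subrK//.
  by rewrite (gt_eqF x0) implybT.
rewrite /c /c' {1 2}aL powRM ?(ltW a0) ?(ltW Phi1_gt0)// (powS a)// (powS Phi1)//.
field; by rewrite gt_eqF// powR_gt0.
Qed.

Lemma Loo_risk_ge : ((L / Phi1)%:E <= Loo_risk N m kappa eta X g)%E.
Proof.
have bt := bounded_meas_test_error.
have mu0 : (0 < mu setT)%E.
  rewrite -[mu setT]fineK ?fin_num_measure// torus_setT lte_fin.
  by rewrite exprn_gt0// mulr_gt0 ?pi_gt0.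
apply: (@le_trans _ _ (\int[P]_w (Phi1^-1 * test_error w))%:E); last first.
  apply: bounded_integral_le_ge0.
  - exact: bounded_measZ.
  - by move=> w; exact: Lnorm_ge0.
  - move=> w; rewrite -test_errorE mulrC.
    apply: Lnormoo_ge => //.
    by apply: bounded_measB => //; exact: bounded_meas_density_estimator.
rewrite lee_fin bounded_integralZ// mulrC ler_wpM2l ?invr_ge0 ?(ltW Phi1_gt0)//.
exact: test_error_mean_ge.
Qed.

End risk_lower_bound.

(** * Besov norms of trigonometric polynomials *)

Section finite_support_norm.
Context (R : realType).

(** The natural factor is [K^(1/q)]; replacing it by [K] gives one bound for all [q], including
    [+oo]. *)
Lemma Lnorm_counting_le (q : \bar R) (u : nat -> \bar R) (j0 K : nat) (M : R) :
  (1 <= q)%E -> (0 < K)%N -> 0 <= M ->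
  (forall j, (j < j0)%N || (j0 + K <= j)%N -> u j = 0%E) ->
  (forall j, (`|u j| <= M%:E)%E) ->
  (Lnorm (@counting nat R) q u <= (K%:R * M)%:E)%E.
Proof.
move=> q1 K0 M0 u0 uM; have K1 : 1 <= K%:R :> R by rewrite ler1n.
case: q q1 => [q| |]//; last first.
  move=> _; rewrite unlock; case: ifP => [c0|_].
    by apply/ess_supP; apply: aeW => j /=; rewrite (le_trans (uM j))// lee_fin ler_peMl.
  by rewrite lee_fin mulr_ge0.
rewrite lee_fin => q1; have q0 : 0 < q by lra.
have qV1 : q^-1 <= 1 by rewrite invf_le1.
rewrite Lnorm_counting//.
have p0 j : (0 <= `|u j| `^ q)%E by exact: poweR_ge0.
rewrite (@nneseries_split _ _ 0 (j0 + K))// eseries0 ?adde0; last first.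
  move=> j /= Kj _; rewrite u0 ?abse0 ?poweR0r// ?gt_eqF//.
  by move: Kj; rewrite add0n => ->; rewrite orbT.
rewrite add0n (@big_cat_nat _ _ _ j0)/= ?leq_addr//.
rewrite big_nat big1 ?add0e => [|j /andP[_ jj]]; last first.
  by rewrite u0 ?jj// abse0 poweR0r// gt_eqF.
have -> : (K%:R * M)%:E = (((K%:R * M) `^ q)%:E `^ q^-1)%E.
  rewrite poweR_EFin -powRrM divff ?gt_eqF// powRr1//.
  by rewrite mulr_ge0.
apply: gt0_ler_poweR; rewrite ?invr_ge0 ?(ltW q0)//.
- by rewrite in_itv/= leey andbT; apply: sume_ge0.
- by rewrite in_itv/= leey andbT lee_fin powR_ge0.
apply: (@le_trans _ _ (\sum_(j0 <= j < j0 + K) (M `^ q)%:E)%E).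
  apply: lee_sum => j _; rewrite -poweR_EFin.
  apply: gt0_ler_poweR => //; first exact: ltW.
  - by rewrite in_itv/= leey andbT abse_ge0.
  - by rewrite in_itv/= leey andbT lee_fin.
rewrite sumEFin big_const_nat iter_addr addr0 addKn lee_fin powRM ?ler0n//.
rewrite -[leLHS]mulr_natl ler_wpM2r ?powR_ge0//.
by rewrite -[leLHS]powRr1 ?ler0n// ler_powR.
Qed.

End finite_support_norm.

Section approximation_error.
Context (R : realType) (d : nat).
Local Notation mu := (torus_measure R d).
Implicit Types (t : R) (l : 'rV[int]_d).

Lemma trig_poly0 t : trig_poly t (fun _ : 'rV[R]_d => 0 : R[i]).
Proof.
exists (fun=> 0); apply/funext => x; rewrite fsbig1// => l _.
by rewrite mul0r.
Qed.

Lemma trig_polyD t (g h : 'rV[R]_d -> R[i]) : trig_poly t g -> trig_poly t h ->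
  trig_poly t (fun x => g x + h x).
Proof.
move=> [a ->] [b ->]; exists (fun l => a l + b l); apply/funext => x.
rewrite -fsbig_split/=; last exact: finite_freq_norm_le.
by apply: eq_fsbigr => l _; rewrite mulrDl.
Qed.

Lemma trig_poly_exp t l (z : R[i]) : freq_norm R l <= t ->
  trig_poly t (fun x : 'rV[R]_d => z * torus_exp l x).
Proof.
move=> lt; exists (fun l' => if l' == l then z else 0); apply/funext => x.
rewrite -(@fsbig_widen _ _ _ _ [set l])/=.
- by rewrite fsbig_set1 eqxx.
- by move=> _ ->.
- by move=> l' [_ /= /eqP/negbTE ->]; rewrite mul0r.
Qed.

Lemma trig_poly_cos t l (a c : R) : freq_norm R l <= t ->
  trig_poly t (fun x : 'rV[R]_d => (a * cos (freq_dot l x + c))%:C%C).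
Proof.
move=> lt; pose p := (2 * pi) `^ (- (d%:R / 2)) : R.
have p0 : p != 0 by rewrite gt_eqF// powR_gt0// mulr_gt0 ?pi_gt0.
pose z : R[i] := (a / 2 / p * cos c +i* (a / 2 / p * sin c))%C.
pose z' : R[i] := (a / 2 / p * cos c -i* (a / 2 / p * sin c))%C.
have -> : (fun x : 'rV[R]_d => (a * cos (freq_dot l x + c))%:C%C) =
    (fun x => z * torus_exp l x + z' * torus_exp (- l) x).
  apply/funext => x; rewrite /torus_exp -/p -/(freq_dot l x) -/(freq_dot (- l) x).
  rewrite freq_dotN cosN sinN cosD /z /z'.
  apply/eqP; rewrite eq_complex /=; apply/andP; split; apply/eqP; by field.
apply: trig_polyD; apply: trig_poly_exp => //.
by rewrite freq_normN.
Qed.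

Lemma trig_poly_tpoly t s (a c : 'rV[int]_d -> R) :
  (forall l, a l != 0 -> freq_norm R l <= t) ->
  trig_poly t (fun x => (tpoly s a c x)%:C%C).
Proof.
move=> at_; rewrite /tpoly; elim: s => [|l s IH].
  under eq_fun do rewrite big_nil; exact: trig_poly0.
have -> : (fun x => (\sum_(l0 <- l :: s) a l0 * cos (freq_dot l0 x + c l0))%:C%C) =
   (fun x => (a l * cos (freq_dot l x + c l))%:C%C +
     (\sum_(l0 <- s) a l0 * cos (freq_dot l0 x + c l0))%:C%C).
  by apply/funext => x; rewrite big_cons rmorphD.
apply: trig_polyD => //; have [->|al] := eqVneq (a l) 0.
  under eq_fun do rewrite mul0r; exact: trig_poly0.
by apply: trig_poly_cos; exact: at_.
Qed.

Lemma approx_error_ge0 t (f : 'rV[R]_d -> R) r : (0 <= approx_error t f r :> \bar R)%E.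
Proof. by apply: le_ereal_inf_tmp => _ [g _ <-]; exact: Lnorm_ge0. Qed.

Lemma approx_error_eq0 t (f : 'rV[R]_d -> R) r : r != 0 ->
  trig_poly t (fun x => (f x)%:C%C) -> approx_error t f r = 0%E.
Proof.
move=> r0 tf; apply/eqP; rewrite eq_le approx_error_ge0 andbT.
have <- : Lnorm mu r%:E (cst 0%E) = 0%E by apply: Lnorm0; rewrite eqe.
apply: ereal_inf_lbound; exists (fun x => (f x)%:C%C) => //.
by apply: eq_Lnorm => x /=; rewrite !subrr expr0n addr0 sqrtr0.
Qed.

Lemma approx_error_le t (f : 'rV[R]_d -> R) r :
  (approx_error t f r <= Lnorm mu r%:E (EFin \o f))%E.
Proof.
apply: ereal_inf_lbound; exists (fun _ => 0); first exact: trig_poly0.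
rewrite -[RHS]Lnorm_abse; apply: eq_Lnorm => x /=.
by rewrite !subr0 expr0n addr0 sqrtr_sqr.
Qed.

Lemma bounded_Lnorm_lty (f : 'rV[R]_d -> R) r : 0 < r -> bounded_meas f ->
  (Lnorm mu r%:E (EFin \o f) < +oo)%E.
Proof.
move=> r0 bf; rewrite unlock.
rewrite (eq_integral (fun x => (`|f x| `^ r)%:E))//.
rewrite bounded_integral; last by apply: bounded_meas_powR => //; exact: ltW.
by rewrite poweR_EFin ltry.
Qed.

(** The approximation error vanishes once [B^j] reaches the degree, so only finitely many terms
    remain. This is membership only; the coefficient norm is estimated separately. *)
Lemma besov_tpoly (N : needlet_system R d) sigma r (q : \bar R) s (a c : 'rV[int]_d -> R) t :
  1 < r -> (1 <= q)%E -> (forall l, a l != 0 -> freq_norm R l <= t) ->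
  besov N sigma r q (tpoly s a c).
Proof.
move=> r1 q1 at_; have bt := bounded_meas_tpoly s a c.
have r0 : 0 < r by lra.
have B1 := ndB_gt1 N.
have Ft := bounded_Lnorm_lty r0 bt.
split => //; first exact: bt.1.
have [K tK] := ndBX_large N t.
have vanish j : (K <= j)%N -> approx_error (ndB N ^+ j) (tpoly s a c) r = 0%E.
  move=> Kj; apply: approx_error_eq0; first by rewrite gt_eqF.
  apply: trig_poly_tpoly => l al; by rewrite (le_trans (at_ _ al))// ltW// tK.
pose A := fine (Lnorm mu r%:E (EFin \o tpoly s a c)).
have AE : Lnorm mu r%:E (EFin \o tpoly s a c) = A%:E.
  by rewrite fineK// ge0_fin_numE ?Lnorm_ge0.
have A0 : 0 <= A by rewrite fine_ge0// Lnorm_ge0.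
pose M := (1 + \sum_(0 <= j < K) ndB N `^ (j%:R * sigma)) * A.
have S0 : 0 <= \sum_(0 <= j < K) ndB N `^ (j%:R * sigma).
  by apply: sumr_ge0 => j _; exact: powR_ge0.
have M0 : 0 <= M by rewrite mulr_ge0// addr_ge0.
apply: le_lt_trans (ltry (K.+1%:R * M)).
apply: (Lnorm_counting_le (j0 := 0)) => // j.
  by rewrite ltn0 add0n /= => /ltnW Kj; rewrite vanish// mule0.
have [Kj|jK] := leqP K j; first by rewrite vanish// mule0 abse0 lee_fin.
rewrite gee0_abs; last by rewrite mule_ge0 ?approx_error_ge0// lee_fin powR_ge0.
rewrite /M EFinM; apply: lee_pmul; rewrite ?approx_error_ge0 ?lee_fin ?powR_ge0//.
  rewrite big_mkord (bigD1 (Ordinal jK))//=.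
  rewrite addrCA lerDl addr_ge0// sumr_ge0// => i _; exact: powR_ge0.
by rewrite -AE approx_error_le.
Qed.

End approximation_error.

(** * Wave packets *)

Section wave_packets.
Context (R : realType) (d : nat) (N : needlet_system R d) (m : 'I_d -> nat).
Local Notation B := (ndB N).
Local Notation mu := (torus_measure R d).
Local Notation mm := (multi_norm m).
Local Notation box j := (int_box d (band_radius N j)).
Local Notation phase := ((multi_norm m)%:R * (pi / 2)).
Implicit Types (l : 'rV[int]_d) (H : 'rV[int]_d -> R).

(** The bands of two levels can meet only under this condition, so a packet is seen by at most three
    levels of needlets. *)
Definition near_level (j0 j : nat) : bool := (j <= j0.+1)%N && (j0 <= j.+1)%N.

(* [H] are the Fourier coefficients of a perturbation at level [j0], of height [V]
   and carried by a set of measure about [1 / V]. *)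
Record wave_packet (j0 : nat) (V C : R) H : Prop := WavePacket {
  packet_even : forall l, H (- l) = H l;
  packet_band : forall l, H l != 0 -> freq_band B j0 l;
  packet_sum : \sum_(l <- box j0) `|H l| <= C * V;
  packet_samples : forall j, near_level j0 j ->
    \sum_(k < ndK N j) ndlam N k *
      `|tpoly (box j0) (fun l => H l * band_mult N j l) (fun=> 0) (ndxi N k)| <= C;
  packet_Dsamples : forall j, near_level j0 j ->
    \sum_(k < ndK N j) ndlam N k *
      `|tpoly (box j0) (fun l => H l * freq_mono R m l * band_mult N j l)
         (fun=> phase) (ndxi N k)| <= C * B ^+ (j0 * mm);
  packet_int : \int[mu]_x `|tpoly (box j0) (fun l => H l * freq_mono R m l)
     (fun=> phase) x| <= C * B ^+ (j0 * mm);
  packet_norm2 : V * (B ^+ (j0 * mm)) ^+ 2 <=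
    C * \int[mu]_x (tpoly (box j0) (fun l => H l * freq_mono R m l)
     (fun=> phase) x) ^+ 2 }.

Lemma near_level_sum_le j0 J (F : nat -> R) (M : R) : 0 <= M ->
  (forall j, ~~ near_level j0 j -> F j = 0) ->
  (forall j, (j < J)%N -> near_level j0 j -> F j <= M) ->
  \sum_(0 <= j < J) F j <= 3 * M.
Proof.
move=> M0 F0 FM.
have pick a := sum_indicator_le1 R a (iota_uniq 0 (J - 0)).
(* For [j0 = 0] the levels [j0] and [j0.-1] coincide, which only enlarges the majorant. *)
apply: (@le_trans _ _ (\sum_(0 <= j < J) M *
   ((j == j0)%:R + (j == j0.+1)%:R + (j == j0.-1)%:R))).
  rewrite big_nat [leRHS]big_nat; apply: ler_sum => j /andP[_ jJ].
  have [nj|nj] := boolP (near_level j0 j); last first.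
    by rewrite F0// mulr_ge0// !addr_ge0.
  apply: le_trans (FM _ jJ nj) _; rewrite ler_peMr//.
  have : [|| j == j0, j == j0.+1 | j == j0.-1].
    by move: nj; rewrite /near_level => /andP[h1 h2]; lia.
  by case/or3P => ->; rewrite -?addrA ?lerDl ?lerDr ?addr_ge0//;
    rewrite ?[_ + (1 + _)]addrCA ?lerDl ?addr_ge0// addrA lerDr addr_ge0.
rewrite -mulr_sumr mulrC ler_wpM2r// !big_split/=.
by have := pick j0; have := pick j0.+1; have := pick j0.-1; lra.
Qed.

Lemma freq_band0 j : ~ freq_band B j (0 : 'rV[int]_d).
Proof.
move=> /freq_band_sub[+ _]; rewrite freq_norm0 mul0r ltNge.
by rewrite ltW// ndBX_gt0.
Qed.

Lemma freq_band_near j0 j l : freq_band B j0 l -> freq_band B j l -> near_level j0 j.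
Proof.
have B1 := ndB_gt1 N; have B0 := ndB_gt0 N.
move=> /freq_band_sub[h1 h2] /freq_band_sub[h3 h4].
rewrite /near_level; apply/andP; split; rewrite leqNgt; apply/negP => lt.
- have : B ^+ j0.+2 <= B ^+ j by rewrite ler_weXn2l// ltW.
  rewrite leNgt (lt_trans h3)// exprSr ltr_pM2r//.
- have : B ^+ j.+2 <= B ^+ j0 by rewrite ler_weXn2l// ltW.
  by rewrite leNgt (lt_trans h1)// exprSr ltr_pM2r.
Qed.

Section one_packet.
Variables (j0 : nat) (V C : R) (H : 'rV[int]_d -> R).
Hypotheses (V_gt0 : 0 < V) (C_gt0 : 0 < C) (pH : wave_packet j0 V C H).

Lemma packet0 : H 0 = 0.
Proof.
by apply/eqP/negPn/negP => /(packet_band pH)/freq_band0.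
Qed.

Lemma packet_far j l : ~~ near_level j0 j -> H l * band_mult N j l = 0.
Proof.
move=> nj; apply/eqP; rewrite mulf_eq0; apply/negPn/negP; rewrite negb_or.
move=> /andP[/(packet_band pH) h1 /band_mult_neq0 h2].
by move: nj; rewrite (freq_band_near h1 h2).
Qed.

Variable gam : R.
Hypothesis gam_gt0 : 0 < gam.

(** The uniform density sits at the frequency [0], where the packet vanishes, so the perturbed
    density is again a single [tpoly]. *)
Definition perturbed_mult l : R := if l == 0 then ((2 * pi) ^+ d)^-1 else gam * H l.

Definition perturbed_density : 'rV[R]_d -> R :=
  tpoly (box j0) perturbed_mult (fun=> 0).

Lemma perturbed_multE l : perturbed_mult l =
  (l == 0)%:R * ((2 * pi) ^+ d)^-1 + gam * H l.
Proof.
rewrite /perturbed_mult; case: eqP => [->|_]; first by rewrite packet0 mulr0 addr0 mul1r.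
by rewrite mul0r add0r.
Qed.

Lemma perturbed_densityE x : perturbed_density x =
  ((2 * pi) ^+ d)^-1 + gam * tpoly (box j0) H (fun=> 0) x.
Proof.
rewrite /perturbed_density /tpoly.
under eq_bigr do rewrite perturbed_multE mulrDl -!mulrA.
rewrite big_split/= -mulr_sumr; congr (_ + _).
rewrite (bigD1_seq 0) ?uniq_int_box//=; last first.
  by apply: (@freq_norm_le_mem R); rewrite freq_norm0.
rewrite eqxx mul1r freq_dot0 addr0 cos0 mulr1 big1 ?addr0// => l /negbTE ->.
by rewrite mul0r.
Qed.

Lemma packet_le x : `|tpoly (box j0) H (fun=> 0) x| <= C * V.
Proof. exact: le_trans (tpoly_le _ _ _ _) (packet_sum pH). Qed.

Hypothesis gam_le : gam * (C * V) <= ((2 * pi) ^+ d)^-1.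

Lemma perturbed_density_bounds x :
  0 <= perturbed_density x <= 2 * ((2 * pi) ^+ d)^-1.
Proof.
rewrite perturbed_densityE; have := packet_le x.
move: (tpoly _ _ _ _) => T hT.
have : `|gam * T| <= ((2 * pi) ^+ d)^-1.
  by rewrite normrM gtr0_norm// (le_trans _ gam_le)// ler_wpM2l// ltW.
rewrite ler_norml; move: (_^-1) => P /andP[h1 h2].
by apply/andP; split; lra.
Qed.

Lemma bounded_meas_perturbed : bounded_meas perturbed_density.
Proof. exact: bounded_meas_tpoly. Qed.

Lemma perturbed_density_int1 : (\int[mu]_x (perturbed_density x)%:E = 1)%E.
Proof.
rewrite bounded_integral; last exact: bounded_meas_perturbed.
congr EFin; rewrite /perturbed_density /tpoly bounded_integral_sum; last first.
  by move=> l _ _; apply: bounded_measZ; exact: bounded_meas_cos.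
rewrite (eq_bigr (fun l => perturbed_mult l * ((l == 0)%:R * (2 * pi) ^+ d * cos 0))); last first.
  by move=> l _; rewrite bounded_integralZ ?torus_integral_cos//; exact: bounded_meas_cos.
rewrite (bigD1_seq 0) ?uniq_int_box//=; last first.
  by apply: (@freq_norm_le_mem R); rewrite freq_norm0.
rewrite eqxx mul1r cos0 mulr1 /perturbed_mult eqxx mulVf ?gt_eqF ?pi2X_gt0//.
by rewrite big1 ?addr0// => l /negbTE ->; rewrite !mul0r mulr0.
Qed.

Definition perturbed : density R d :=
  @Density R d perturbed_density bounded_meas_perturbed.1
    (fun x _ => (andP (perturbed_density_bounds x)).1) perturbed_density_int1.

Definition packet_derivative : 'rV[R]_d -> R :=
  tpoly (box j0) (fun l => H l * freq_mono R m l) (fun=> phase).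

Lemma perturbed_Dmulti : (0 < mm)%N ->
  is_Dmulti m perturbed (fun x => gam * packet_derivative x).
Proof.
move=> m0; exists perturbed_density; split.
- exact: periodic_tpoly.
- exact: Ck_tpoly.
- exact: aeW.
- rewrite /perturbed_density Dmulti_tpoly; apply/funext => x.
  rewrite /packet_derivative /tpoly mulr_sumr; apply: eq_bigr => l _.
  rewrite add0r mulrA perturbed_multE; congr (_ * _).
  have [->|l0] := eqVneq l 0; first by rewrite freq_mono0// !mulr0.
  by rewrite mul0r add0r mulrA.
Qed.

Lemma perturbed_besov sigma r (q : \bar R) : 1 < r -> (1 <= q)%E ->
  besov N sigma r q perturbed.
Proof.
move=> r1 q1; apply: (@besov_tpoly _ _ _ _ _ _ _ _ _ (B ^+ j0.+1)) => // l.
rewrite perturbed_multE; have [->|l0] := eqVneq l 0.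
  by rewrite freq_norm0 ltW// ndBX_gt0.
rewrite mul0r add0r mulf_eq0 negb_or => /andP[_ /(packet_band pH)/freq_band_sub[_]].
exact: ltW.
Qed.

Lemma perturbed_coef j (k : 'I_(ndK N j)) : needlet_coef perturbed k =
  gam * (Num.sqrt (ndlam N k) *
    tpoly (box j0) (fun l => H l * band_mult N j l) (fun=> 0) (ndxi N k)).
Proof.
rewrite /needlet_coef /= /perturbed_density needlet_inner mulrCA; congr (_ * _).
rewrite /tpoly mulr_sumr; apply: eq_bigr => l _; rewrite perturbed_multE mulrDl.
have -> : (l == 0)%:R / (2 * pi) ^+ d * band_mult N j l = 0 :> R.
  have [->|_] := eqVneq l 0; last by rewrite !mul0r.
  suff -> : band_mult N j 0 = 0 by rewrite mulr0.
  by apply/eqP/negPn/negP => /band_mult_neq0/freq_band0.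
by rewrite add0r -!mulrA.
Qed.

End one_packet.
End wave_packets.

Lemma near_levelPn (j0 j : nat) :
  (j < j0.-1)%N || (j0.-1 + 3 <= j)%N -> ~~ near_level j0 j.
Proof. by rewrite /near_level => /orP[h|h]; lia. Qed.

(** * One perturbed density: Besov norm, noise and risk *)

Section packet_bounds.
Context (R : realType) (d : nat) (N : needlet_system R d) (m : 'I_d -> nat).
Local Notation B := (ndB N).
Local Notation mu := (torus_measure R d).
Local Notation mm := (multi_norm m).
Local Notation box j := (int_box d (band_radius N j)).
Local Notation phase := ((multi_norm m)%:R * (pi / 2)).
Hypothesis m_gt0 : (0 < multi_norm m)%N.
Variables (cl Cl M : R).
Hypotheses (cl_gt0 : 0 < cl) (Cl_gt0 : 0 < Cl) (M_gt0 : 0 < M).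
Hypothesis lam_bounds : forall j (k : 'I_(ndK N j)),
  cl / B ^+ (j * d) <= ndlam N k <= Cl / B ^+ (j * d).
Hypothesis ndb_leM : forall x, ndb N x <= M.

Lemma sqrt_lam_le j (k : 'I_(ndK N j)) :
  Num.sqrt (ndlam N k) <= Num.sqrt Cl / Num.sqrt (B ^+ (j * d)).
Proof.
have /andP[_ h] := lam_bounds k; have Bj := ndBX_gt0 N (j * d).
by rewrite -sqrtrV ?(ltW Bj)// -sqrtrM ?(ltW Cl_gt0)// ler_sqrt// divr_ge0// ltW.
Qed.

(** Coefficients carry the weight [sqrt lambda], cubature sums the weight [lambda]; the lower bound
    on [lambda] converts one into the other at the price [B^(j d / 2)]. *)
Lemma sqrt_samples_le j (T : 'rV[R]_d -> R) (S : R) :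
  \sum_(k < ndK N j) ndlam N k * `|T (ndxi N k)| <= S ->
  \sum_(k < ndK N j) Num.sqrt (ndlam N k) * `|T (ndxi N k)| <=
    Num.sqrt (B ^+ (j * d)) / Num.sqrt cl * S.
Proof.
have Bj := ndBX_gt0 N (j * d).
have sB : 0 < Num.sqrt (B ^+ (j * d)) by rewrite sqrtr_gt0.
have sc : 0 < Num.sqrt cl by rewrite sqrtr_gt0.
move=> TS; apply: le_trans (ler_wpM2l (ltW (divr_gt0 sB sc)) TS).
rewrite mulr_sumr; apply: ler_sum => k _; rewrite mulrA ler_wpM2r//.
have l0 := ndlam_gt0 k; have /andP[h _] := lam_bounds k.
have sl : 0 < Num.sqrt (ndlam N k) by rewrite sqrtr_gt0.
rewrite -[X in _ * X](sqr_sqrtr (ltW l0)) expr2 mulrA ler_peMl ?(ltW sl)//.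
rewrite mulrAC ler_pdivlMr// mul1r -sqrtrM ?(ltW Bj)// ler_sqrt; last first.
  by rewrite mulr_ge0// ltW.
by move: h; rewrite ler_pdivrMr// mulrC.
Qed.

(** Interpolation of [l^r] between [l^1] and [l^oo], which brings in the height of a packet next to
    its mass. *)
Lemma sum_powR_le (n : nat) (y : 'I_n -> R) (Y S r : R) : 1 < r ->
  (forall k, 0 <= y k <= Y) -> \sum_(k < n) y k <= S ->
  \sum_(k < n) y k `^ r <= Y `^ (r - 1) * S.
Proof.
move=> r1 yY yS; apply: le_trans (ler_wpM2l (powR_ge0 _ _) yS).
rewrite mulr_sumr; apply: ler_sum => k _; have /andP[y0 yk] := yY k.
rewrite -mulr_powRB1//; last by lra.
rewrite mulrC ler_wpM2r//.
by apply: ge0_ler_powR; rewrite ?nnegrE ?subr_ge0 ?(ltW r1) ?(le_trans y0 yk) ?y0 ?yk.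
Qed.

Lemma sqrt_BXE j : Num.sqrt (B ^+ (j * d)) = B `^ (j%:R * d%:R / 2).
Proof.
have B0 := ndB_gt0 N.
rewrite -powR12_sqrt ?ltW ?ndBX_gt0// -powR_mulrn ?ltW// -powRrM natrM.
by [].
Qed.

(** With [P = B^(j d / 2)], the weight [B^(j d (1/2 - 1/r))] of the Besov norm compensates exactly
    the powers of [P] left by sampling. *)
Lemma powR_cancel (r P A S : R) : 1 < r -> 0 < P -> 0 < A -> 0 < S ->
  (P * P `^ (- (2 / r))) * ((A / P) `^ (r - 1) * (S * P)) `^ r^-1 =
  (A `^ (r - 1) * S) `^ r^-1.
Proof.
move=> r1 P0 A0 S0; have rn0 : r != 0 by rewrite gt_eqF//; lra.
have -> : (A / P) `^ (r - 1) * (S * P) = (A `^ (r - 1) * S) * P `^ (2 - r).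
  rewrite powRM ?invr_ge0 ?ltW// -powR_inv1 ?ltW// -powRrM mulrACA; congr (_ * _).
  rewrite -[X in _ * X](powRr1 (ltW P0)) -powRD; last by rewrite (gt_eqF P0) implybT.
  by congr (_ `^ _); ring.
rewrite [X in _ * X]powRM ?mulr_ge0 ?powR_ge0 ?ltW// -powRrM.
rewrite -[X in X * _ * _](powRr1 (ltW P0)) mulrCA mulrA.
rewrite -!powRD ?(gt_eqF P0) ?implybT//.
rewrite -mulrA -powRD ?(gt_eqF P0) ?implybT//.
rewrite [X in P `^ X](_ : _ = 0) ?powRr0 ?mul1r ?mulr1//.
by field.
Qed.

Variables (kappa : R) (eta : R -> R -> R).
Hypotheses (kappa_gt0 : 0 < kappa) (etaP : threshold_rule eta).

Section one_packet.
Variables (j0 : nat) (V C : R) (H : 'rV[int]_d -> R).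
Hypotheses (V_gt0 : 0 < V) (C_gt0 : 0 < C) (pH : wave_packet N m j0 V C H).
Variable gam : R.
Hypothesis gam_gt0 : 0 < gam.
Hypothesis gam_le : gam * (C * V) <= ((2 * pi) ^+ d)^-1.
Local Notation f := (perturbed pH gam_gt0 gam_le).
Local Notation phi := (packet_derivative N m j0 H).

Lemma band_mult_le j l : `|band_mult N j l| <= M.
Proof. by rewrite ger0_norm ?ndb_ge0//; exact: ndb_leM. Qed.

Definition besov_const (r : R) : R :=
  ((Num.sqrt Cl * (M * C)) `^ (r - 1) * (C / Num.sqrt cl)) `^ r^-1.

Lemma besov_const_gt0 r : 0 < besov_const r.
Proof.
by rewrite powR_gt0// mulr_gt0 ?powR_gt0 ?divr_gt0 ?mulr_gt0 ?sqrtr_gt0.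
Qed.

(** The factor [V^(1 - 1/r)] is the [L^r] norm of a function of height [V] carried by a set of
    measure [1 / V]. *)
Lemma perturbed_coef_norm_le sigma r j : 1 < r -> near_level j0 j ->
  B `^ (j%:R * (sigma + d%:R * (2^-1 - r^-1))) *
    (\sum_(k < ndK N j) `|needlet_coef f k| `^ r) `^ r^-1 <=
  gam * (besov_const r * V `^ (1 - r^-1)) * B `^ (j%:R * sigma).
Proof.
move=> r1 nj; have r0 : 0 < r by lra. have B0 := ndB_gt0 N.
pose T := tpoly (box j0) (fun l => H l * band_mult N j l) (fun=> 0) : 'rV[R]_d -> R.
pose y (k : 'I_(ndK N j)) := Num.sqrt (ndlam N k) * `|T (ndxi N k)|.
pose P := Num.sqrt (B ^+ (j * d)).
have P0 : 0 < P by rewrite sqrtr_gt0 ndBX_gt0.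
pose A := Num.sqrt Cl * (M * C) * V.
have A0 : 0 < A by rewrite !mulr_gt0// sqrtr_gt0.
pose S := C / Num.sqrt cl; have S0 : 0 < S by rewrite divr_gt0// sqrtr_gt0.
have T_le x : `|T x| <= M * (C * V).
  rewrite (le_trans (tpoly_le _ _ _ _))// (le_trans _ (ler_wpM2l (ltW M_gt0) (packet_sum pH)))//.
  rewrite mulr_sumr; apply: ler_sum => l _.
  by rewrite normrM mulrC ler_wpM2r// band_mult_le.
have yA k : 0 <= y k <= A / P.
  rewrite mulr_ge0 ?sqrtr_ge0//=.
  apply: le_trans (ler_pM (sqrtr_ge0 _) (normr_ge0 _) (sqrt_lam_le k) (T_le _)) _.
  by apply: eq_ler; rewrite /A /P; field; rewrite gt_eqF.
have yS : \sum_(k < ndK N j) y k <= S * P.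
  apply: le_trans (sqrt_samples_le (packet_samples pH nj)) _.
  by apply: eq_ler; rewrite /S /P; field; rewrite gt_eqF// sqrtr_gt0.
have yr := sum_powR_le r1 yA yS.
have -> : \sum_(k < ndK N j) `|needlet_coef f k| `^ r = gam `^ r * \sum_(k < ndK N j) y k `^ r.
  rewrite mulr_sumr; apply: eq_bigr => k _.
  rewrite perturbed_coef normrM gtr0_norm// normrM ger0_norm ?sqrtr_ge0//.
  by rewrite powRM ?(ltW gam_gt0)// mulr_ge0// sqrtr_ge0.
rewrite powRM ?powR_ge0//; last by apply: sumr_ge0 => k _; exact: powR_ge0.
rewrite -powRrM divff ?gt_eqF// powRr1 ?(ltW gam_gt0)//.
have h : (\sum_(k < ndK N j) y k `^ r) `^ r^-1 <= ((A / P) `^ (r - 1) * (S * P)) `^ r^-1.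
  rewrite ge0_ler_powR ?invr_ge0 ?(ltW r0)// ?nnegrE.
    by apply: sumr_ge0 => k _; exact: powR_ge0.
  by rewrite mulr_ge0 ?powR_ge0// mulr_ge0// ltW.
rewrite mulrCA -mulrA ler_wpM2l ?(ltW gam_gt0)//.
apply: le_trans (ler_wpM2l (powR_ge0 _ _) h) _.
have -> : B `^ (j%:R * (sigma + d%:R * (2^-1 - r^-1))) =
    B `^ (j%:R * sigma) * (P * P `^ (- (2 / r))).
  rewrite /P sqrt_BXE -powRrM -!powRD ?(gt_eqF B0) ?implybT//.
  by congr (_ `^ _); field; rewrite gt_eqF.
rewrite -[X in X <= _]mulrA powR_cancel// mulrC ler_wpM2r ?powR_ge0//.
apply: eq_ler.
rewrite /besov_const /A -/S.
have X0 : 0 <= Num.sqrt Cl * (M * C) by rewrite !mulr_ge0 ?sqrtr_ge0 ?ltW.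
have C0 := ltW C_gt0.
rewrite [X in (X * S) `^ _]powRM ?(ltW V_gt0)// [_ * S]mulrAC.
rewrite [LHS]powRM ?powR_ge0//; last by rewrite mulr_ge0 ?powR_ge0// ltW.
rewrite -[V `^ (r - 1) `^ _]powRrM; congr (_ * _ `^ _).
by field; rewrite gt_eqF.
Qed.

Lemma perturbed_coef_far j (k : 'I_(ndK N j)) : ~~ near_level j0 j ->
  needlet_coef f k = 0.
Proof.
move=> nj; rewrite perturbed_coef /tpoly big1 => [|l _]; first by rewrite !mulr0.
by rewrite (packet_far pH)// mul0r.
Qed.

Lemma perturbed_coef_norm_far r j : 1 < r -> ~~ near_level j0 j ->
  (\sum_(k < ndK N j) `|needlet_coef f k| `^ r) `^ r^-1 = 0.
Proof.
move=> r1 nj; have r0 : r != 0 by rewrite gt_eqF//; lra.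
rewrite big1 => [|k _]; first by rewrite powR0// invr_eq0.
by rewrite perturbed_coef_far// normr0 powR0.
Qed.

Lemma perturbed_besov_norm sigma r (q : \bar R) : 1 < r -> (1 <= q)%E -> 0 <= sigma ->
  (besov_norm N sigma r q f <=
   (3 * (gam * (besov_const r * V `^ (1 - r^-1)) * B `^ (j0.+1%:R * sigma)))%:E)%E.
Proof.
move=> r1 q1 s0; have B1 := ndB_gt1 N.
have K0 : 0 <= gam * (besov_const r * V `^ (1 - r^-1)).
  by rewrite !mulr_ge0 ?powR_ge0 ?(ltW gam_gt0) ?(ltW (besov_const_gt0 _)).
have M0 : 0 <= gam * (besov_const r * V `^ (1 - r^-1)) * B `^ (j0.+1%:R * sigma).
  by rewrite mulr_ge0 ?powR_ge0.
rewrite /besov_norm; apply: (Lnorm_counting_le (j0 := j0.-1) (K := 3) q1 _ M0) => //.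
- move=> j /near_levelPn nj.
  by rewrite perturbed_coef_norm_far// mulr0.
- move=> j; have [nj|nj] := boolP (near_level j0 j); last first.
    by rewrite perturbed_coef_norm_far// mulr0 abse0 lee_fin.
  rewrite /= lee_fin ger0_norm; last by rewrite mulr_ge0 ?powR_ge0.
  apply: le_trans (perturbed_coef_norm_le _ r1 nj) _.
  rewrite ler_wpM2l// ler_powR ?(ltW B1)// ler_wpM2r// ler_nat.
  by move: nj => /andP[].
Qed.

Local Notation P := ((2 * pi) ^+ d : R).

Lemma ndBX_le j j' : (j <= j')%N -> B ^+ j <= B ^+ j'.
Proof. by move=> jj; rewrite ler_weXn2l// ltW// ndB_gt1. Qed.

Lemma packet_derivative_le x : `|phi x| <= C * V * B ^+ (j0.+1 * mm).
Proof.
rewrite (le_trans (tpoly_le _ _ _ _))//.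
apply: le_trans (ler_wpM2r (ltW (ndBX_gt0 N _)) (packet_sum pH)).
rewrite mulr_suml; apply: ler_sum => l _; rewrite normrM.
have [->|Hl] := eqVneq (H l) 0; first by rewrite normr0 !mul0r.
have [_ /ltW lB] := freq_band_sub (packet_band pH Hl).
by rewrite ler_wpM2l// exprM freq_mono_le.
Qed.

(** The factor [2 * P^-1] bounds the density; the rest is [Dneedlet_norm2_le] with
    [ndlam N k <= Cl / B^(j d)]. *)
Definition variance_const : R :=
  2 * P^-1 * (P^-1 * Cl * (M * B ^+ mm) ^+ 2 * (2 * B + 3) ^+ d).

Definition bias_const : R := Cl * (M * B ^+ mm) ^+ 2 * C ^+ 2 * B ^+ d.

Lemma Dneedlet_variance_le j (k : 'I_(ndK N j)) :
  \int[mu]_x (Dmulti m (needlet k) x ^+ 2 * f x) <= variance_const * (B ^+ (j * mm)) ^+ 2.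
Proof.
have P0 := @pi2X_gt0 R d; have B0 := ndB_gt0 N.
have bD := bounded_meas_Dneedlet m k.
have bD2 := bounded_measX 2 bD.
have bf : bounded_meas f := bounded_meas_perturbed N j0 H gam.
apply: (@le_trans _ _ (\int[mu]_x (2 * P^-1 * Dmulti m (needlet k) x ^+ 2))).
  apply: bounded_le_integral; [exact: bounded_measM|exact: bounded_measZ|move=> x].
  rewrite mulrC ler_wpM2r ?sqr_ge0//.
  by have /andP[] := perturbed_density_bounds pH gam_gt0 gam_le x.
rewrite bounded_integralZ// /variance_const -[leRHS]mulrA.
have P1 : 0 <= 2 * P^-1 by rewrite mulr_ge0// invr_ge0 ltW.
rewrite ler_wpM2l//.
have := Dneedlet_norm2_le m k (ltW M_gt0) ndb_leM; move=> /le_trans; apply.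
have /andP[_ lam] := lam_bounds k.
have -> : ndlam N k * P^-1 * (M * B ^+ (j.+1 * mm)) ^+ 2 * ((2 * B + 3) * B ^+ j) ^+ d =
   (ndlam N k * B ^+ (j * d)) * (P^-1 * (M * B ^+ mm) ^+ 2 * (2 * B + 3) ^+ d * (B ^+ (j * mm)) ^+ 2).
  by rewrite mulSn exprD [((_ + 3) * _) ^+ d]exprMn -[(B ^+ j) ^+ d]exprM; ring.
have -> : P^-1 * Cl * (M * B ^+ mm) ^+ 2 * (2 * B + 3) ^+ d * (B ^+ (j * mm)) ^+ 2 =
  Cl * (P^-1 * (M * B ^+ mm) ^+ 2 * (2 * B + 3) ^+ d * (B ^+ (j * mm)) ^+ 2) by ring.
rewrite ler_wpM2r//; last by rewrite -ler_pdivlMr// ndBX_gt0.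
apply: mulr_ge0; last exact: sqr_ge0.
apply: mulr_ge0; last by rewrite exprn_ge0// addr_ge0// mulr_ge0// ltW.
by apply: mulr_ge0; [rewrite invr_ge0 ltW|exact: sqr_ge0].
Qed.

Lemma Dneedlet_int0 j (k : 'I_(ndK N j)) : \int[mu]_x Dmulti m (needlet k) x = 0.
Proof.
rewrite Dmulti_needletE /tpoly bounded_integral_sum; last first.
  by move=> l _ _; apply: bounded_measZ; exact: bounded_meas_cos.
apply: big1 => l _; rewrite bounded_integralZ; last exact: bounded_meas_cos.
rewrite torus_integral_cos; have [->|_] := eqVneq l 0; last by rewrite !mul0r mulr0.
by rewrite freq_mono0// mulr0 mul0r.
Qed.

(** The uniform part of the density integrates to zero against a derivative, so only [gam] times the
    packet is left. *)
Lemma Dneedlet_bias_le j (k : 'I_(ndK N j)) :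
  `|\int[mu]_x (Dmulti m (needlet k) x * f x)| <=
  gam * (Num.sqrt (ndlam N k) * (M * B ^+ (j.+1 * mm)) * (C * V)).
Proof.
have bD := bounded_meas_Dneedlet m k.
pose h := tpoly (box j0) H (fun=> 0) : 'rV[R]_d -> R.
have bh : bounded_meas h by exact: bounded_meas_tpoly.
have -> : \int[mu]_x (Dmulti m (needlet k) x * f x) =
    gam * \int[mu]_x (h x * Dmulti m (needlet k) x).
  transitivity (\int[mu]_x (P^-1 * Dmulti m (needlet k) x +
      gam * (h x * Dmulti m (needlet k) x))).
    by apply: eq_Rintegral => x _; rewrite /= (perturbed_densityE pH) -/(h x); ring.
  rewrite bounded_integralD; [|exact: bounded_measZ|]; last first.
    by apply: bounded_measZ; exact: bounded_measM.
  rewrite (bounded_integralZ mu P^-1 bD) Dneedlet_int0 mulr0 add0r bounded_integralZ//.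
  exact: bounded_measM.
rewrite normrM gtr0_norm// ler_wpM2l ?(ltW gam_gt0)//.
rewrite (le_trans (Dneedlet_inner_le m k _ _ _ (ltW M_gt0) ndb_leM))//.
rewrite ler_wpM2l ?(packet_sum pH)//.
by rewrite !mulr_ge0 ?sqrtr_ge0 ?(ltW M_gt0) ?(ltW (ndBX_gt0 N _)).
Qed.

Section sample_size.
Variable n : nat.
Hypothesis n_ge2 : (2 <= n)%N.
Hypothesis gamV_le : (gam * V) ^+ 2 <= B ^+ (j0 * d) / n%:R.
Local Notation tau := (threshold N m kappa n).

Let n_gt0 : 0 < n%:R :> R. Proof. by rewrite ltr0n; exact: ltnW. Qed.

(** By [gamV_le] the squared mean, of order [(gam V)^2 B^(- j d) B^(2 j mm)], is at most a multiple
    of [B^(2 j mm) / n], the order of the variance bound. *)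
Lemma packet_noise_level j (k : 'I_(ndK N j)) : near_level j0 j ->
  noise_level m kappa n f k <=
  (tau j)^-1 * (n%:R^-1 * ((variance_const + bias_const) * (B ^+ (j * mm)) ^+ 2)).
Proof.
move=> nj; have B0 := ndB_gt0 N.
rewrite /noise_level ler_wpM2l//.
  by rewrite invr_ge0 ltW// threshold_gt0.
rewrite mulrDl mulrDr lerD//.
  by rewrite ler_wpM2l ?Dneedlet_variance_le// invr_ge0 ltW.
rewrite -[leLHS]real_normK ?num_real//.
have h := Dneedlet_bias_le k.
have h0 : 0 <= gam * (Num.sqrt (ndlam N k) * (M * B ^+ (j.+1 * mm)) * (C * V)).
  exact: le_trans h.
apply: (@le_trans _ _ ((gam * (Num.sqrt (ndlam N k) * (M * B ^+ (j.+1 * mm)) * (C * V))) ^+ 2)).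
  by rewrite ler_sqr ?nnegrE.
have -> : (gam * (Num.sqrt (ndlam N k) * (M * B ^+ (j.+1 * mm)) * (C * V))) ^+ 2 =
    (gam * V) ^+ 2 * (Num.sqrt (ndlam N k) ^+ 2) *
      ((M * B ^+ mm) ^+ 2 * C ^+ 2 * (B ^+ (j * mm)) ^+ 2).
  by rewrite mulSn exprD; ring.
rewrite sqr_sqrtr ?(ltW (ndlam_gt0 k))//.
have -> : n%:R^-1 * (bias_const * (B ^+ (j * mm)) ^+ 2) =
    (Cl * B ^+ d / n%:R) * ((M * B ^+ mm) ^+ 2 * C ^+ 2 * (B ^+ (j * mm)) ^+ 2).
  by rewrite /bias_const; ring.
apply: ler_wpM2r; first by rewrite -!exprMn sqr_ge0.
have /andP[_ lam] := lam_bounds k.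
apply: le_trans (ler_pM (sqr_ge0 _) (ltW (ndlam_gt0 k)) gamV_le lam) _.
have Bj := ndBX_gt0 N (j * d).
have -> : B ^+ (j0 * d) / n%:R * (Cl / B ^+ (j * d)) =
    Cl * (B ^+ (j0 * d) / B ^+ (j * d)) / n%:R by ring.
rewrite ler_wpM2r ?invr_ge0 ?(ltW n_gt0)// ler_wpM2l ?(ltW Cl_gt0)//.
rewrite ler_pdivrMr// -exprD -mulSn; apply: ndBX_le.
by rewrite leq_mul2r; case/andP: nj => _ ->; rewrite orbT.
Qed.

Definition noise_const : R :=
  3 * (B ^+ d / Num.sqrt cl * C * (kappa^-1 * ((variance_const + bias_const) * B ^+ mm))).

Lemma consts_ge0 : 0 <= variance_const + bias_const.
Proof.
have P0 := @pi2X_gt0 R d; have B0 := ndB_gt0 N.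
have X0 : 0 <= (2 * B + 3) ^+ d by rewrite exprn_ge0// addr_ge0// mulr_ge0// ltW.
have Y0 : 0 <= (M * B ^+ mm) ^+ 2 by exact: sqr_ge0.
have Q0 : 0 <= P^-1 by rewrite invr_ge0 ltW.
have Bd : 0 <= B ^+ d by rewrite ltW// ndBX_gt0.
have Cl0 := ltW Cl_gt0.
rewrite /variance_const /bias_const; apply: addr_ge0.
  apply: mulr_ge0; first by rewrite mulr_ge0.
  by apply: mulr_ge0 => //; apply: mulr_ge0 => //; apply: mulr_ge0.
apply: mulr_ge0 => //; apply: mulr_ge0; last exact: sqr_ge0.
exact: mulr_ge0.
Qed.

(** On each of three levels, the coefficients of [phi] sum up to order [B^(j0 d / 2) B^(j0 mm)], and
    the noise level is of order [B^(j0 mm)] over [n] times the square root of [ln n / n]. *)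
Lemma packet_noise_sum J :
  \sum_(0 <= j < J) \sum_(k < ndK N j)
    `|\int[mu]_x (phi x * needlet k x)| * noise_level m kappa n f k <=
  noise_const * (Num.sqrt (B ^+ (j0 * d)) * (B ^+ (j0 * mm)) ^+ 2 /
    (n%:R * Num.sqrt (ln n%:R / n%:R))).
Proof.
set rn := Num.sqrt (ln n%:R / n%:R).
have n1 : 1 < n%:R :> R by rewrite ltr1n.
have rn0 : 0 < rn by rewrite sqrtr_gt0 divr_gt0// ln_gt0.
have E0 := consts_ge0; have B0 := ndB_gt0 N.
have sc : 0 < Num.sqrt cl by rewrite sqrtr_gt0.
have Bd := ndBX_gt0 N d; have Bm := ndBX_gt0 N mm; have Bjm := ndBX_gt0 N (j0 * mm).
pose K := B ^+ d / Num.sqrt cl * C * (kappa^-1 * ((variance_const + bias_const) * B ^+ mm)).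
pose W := Num.sqrt (B ^+ (j0 * d)) * (B ^+ (j0 * mm)) ^+ 2 / (n%:R * rn).
have W0 : 0 <= W.
  by apply: divr_ge0; apply: mulr_ge0; rewrite ?sqrtr_ge0 ?sqr_ge0 ?(ltW n_gt0) ?(ltW rn0).
have K0 : 0 <= K.
  apply: mulr_ge0; first by rewrite !mulr_ge0 ?invr_ge0// ltW.
  by apply: mulr_ge0; [rewrite invr_ge0 ltW|apply: mulr_ge0 => //; exact: ltW].
rewrite /noise_const -/K -mulrA; apply: (@near_level_sum_le R j0) => //.
- by rewrite mulr_ge0.
- move=> j nj; apply: big1 => k _.
  rewrite /packet_derivative needlet_inner [tpoly _ _ _ _]big1 => [|l _].
    by rewrite mulr0 normr0 mul0r.
  by rewrite [X in X * _]mulrAC (packet_far pH)// !mul0r.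
- move=> j _ nj.
  have t0 : 0 < tau j by exact: threshold_gt0.
  pose nb := (tau j)^-1 * (n%:R^-1 * ((variance_const + bias_const) * (B ^+ (j * mm)) ^+ 2)).
  have nb0 : 0 <= nb.
    by rewrite /nb mulr_ge0 ?invr_ge0 ?(ltW t0)// mulr_ge0 ?invr_ge0 ?(ltW n_gt0)// mulr_ge0 ?sqr_ge0.
  apply: (@le_trans _ _ (\sum_(k < ndK N j) `|\int[mu]_x (phi x * needlet k x)| * nb)).
    apply: ler_sum => k _; rewrite ler_wpM2l//; exact: packet_noise_level.
  rewrite -mulr_suml.
  pose T := tpoly (box j0) (fun l => H l * freq_mono R m l * band_mult N j l)
    (fun=> phase) : 'rV[R]_d -> R.
  have -> : \sum_(k < ndK N j) `|\int[mu]_x (phi x * needlet k x)| =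
      \sum_(k < ndK N j) Num.sqrt (ndlam N k) * `|T (ndxi N k)|.
    apply: eq_bigr => k _; rewrite /packet_derivative needlet_inner normrM.
    by rewrite ger0_norm ?sqrtr_ge0.
  have h := sqrt_samples_le (packet_Dsamples pH nj).
  apply: le_trans (ler_wpM2r nb0 h) _.
  have Bj := ndBX_gt0 N (j * mm).
  have -> : nb = (kappa * rn * n%:R)^-1 * (variance_const + bias_const) * B ^+ (j * mm).
    rewrite /nb /threshold -/rn; move: (variance_const + bias_const) => E.
    by field; rewrite !gt_eqF.
  have /andP[nj1 nj2] := nj.
  (* The factor [B^(d / 2)] would be natural; [B^d] avoids a half-integer power. *)
  have hd : Num.sqrt (B ^+ (j * d)) <= Num.sqrt (B ^+ (j0 * d)) * B ^+ d.
    rewrite -[X in _ * X](@ger0_norm _ (B ^+ d)) ?(ltW Bd)// -sqrtr_sqr.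
    rewrite -sqrtrM ?(ltW (ndBX_gt0 N _))// ler_sqrt; last first.
      by rewrite mulr_ge0 ?sqr_ge0// ltW// ndBX_gt0.
    rewrite -exprM -exprD; apply: ndBX_le.
    apply: (@leq_trans (j0.+1 * d)); first by rewrite leq_mul2r nj1 orbT.
    by rewrite mulSn addnC leq_add2l muln2 -addnn leq_addr.
  have hm : B ^+ (j * mm) <= B ^+ (j0 * mm) * B ^+ mm.
    by rewrite -exprD -mulSnr; apply: ndBX_le; rewrite leq_mul2r nj1 orbT.
  pose Z := C * B ^+ (j0 * mm) / Num.sqrt cl *
    ((kappa * rn * n%:R)^-1 * (variance_const + bias_const)).
  have -> : K * W = (Num.sqrt (B ^+ (j0 * d)) * B ^+ d) * (B ^+ (j0 * mm) * B ^+ mm) * Z.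
    rewrite /K /W /Z; move: (variance_const + bias_const) => E.
    by field; rewrite !gt_eqF.
  have -> : Num.sqrt (B ^+ (j * d)) / Num.sqrt cl * (C * B ^+ (j0 * mm)) *
      ((kappa * rn * n%:R)^-1 * (variance_const + bias_const) * B ^+ (j * mm)) =
      Num.sqrt (B ^+ (j * d)) * B ^+ (j * mm) * Z by rewrite /Z; ring.
  rewrite ler_wpM2r//.
    by rewrite /Z !mulr_ge0 ?invr_ge0 ?mulr_ge0 ?(ltW C_gt0) ?(ltW Bjm) ?(ltW sc) ?(ltW kappa_gt0) ?(ltW rn0) ?(ltW n_gt0).
  by rewrite ler_pM// ?sqrtr_ge0// ltW.
Qed.

End sample_size.

Section sample_risk.
Variable n : nat.
Hypothesis n_ge2 : (2 <= n)%N.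
Variable X : iid_sample n f.
Local Notation W := (B ^+ (j0 * mm)).

Hypothesis noise_le : \sum_(0 <= j < cutoff N m n) \sum_(k < ndK N j)
    `|\int[mu]_x (phi x * needlet k x)| * noise_level m kappa n f k <=
  gam * V * W ^+ 2 / (2 * C).

(** Half of the lower bound [gam V W^2 / C] for the signal; the other half absorbs the noise. *)
Let L := gam * V * W ^+ 2 / (2 * C).

Let W_gt0 : 0 < W. Proof. exact: ndBX_gt0. Qed.

Let L_gt0 : 0 < L.
Proof.
have W2 : 0 < W ^+ 2 by exact: exprn_gt0.
by rewrite /L; apply: divr_gt0; rewrite !mulr_gt0.
Qed.

Let bphi : bounded_meas phi. Proof. exact: bounded_meas_tpoly. Qed.

Let bf : bounded_meas f := bounded_meas_perturbed N j0 H gam.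

Let f_ge0 x : 0 <= f x.
Proof. by have /andP[] := perturbed_density_bounds pH gam_gt0 gam_le x. Qed.

Let signal : L + \sum_(0 <= j < cutoff N m n) \sum_(k < ndK N j)
    `|\int[mu]_x (phi x * needlet k x)| * noise_level m kappa n f k <=
  \int[mu]_x (gam * phi x * phi x).
Proof.
apply: (@le_trans _ _ (L + L)); first by rewrite lerD2l.
have := packet_norm2 pH; rewrite -/phi -ler_pdivrMl// => h.
have -> : \int[mu]_x (gam * phi x * phi x) = \int[mu]_x (gam * (phi x ^+ 2)).
  by apply: eq_Rintegral => x _; rewrite expr2 mulrA.
rewrite bounded_integralZ; last exact: bounded_measX.
apply: le_trans (ler_wpM2l (ltW gam_gt0) h).
apply: eq_ler; rewrite /L.
by field; rewrite gt_eqF.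
Qed.

Lemma packet_Loo_risk :
  ((gam * V * W / (2 * C ^+ 2))%:E <= Loo_risk N m kappa eta X (fun x => (gam * phi x)%R))%E.
Proof.
have bg : bounded_meas (fun x => gam * phi x) by exact: bounded_measZ.
have := Loo_risk_ge kappa_gt0 etaP n_ge2 X bf f_ge0 bg bphi signal
  (mulr_gt0 C_gt0 W_gt0) (packet_int pH).
congr (_ <= _)%E; congr EFin; rewrite /L; field.
by rewrite !gt_eqF.
Qed.

(** Up to constants, the height [gam V W] of the missed derivative to the power [p], times the
    measure [1 / V] of the set that carries it. *)
Lemma packet_Lp_risk (p : R) : 1 <= p ->
  (((gam * V * W / (2 * C ^+ 2)) `^ p / (V * B ^+ mm))%:E <=
   Lp_risk N m kappa eta p X (fun x => (gam * phi x)%R))%E.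
Proof.
move=> p1; have bg : bounded_meas (fun x => gam * phi x) by exact: bounded_measZ.
have CV0 : 0 < C * V * B ^+ (j0.+1 * mm) by rewrite !mulr_gt0 ?ndBX_gt0.
have := Lp_risk_ge kappa_gt0 etaP n_ge2 X bf f_ge0 bg bphi L_gt0 signal CV0
  packet_derivative_le (mulr_gt0 C_gt0 W_gt0) (packet_int pH) p1.
congr (_ <= _)%E; congr EFin.
have CW : 0 < C * W by rewrite mulr_gt0.
have X0 : 0 < gam * V * W / (2 * C ^+ 2).
  have C2 : 0 < C ^+ 2 by exact: exprn_gt0.
  by apply: divr_gt0; rewrite !mulr_gt0.
have -> : L = gam * V * W / (2 * C ^+ 2) * (C * W).
  by rewrite /L; field; rewrite gt_eqF.
rewrite powRM ?(ltW X0) ?(ltW CW)//.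
have -> : (C * W) `^ p = (C * W) `^ (p - 1) * (C * W).
  rewrite -[X in _ = _ * X](powRr1 (ltW CW)) -powRD ?subrK//.
  by rewrite (gt_eqF CW) implybT.
have Y0 : 0 < (C * W) `^ (p - 1) by rewrite powR_gt0.
rewrite mulSn exprD; have Bm := ndBX_gt0 N mm.
move: (_ `^ p) ((C * W) `^ (p - 1)) Y0 => Z Y Y0.
by field; rewrite !gt_eqF.
Qed.

End sample_risk.

End one_packet.
End packet_bounds.

Section packet_lower_bound.
Context (R : realType) (d : nat) (N : needlet_system R d) (m : 'I_d -> nat).
Hypothesis m_gt0 : (0 < multi_norm m)%N.
Variables (kappa : R) (eta : R -> R -> R) (sigma r : R) (q : \bar R).
Hypotheses (kappa_gt0 : 0 < kappa) (etaP : threshold_rule eta).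
Hypotheses (sigma_ge0 : 0 <= sigma) (r_gt1 : 1 < r) (q_ge1 : (1 <= q)%E).
Local Notation B := (ndB N).
Local Notation mm := (multi_norm m).

(* The two alternatives on the sample size: either the levels of the packet are not
   estimated at all, or they are thresholded away. *)
Lemma packet_lower_bound (C : R) : 0 < C -> exists K : R, 0 < K /\
  forall j0 V H gam (G : R) n, 0 < V -> wave_packet N m j0 V C H -> 0 < gam -> (2 <= n)%N ->
  K * (gam * V) <= 1 ->
  K * (gam * V `^ (1 - r^-1) * B `^ (j0%:R * sigma)) <= G ->
  (cutoff N m n < j0)%N \/
    ((gam * V) ^+ 2 <= B ^+ (j0 * d) / n%:R /\
     K * Num.sqrt (B ^+ (j0 * d)) <= gam * V * (n%:R * Num.sqrt (ln n%:R / n%:R))) ->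
  forall X : (forall f : density R d, iid_sample n f),
  exists (f : density R d) (g : 'rV[R]_d -> R),
  [/\ besov_ball N sigma r q G f, is_Dmulti m f g,
    (forall p, 1 <= p ->
      (((K^-1 * (gam * V * B ^+ (j0 * mm))) `^ p / (K * V))%:E <=
       Lp_risk N m kappa eta p (X f) g)%E) &
    ((K^-1 * (gam * V * B ^+ (j0 * mm)))%:E <= Loo_risk N m kappa eta (X f) g)%E].
Proof.
move=> C0; have [cl [Cl [cl0 Cl0 lamB]]] := ndlam_bounds N.
have [M M0 bM] := ndb_le N.
have P0 := @pi2X_gt0 R d; have B0 := ndB_gt0 N.
(* [K1] makes the density nonnegative, [K2] keeps it in the Besov ball, [K3] makes the signal
   dominate the noise, [K4] is lost in testing and [K5] comes from the height of the derivative.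
   Their sum serves all purposes. *)
pose K1 := C * (2 * pi) ^+ d; pose K2 := 3 * besov_const cl Cl M C r * B `^ sigma.
pose K3 := noise_const N m cl Cl M kappa C * (2 * C).
pose K4 := 2 * C ^+ 2; pose K5 := B ^+ mm.
have K10 : 0 < K1 by rewrite mulr_gt0.
have K20 : 0 < K2.
  by apply: mulr_gt0; [apply: mulr_gt0 => //; exact: besov_const_gt0|exact: powR_gt0].
have K30 : 0 <= K3.
  apply: mulr_ge0; last by rewrite mulr_ge0// ltW.
  apply: mulr_ge0 => //; apply: mulr_ge0.
    by rewrite !mulr_ge0 ?invr_ge0 ?sqrtr_ge0 ?(ltW C0) ?(ltW (ndBX_gt0 N _)).
  apply: mulr_ge0; first by rewrite invr_ge0 ltW.
  by apply: mulr_ge0; [exact: consts_ge0|exact/ltW/ndBX_gt0].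
have K40 : 0 < K4 by rewrite mulr_gt0// exprn_gt0.
have K50 : 0 < K5 by exact: ndBX_gt0.
pose K := K1 + K2 + K3 + K4 + K5.
have K0 : 0 < K by rewrite /K; lra.
exists K; split => // j0 V H gam G n V0 pH gam0 n2 hK1 hK2 noise X.
have gV0 : 0 < gam * V by rewrite mulr_gt0.
have gam_le : gam * (C * V) <= ((2 * pi) ^+ d)^-1.
  rewrite -[leRHS]mul1r ler_pdivlMr//; apply: le_trans hK1.
  have -> : gam * (C * V) * (2 * pi) ^+ d = K1 * (gam * V) by rewrite /K1; ring.
  by rewrite ler_wpM2r ?(ltW gV0)// /K; lra.
pose f := perturbed pH gam0 gam_le.
pose phi := packet_derivative N m j0 H.
have W0 : 0 < B ^+ (j0 * mm) by exact: ndBX_gt0.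
have noise_le : \sum_(0 <= j < cutoff N m n) \sum_(k < ndK N j)
    `|\int[torus_measure R d]_x (phi x * needlet k x)| * noise_level m kappa n f k <=
    gam * V * (B ^+ (j0 * mm)) ^+ 2 / (2 * C).
  case: noise => [cut|[h1 h2]].
    (* Estimated levels lie below the cutoff, hence at least two below [j0], and do not see the
       packet. *)
    rewrite big_nat big1 => [|j /andP[_ jc]].
      apply: divr_ge0; apply: mulr_ge0; rewrite ?sqr_ge0 ?(ltW gV0) ?(ltW C0)//.
    apply: big1 => k _; rewrite /phi /packet_derivative needlet_inner [tpoly _ _ _ _]big1 => [|l _].
      by rewrite mulr0 normr0 mul0r.
    rewrite [X in X * _]mulrAC (packet_far pH) ?mul0r//.
    by rewrite /near_level negb_and -!ltnNge (leq_trans _ cut) ?orbT.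
  apply: le_trans (packet_noise_sum m_gt0 cl0 Cl0 M0 lamB bM kappa_gt0 C0 pH gam0 gam_le n2 h1 _) _.
  set S := Num.sqrt (B ^+ (j0 * d)) in h2 *.
  set rn := Num.sqrt (ln n%:R / n%:R) in h2 *.
  have n1 : 1 < n%:R :> R by rewrite ltr1n.
  have rn0 : 0 < rn by rewrite sqrtr_gt0 divr_gt0 ?ln_gt0//; lra.
  have nrn : 0 < n%:R * rn by rewrite mulr_gt0//; lra.
  rewrite ler_pdivlMr ?mulr_gt0//.
  have -> : noise_const N m cl Cl M kappa C * (S * (B ^+ (j0 * mm)) ^+ 2 / (n%:R * rn)) * (2 * C) =
     K3 * S / (n%:R * rn) * (B ^+ (j0 * mm)) ^+ 2 by rewrite /K3; ring.
  rewrite ler_wpM2r ?sqr_ge0// ler_pdivrMr//; apply: le_trans h2.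
  by rewrite ler_wpM2r ?sqrtr_ge0// /K; lra.
have K4K : K^-1 <= K4^-1 by rewrite lef_pV2 ?posrE// /K; lra.
have gW0 : 0 < gam * V * B ^+ (j0 * mm) by rewrite mulr_gt0.
have KW : K^-1 * (gam * V * B ^+ (j0 * mm)) <= gam * V * B ^+ (j0 * mm) / K4.
  by rewrite [leRHS]mulrC ler_wpM2r// ltW.
exists f, (fun x => gam * phi x); split.
- split; first exact: perturbed_besov.
  apply: le_trans (perturbed_besov_norm cl0 Cl0 M0 lamB bM V0 C0 pH gam0 gam_le r_gt1 q_ge1 sigma_ge0) _.
  rewrite lee_fin; apply: le_trans hK2.
  have -> : 3 * (gam * (besov_const cl Cl M C r * V `^ (1 - r^-1)) * B `^ (j0.+1%:R * sigma)) =
      K2 * (gam * V `^ (1 - r^-1) * B `^ (j0%:R * sigma)).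
    have -> : B `^ (j0.+1%:R * sigma) = B `^ (j0%:R * sigma) * B `^ sigma.
      rewrite -powRD; last by rewrite (gt_eqF B0) implybT.
      by congr (_ `^ _); rewrite -natr1; ring.
    by rewrite /K2; ring.
  by rewrite ler_wpM2r// ?mulr_ge0 ?powR_ge0 ?(ltW gam0)// /K; lra.
- exact: perturbed_Dmulti.
- move=> p p1.
  apply: le_trans (packet_Lp_risk kappa_gt0 etaP V0 C0 n2 (X f) noise_le p1).
  rewrite lee_fin; apply: ler_pM; rewrite ?powR_ge0 ?invr_ge0 ?mulr_ge0 ?(ltW K0) ?(ltW V0)//.
    apply: ge0_ler_powR => //; rewrite ?nnegrE; first lra.
    - by rewrite mulr_ge0 ?invr_ge0 ?ltW.
    - by rewrite divr_ge0 ?ltW.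
  rewrite lef_pV2 ?posrE ?mulr_gt0// [leLHS]mulrC ler_wpM2r ?(ltW V0)// -/K5 /K; lra.
- apply: le_trans (packet_Loo_risk kappa_gt0 etaP C0 n2 (X f) noise_le).
  by rewrite lee_fin.
Qed.

End packet_lower_bound.

Section packet_tools.
Context (R : realType) (d : nat) (N : needlet_system R d) (m : 'I_d -> nat).
Local Notation B := (ndB N).
Local Notation mu := (torus_measure R d).
Local Notation box j := (int_box d (band_radius N j)).
Local Notation phase := ((multi_norm m)%:R * (pi / 2)).
Implicit Types (l : 'rV[int]_d) (H : 'rV[int]_d -> R).

Lemma packet_norm2_ge j0 H : (forall l, H (- l) = H l) ->
  (2 * pi) ^+ d / 2 * \sum_(l <- box j0) (H l * freq_mono R m l) ^+ 2 <=
  \int[mu]_x (tpoly (box j0) (fun l => H l * freq_mono R m l) (fun=> phase) x) ^+ 2.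
Proof.
move=> eH; apply: le_trans (tpoly_norm2_ge m (uniq_int_box d _) eH) _.
rewrite Dmulti_tpoly; apply: eq_ler.
by congr Rintegral; apply/funext => x; congr (_ ^+ 2); congr (_ x);
  apply: eq_tpoly => l _ //; rewrite add0r.
Qed.

Lemma freq_band_norm j l : B ^+ j < freq_norm R l * B -> freq_norm R l < B ^+ j.+1 ->
  freq_band B j l.
Proof.
have B0 := ndB_gt0 N => h1 h2.
rewrite /freq_band /= exprzDr ?unitfE ?gt_eqF// exprzDr ?unitfE ?gt_eqF//.
rewrite expr1z -exprnP -invr_expz expr1z.
by rewrite ltr_pdivrMr// h1 -exprSr h2.
Qed.

Lemma sum_lam_le : exists2 L : R, 0 < L & forall j, \sum_(k < ndK N j) ndlam N k <= L.
Proof.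
have [cl [Cl [cl0 Cl0 lamB]]] := ndlam_bounds N.
have [ck [Ck [ck0 Ck0 KB]]] := ndK_bounds N.
exists (Ck * Cl) => [|j]; first by rewrite mulr_gt0.
have Bj := ndBX_gt0 N (j * d).
apply: (@le_trans _ _ (\sum_(k < ndK N j) Cl / B ^+ (j * d))).
  by apply: ler_sum => k _; have /andP[] := lamB j k.
rewrite sumr_const card_ord -mulr_natl.
have /andP[_ h] := KB j.
apply: (@le_trans _ _ (Ck * B ^+ (j * d) * (Cl / B ^+ (j * d)))).
  by rewrite ler_wpM2r// divr_ge0// ltW.
by apply: eq_ler; field; rewrite gt_eqF.
Qed.

Lemma sample_sum_le j (T : 'rV[R]_d -> R) (L M : R) : 0 <= M ->
  \sum_(k < ndK N j) ndlam N k <= L -> (forall x, `|T x| <= M) ->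
  \sum_(k < ndK N j) ndlam N k * `|T (ndxi N k)| <= L * M.
Proof.
move=> M0 lL TM; apply: le_trans (ler_wpM2r M0 lL); rewrite mulr_suml.
by apply: ler_sum => k _; rewrite ler_wpM2l ?(ltW (ndlam_gt0 k)).
Qed.

End packet_tools.

(** * The dense packet *)

Section dense_packet.
Context (R : realType) (d : nat) (N : needlet_system R d) (m : 'I_d -> nat).
Hypothesis d_gt0 : (0 < d)%N.
Local Notation B := (ndB N).
Local Notation mu := (torus_measure R d).
Local Notation mm := (multi_norm m).
Local Notation box j := (int_box d (band_radius N j)).
Local Notation phase := ((multi_norm m)%:R * (pi / 2)).
Implicit Types (l : 'rV[int]_d) (H : 'rV[int]_d -> R).

Definition single_freq (l0 l : 'rV[int]_d) : R := ((l == l0) || (l == - l0))%:R.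

Lemma single_freqN l0 l : single_freq l0 (- l) = single_freq l0 l.
Proof. by rewrite /single_freq eqr_opp eqr_oppLR orbC. Qed.

Lemma sum_single_freq_le (s : seq 'rV[int]_d) l0 (F : 'rV[int]_d -> R) (M : R) :
  uniq s -> 0 <= M -> (forall l, (l == l0) || (l == - l0) -> `|F l| <= M) ->
  \sum_(l <- s) `|single_freq l0 l * F l| <= 2 * M.
Proof.
move=> us M0 FM.
have pick a := sum_indicator_le1 R a us.
apply: (@le_trans _ _ (\sum_(l <- s) M * ((l == l0)%:R + (l == - l0)%:R))).
  apply: ler_sum => l _; rewrite /single_freq normrM.
  have [h|] := boolP ((l == l0) || (l == - l0)); last first.
    by rewrite normr0 mul0r mulr_ge0// addr_ge0.
  rewrite normr1 mul1r (le_trans (FM _ h))// ler_peMr//.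
  by case/orP: h => ->; rewrite ?lerDl ?lerDr.
rewrite -mulr_sumr mulrC ler_wpM2r// big_split/=.
by have := pick l0; have := pick (- l0); lra.
Qed.

(** The frequency is taken on the diagonal, where [freq_mono m] has the full order [B^(j0 mm)]
    whatever the multi-index. With height [1] all upper bounds follow from the supremum. *)
Lemma dense_packet : exists C : R, 0 < C /\ exists j1 : nat,
  forall j0, (j1 <= j0)%N -> exists H, wave_packet N m j0 1 C H.
Proof.
have [M M0 bM] := ndb_le N; have [L L0 lamL] := sum_lam_le N.
have B0 := ndB_gt0 N; have B1 := ndB_gt1 N; have P0 := @pi2X_gt0 R d.
have Bm := ndBX_gt0 N mm.
have dR : 0 < d%:R :> R by rewrite ltr0n.
have sd : 0 < Num.sqrt d%:R :> R by rewrite sqrtr_gt0.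
pose C1 := 2 * M * L; pose C2 := 2 * M * L * B ^+ mm.
pose C3 : R := 2 * B ^+ mm * (2 * pi) ^+ d.
pose C4 : R := 2 / (2 * pi) ^+ d * (Num.sqrt d%:R ^+ mm) ^+ 2.
have C10 : 0 < C1 by rewrite !mulr_gt0.
have C20 : 0 < C2 by rewrite !mulr_gt0.
have C30 : 0 < C3 by rewrite !mulr_gt0.
have C40 : 0 < C4.
  by apply: mulr_gt0; [rewrite divr_gt0|rewrite !exprn_gt0].
pose C := 2 + C1 + C2 + C3 + C4.
exists C; split; first by rewrite /C; lra.
have BB : 0 < B - 1 by lra.
have [j1 hj1] := ndBX_large N (Num.sqrt d%:R / (B - 1)); exists j1 => j0 jj0.
have Bj0 : Num.sqrt d%:R < B ^+ j0 * (B - 1) by rewrite -ltr_pdivrMr// hj1.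
(* The least integer with [a * sqrt d > B^j0]. The norm overshoots [B^j0] by at most [sqrt d], which
   stays within the band by [Bj0]. *)
pose a := (Num.truncn (B ^+ j0 / Num.sqrt d%:R)).+1.
have Bjd : 0 < B ^+ j0 / Num.sqrt d%:R by rewrite divr_gt0// ndBX_gt0.
have a_gt : B ^+ j0 / Num.sqrt d%:R < a%:R by exact: truncnS_gt.
have a_le : a%:R <= B ^+ j0 / Num.sqrt d%:R + 1.
  by rewrite -natr1 lerD2r; have /andP[] := truncn_itv (ltW Bjd).
pose l0 : 'rV[int]_d := const_mx a%:Z.
have nl0 : freq_norm R l0 = a%:R * Num.sqrt d%:R.
  rewrite /freq_norm (eq_bigr (fun=> a%:R ^+ 2)) => [|i _]; last by rewrite mxE.
  rewrite sumr_const card_ord -[X in Num.sqrt X]mulr_natr sqrtrM ?sqr_ge0// sqrtr_sqr ger0_norm//.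
have l0band : freq_band B j0 l0.
  apply: freq_band_norm; rewrite nl0.
    rewrite ltr_pdivrMr// in a_gt; apply: lt_trans a_gt _.
    by rewrite ltr_pMr// mulr_gt0// ltr0n.
  apply: le_lt_trans (ler_wpM2r (ltW sd) a_le) _.
  rewrite mulrDl divfK ?gt_eqF// mul1r exprSr.
  by rewrite -ltrBrDl -{2}[B ^+ j0]mulr1 -mulrBr.
have bandE l : (l == l0) || (l == - l0) -> freq_norm R l = freq_norm R l0.
  by case/orP => /eqP ->; rewrite ?freq_normN.
have [_ l0lt] := freq_band_sub l0band.
have mono_le l : (l == l0) || (l == - l0) -> `|freq_mono R m l| <= B ^+ mm * B ^+ (j0 * mm).
  move=> hl; rewrite -exprD -mulSn exprM; apply: freq_mono_le.
  by rewrite bandE// ltW.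
have Wj0 := ndBX_gt0 N (j0 * mm).
have abs_band j l : `|band_mult N j l| <= M by exact: band_mult_le.
exists (single_freq l0); split.
- exact: single_freqN.
- move=> l; rewrite /single_freq; case: (boolP (_ || _)) => [hl _|_]; last by rewrite eqxx.
  have [h1 h2] := freq_band_sub l0band.
  by apply: freq_band_norm; rewrite bandE.
- have := @sum_single_freq_le _ l0 (fun=> 1) 1 (uniq_int_box d (band_radius N j0)) ler01.
  under eq_bigr do rewrite mulr1.
  move=> /(_ _)/le_trans; apply; first by move=> l _; rewrite normr1.
  by rewrite !mulr1 /C; lra.
- move=> j nj; apply: (@le_trans _ _ (L * (2 * M))); last by rewrite /C /C1; lra.
  apply: sample_sum_le => // [|x]; first by rewrite mulr_ge0// ltW.
  apply: le_trans (tpoly_le _ _ _ _) _.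
  by apply: sum_single_freq_le => //; [exact: uniq_int_box|exact: ltW].
- move=> j nj; apply: (@le_trans _ _ (L * (2 * (B ^+ mm * B ^+ (j0 * mm) * M)))).
    apply: sample_sum_le => // [|x]; first by rewrite !mulr_ge0// ltW.
    apply: le_trans (tpoly_le _ _ _ _) _.
    under eq_bigr do rewrite -mulrA.
    apply: sum_single_freq_le; [exact: uniq_int_box|by rewrite !mulr_ge0// ltW|].
    by move=> l hl; rewrite normrM ler_pM// mono_le.
  have -> : L * (2 * (B ^+ mm * B ^+ (j0 * mm) * M)) = C2 * B ^+ (j0 * mm) by rewrite /C2; ring.
  by rewrite ler_wpM2r ?(ltW Wj0)// /C; lra.
- pose phi := tpoly (box j0) (fun l => single_freq l0 l * freq_mono R m l) (fun=> phase) : 'rV[R]_d -> R.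
  have phi_le x : `|phi x| <= 2 * (B ^+ mm * B ^+ (j0 * mm)).
    apply: le_trans (tpoly_le _ _ _ _) _.
    by apply: sum_single_freq_le; [exact: uniq_int_box|rewrite mulr_ge0// ltW|exact: mono_le].
  have bphi : bounded_meas phi by exact: bounded_meas_tpoly.
  rewrite -/phi.
  have := bounded_integral_norm_le mu (bounded_meas_norm bphi) (M := 2 * (B ^+ mm * B ^+ (j0 * mm))).
  rewrite torus_setT => h.
  apply: le_trans (ler_norm _) _; apply: le_trans (h _) _; first by move=> x; rewrite normr_id.
  have -> : 2 * (B ^+ mm * B ^+ (j0 * mm)) * (2 * pi) ^+ d = C3 * B ^+ (j0 * mm) by rewrite /C3; ring.
  by rewrite ler_wpM2r ?(ltW Wj0)// /C; lra.
- rewrite mul1r.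
  have ev := single_freqN l0.
  have C0 : 0 < C by rewrite /C; lra.
  apply: le_trans (ler_wpM2l (ltW C0) (packet_norm2_ge N m j0 ev)).
  have mono_l0 : freq_mono R m l0 = a%:R ^+ mm.
    by rewrite /freq_mono /multi_norm expr_sum; apply: eq_bigr => i _; rewrite mxE.
  have sum_ge : (a%:R ^+ mm) ^+ 2 <=
      \sum_(l <- box j0) (single_freq l0 l * freq_mono R m l) ^+ 2.
    rewrite (bigD1_seq l0) ?uniq_int_box ?freq_band_box//=.
    rewrite /single_freq eqxx mul1r mono_l0 lerDl.
    by apply: sumr_ge0 => l _; exact: sqr_ge0.
  have PC : 0 <= (2 * pi) ^+ d / 2 :> R by rewrite divr_ge0// ltW.
  apply: le_trans (ler_wpM2l (ltW C0) (ler_wpM2l PC sum_ge)).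
  rewrite exprM.
  have h1 : ((B ^+ j0) ^+ mm) ^+ 2 <= (a%:R ^+ mm) ^+ 2 * (Num.sqrt d%:R ^+ mm) ^+ 2.
    rewrite -!exprMn; apply: lerXn2r; rewrite ?nnegrE ?exprn_ge0 ?mulr_ge0 ?(ltW sd) ?(ltW B0)//.
    apply: lerXn2r; rewrite ?nnegrE ?exprn_ge0 ?mulr_ge0 ?(ltW sd) ?(ltW B0)//.
    by rewrite -ler_pdivrMr// ltW.
  apply: le_trans h1 _.
  have -> : (a%:R ^+ mm) ^+ 2 * (Num.sqrt d%:R ^+ mm) ^+ 2 = C4 * ((2 * pi) ^+ d / 2 * (a%:R ^+ mm) ^+ 2).
    by rewrite /C4; field; rewrite gt_eqF.
  by rewrite ler_wpM2r ?mulr_ge0 ?sqr_ge0// /C; lra.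
Qed.

End dense_packet.

(** * Decay of the sparse packet *)

Section smooth_functions.
Context (R : realType).
Implicit Types (g : R -> R) (C : R).

(** Derivatives are carried as witnesses, so closure under products and dilations needs no formula
    for higher derivatives. *)
Fixpoint smooth_upto (n : nat) g : Prop :=
  if n is n'.+1 then
    exists g', (forall x : R, is_derive x (1 : R) g (g' x)) /\ smooth_upto n' g'
  else continuous g.

Lemma is_derive_continuous g g' :
  (forall x : R, is_derive x (1 : R) g (g' x)) -> continuous g.
Proof.
by move=> dg x; apply/differentiable_continuous/derivable1_diffP; case: (dg x).
Qed.

Lemma smooth_upto_continuous n g : smooth_upto n g -> continuous g.
Proof. by case: n => // n [g' [dg _]]; exact: is_derive_continuous dg. Qed.

Lemma smooth_uptoW n g : smooth_upto n.+1 g -> smooth_upto n g.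
Proof.
elim: n g => [|n IH] g; first by move=> /smooth_upto_continuous.
by move=> [g' [dg sg]]; exists g'; split => //; exact: IH.
Qed.

Lemma smooth_uptoD n f g : smooth_upto n f -> smooth_upto n g ->
  smooth_upto n (fun x => f x + g x).
Proof.
elim: n f g => [|n IH] f g; first exact: continuous_add.
move=> [f' [df sf]] [g' [dg sg]]; exists (fun x => f' x + g' x); split; last exact: IH.
by move=> x; exact: is_deriveD.
Qed.

Lemma smooth_uptoM n f g : smooth_upto n f -> smooth_upto n g ->
  smooth_upto n (fun x => f x * g x).
Proof.
elim: n f g => [|n IH] f g.
  by move=> cf cg x; apply: cvgM; [exact: cf|exact: cg].
move=> sf0 sg0; have sf1 := smooth_uptoW sf0; have sg1 := smooth_uptoW sg0.
move: sf0 sg0 => [f' [df sf]] [g' [dg sg]].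
exists (fun x => f x * g' x + g x * f' x); split.
  by move=> x; exact: is_deriveM.
by apply: smooth_uptoD; exact: IH.
Qed.

Lemma smooth_upto_scale n g (c : R) : smooth_upto n g ->
  smooth_upto n (fun x => g (c * x)).
Proof.
elim: n g => [|n IH] g.
  by move=> cg x; apply: continuous_comp; [apply: cvgM; [exact: cvg_cst|exact: cvg_id]|exact: cg].
move=> [g' [dg sg]]; exists (fun x => c * g' (c * x)); split.
  move=> x; rewrite mulrC.
  apply: (@is_derive1_comp _ g (fun x => c * x) x (g' (c * x)) c (dg _)).
  by have := is_derive_affine c 0 x; under eq_fun do rewrite addr0.
apply: smooth_uptoM; last exact: IH.
elim: n {IH g g' dg sg} => [|n IH]; first exact: cst_continuous.
exists (cst 0); split; first by move=> x; exact: is_derive_cst.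
elim: n {IH} => [|n IH]; first exact: cst_continuous.
by exists (cst 0); split => // x; exact: is_derive_cst.
Qed.

Lemma smooth_upto_derive1n n g :
  (forall (k : nat) (x : R), derivable (derive1n k g) x 1) -> smooth_upto n g.
Proof.
move=> dg; suff : forall k, smooth_upto n (derive1n k g) by move=> /(_ 0%N).
elim: n => [|n IH] k.
  by move=> x; apply/differentiable_continuous/derivable1_diffP; exact: dg.
exists (derive1n k.+1 g); split; last exact: IH.
by move=> x; split; [exact: dg|rewrite derive1nS derive1E].
Qed.

Fixpoint bounded_upto (n : nat) C g : Prop :=
  (forall x, `|g x| <= C) /\
  if n is n'.+1 then
    exists g', (forall x : R, is_derive x (1 : R) g (g' x)) /\ bounded_upto n' C g'
  else True.

Lemma bounded_upto_le n C g x : bounded_upto n C g -> `|g x| <= C.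
Proof. by case: n => [[]|n []]. Qed.

Lemma bounded_uptoD n C C' f g : bounded_upto n C f -> bounded_upto n C' g ->
  bounded_upto n (C + C') (fun x => f x + g x).
Proof.
elim: n f g => [|n IH] f g [hf rf] [hg rg]; split => //.
- by move=> x; rewrite (le_trans (ler_normD _ _))// lerD.
- by move=> x; rewrite (le_trans (ler_normD _ _))// lerD.
- move: rf rg => [f' [df sf]] [g' [dg sg]]; exists (fun x => f' x + g' x).
  by split; [move=> x; exact: is_deriveD|exact: IH].
Qed.

Lemma bounded_uptoZ n C g (c : R) : bounded_upto n C g ->
  bounded_upto n (`|c| * C) (fun x => c * g x).
Proof.
elim: n g => [|n IH] g [hg rg]; split => //.
- by move=> x; rewrite normrM ler_wpM2l.
- by move=> x; rewrite normrM ler_wpM2l.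
- move: rg => [g' [dg sg]]; exists (fun x => c * g' x).
  by split; [move=> x; exact: is_deriveZ|exact: IH].
Qed.

Lemma bounded_uptoS n C C' g : C <= C' -> bounded_upto n C g -> bounded_upto n C' g.
Proof.
move=> CC; elim: n g => [|n IH] g [hg rg]; split => //.
- by move=> x; exact: le_trans CC.
- by move=> x; exact: le_trans CC.
- by move: rg => [g' [dg sg]]; exists g'; split => //; exact: IH.
Qed.

Definition difference (h : R) g : R -> R := fun x => g x - g (x + h).

Lemma difference_derive (h : R) g g' :
  (forall x : R, is_derive x (1 : R) g (g' x)) ->
  forall x : R, is_derive x (1 : R) (difference h g) (difference h g' x).
Proof.
move=> dg x; apply: is_deriveB.
rewrite -[g' (x + h)]mulr1.
apply: (@is_derive1_comp _ g (fun x => x + h) x (g' (x + h)) 1 (dg _)).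
by have := is_derive_affine 1 h x; under eq_fun do rewrite mul1r.
Qed.

(** By the mean value theorem a difference trades one derivative for a factor [h]; it commutes with
    the remaining derivatives. *)
Lemma bounded_upto_difference n C g (h : R) : 0 <= h -> bounded_upto n.+1 C g ->
  bounded_upto n (C * h) (difference h g).
Proof.
move=> h0.
have H0 C' g1 g1' : (forall x : R, is_derive x (1 : R) g1 (g1' x)) ->
    (forall x, `|g1' x| <= C') -> forall x, `|difference h g1 x| <= C' * h.
  move=> dg gC x; move: h0; rewrite le_eqVlt => /predU1P[<-|hp].
    by rewrite /difference addr0 subrr normr0 mulr0.
  have xh : x < x + h by rewrite ltrDl.
  have [c _] := MVT xh (fun y _ => dg y) (continuous_subspaceT (is_derive_continuous dg)).
  rewrite addrAC subrr add0r => E.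
  by rewrite /difference distrC E normrM (gtr0_norm hp) ler_wpM2r// ltW.
elim: n g => [|n IH] g [hg [g' [dg bg]]]; split => //.
- by apply: (H0 _ _ _ dg); case: bg.
- by apply: (H0 _ _ _ dg) => x; exact: (@bounded_upto_le n.+1 C g' x bg).
- by exists (difference h g'); split; [exact: difference_derive|exact: IH].
Qed.

Lemma iter_difference_le n C g (h : R) : 0 <= h -> bounded_upto n C g ->
  forall x, `|iter n (difference h) g x| <= C * h ^+ n.
Proof.
move=> h0; elim: n C g => [|n IH] C g; first by move=> [hg _] x; rewrite expr0 mulr1.
move=> bg x; rewrite iterSr exprS mulrA; apply: IH.
exact: bounded_upto_difference.
Qed.

Variables (u v : R).
Hypotheses (u_gt0 : 0 < u) (v_ge0 : 0 <= v).
Implicit Types beta : R -> R.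

Definition supported beta := forall x, x < u \/ v < x -> beta x = 0.

Lemma supported_bounded beta : continuous beta -> supported beta ->
  exists2 M, 0 <= M & forall x, `|beta x| <= M.
Proof.
move=> cb b0; have [vu|uv] := ltP v u.
  exists 0 => // x; rewrite b0 ?normr0//.
  by have [xu|ux] := ltP x u; [left|right; exact: lt_le_trans ux].
have cn : continuous (fun x => `|beta x|).
  by move=> x; apply: continuous_comp; [exact: cb|exact: norm_continuous].
have [c _ cmax] := EVT_max uv (continuous_subspaceT cn).
exists `|beta c| => // x; have [xu|ux] := ltP x u; first by rewrite b0 ?normr0//; by left.
have [vx|xv] := ltP v x; first by rewrite b0 ?normr0//; by right.
by apply: cmax; rewrite in_itv/= ux xv.
Qed.

Lemma supported_derive beta beta' :
  (forall x : R, is_derive x (1 : R) beta (beta' x)) -> supported beta -> supported beta'.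
Proof.
move=> db b0 x hx; have := db x => -[_ <-].
have -> : 'D_1 beta x = 'D_1 (cst (0 : R)) x; last by rewrite derive_cst.
apply: near_eq_derive.
case: hx => hx.
- near=> y; rewrite b0//; left; near: y; exact: lt_nbhsl.
- near=> y; rewrite b0//; right; near: y; exact: lt_nbhsr.
Unshelve. all: by end_near. Qed.

(* [x_1^k * beta |x| / |x|^i] along the line [t -> x = (t, x_2, ..., x_d)], where [a] is
   the sum of the other squares: this family is closed under [d/dt]. *)
Definition radial k i beta (a t : R) : R :=
  t ^+ k * (beta (Num.sqrt (t ^+ 2 + a)) / Num.sqrt (t ^+ 2 + a) ^+ i).

(** Where the function is nonzero, [|x|] lies in [[u, v]] and dominates [|t|]. The bound is
    therefore uniform in [a], that is, in the position of the line. *)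
Lemma radial_le k i beta : continuous beta -> supported beta ->
  exists2 C, 0 <= C & forall a, 0 <= a -> forall t, `|radial k i beta a t| <= C.
Proof.
move=> cb b0; have [M M0 bM] := supported_bounded cb b0.
have C0 : 0 <= v ^+ k * (M / u ^+ i).
  by rewrite mulr_ge0 ?exprn_ge0// divr_ge0// exprn_ge0// ltW.
exists (v ^+ k * (M / u ^+ i)) => // a a0 t; rewrite /radial; set rho := Num.sqrt _.
have t_rho : `|t| <= rho.
  by rewrite -sqrtr_sqr ler_wsqrtr// lerDl.
have [ru|ur] := ltP rho u.
  rewrite b0 ?mul0r ?mulr0 ?normr0//; by left.
have [vr|rv] := ltP v rho.
  rewrite b0 ?mul0r ?mulr0 ?normr0//; by right.
have r0 : 0 < rho by exact: lt_le_trans ur.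
rewrite !normrM !normrX normfV normrX (gtr0_norm r0); apply: ler_pM.
- exact: exprn_ge0.
- by rewrite divr_ge0// exprn_ge0// ltW.
- by rewrite lerXn2r ?nnegrE// (le_trans t_rho).
- apply: ler_pM => //; first by rewrite invr_ge0 exprn_ge0// ltW.
  by rewrite lef_pV2 ?posrE ?exprn_gt0// lerXn2r ?nnegrE// ltW.
Qed.

(** The norm is not smooth at the origin, but [u > 0] makes the function vanish near every point
    with [rho < u]; elsewhere this is the chain rule. *)
Lemma radial_derive k i beta beta' (a : R) : 0 <= a ->
  (forall x : R, is_derive x (1 : R) beta (beta' x)) -> supported beta ->
  forall t : R, is_derive t (1 : R) (radial k i beta a)
    (k%:R * radial k.-1 i beta a t + (radial k.+1 i.+1 beta' a t +
      - i%:R * radial k.+1 i.+2 beta a t)).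
Proof.
move=> a0 db b0 t; have b'0 := supported_derive db b0.
set rho := Num.sqrt (t ^+ 2 + a).
have rho0 : 0 <= rho by exact: sqrtr_ge0.
have [ru|ur] := ltP rho u.
  have z j l g : supported g -> radial j l g a t = 0.
    by move=> g0; rewrite /radial g0 ?mul0r ?mulr0//; left.
  rewrite !z// !mulr0 !addr0.
  have near0 : \forall y \near t, radial k i beta a y = cst 0 y.
    have c : {for t, continuous (fun y : R => Num.sqrt (y ^+ 2 + a))}.
      apply: (@continuous_comp _ _ _ (fun y : R => y ^+ 2 + a)).
        by apply: cvgD; [exact: exprn_continuous|exact: cvg_cst].
      exact: sqrt_continuous.
    have nr : \forall y \near t, Num.sqrt (y ^+ 2 + a) < u := c _ (lt_nbhsl ru).
    by apply: filterS nr => y yu; rewrite /radial b0 ?mul0r ?mulr0//; left.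
  apply: (@near_eq_is_derive _ _ _ (cst 0)).
  by apply: filterS near0 => y ->.
have r0 : 0 < rho by exact: lt_le_trans ur.
have s0 : 0 < t ^+ 2 + a by rewrite -sqrtr_gt0.
have dX j (y : R) : is_derive y (1 : R) (fun z : R => z ^+ j) (j%:R * y ^+ j.-1).
  have := is_derive_poly 'X^j y; rewrite derivXn hornerMn hornerXn -mulr_natl.
  by rewrite (_ : horner 'X^j = fun z : R => z ^+ j)//; apply/funext => z; rewrite hornerXn.
have drho : is_derive t (1 : R) (fun y : R => Num.sqrt (y ^+ 2 + a)) (t / rho).
  have -> : t / rho = (2 * rho)^-1 * (2 * t ^+ 1 + 0).
    by rewrite expr1; field; rewrite gt_eqF.
  have d2 : is_derive t (1 : R) (fun y : R => y ^+ 2 + a) (2%:R * t ^+ 1 + 0).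
    exact: (@is_deriveD _ _ _ (fun y : R => y ^+ 2) (cst a) t 1 _ _ (dX 2%N t)
      (is_derive_cst a t 1)).
  exact: (@is_derive1_comp _ Num.sqrt (fun y : R => y ^+ 2 + a) _ _ _
    (is_derive1_sqrt s0) d2).
have dbrho : is_derive t (1 : R) (fun y : R => beta (Num.sqrt (y ^+ 2 + a))) (beta' rho * (t / rho)).
  exact: (@is_derive1_comp _ beta _ _ _ _ (db _) drho).
have dri : is_derive t (1 : R) (fun y : R => Num.sqrt (y ^+ 2 + a) ^+ i)
    (i%:R * rho ^+ i.-1 * (t / rho)).
  exact: (@is_derive1_comp _ (fun z : R => z ^+ i) _ _ _ _ (dX i _) drho).
have rn0 : (fun y : R => Num.sqrt (y ^+ 2 + a) ^+ i) t != 0.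
  by rewrite /= expf_neq0// gt_eqF.
have dV := @is_deriveV _ (fun y : R => Num.sqrt (y ^+ 2 + a) ^+ i) t _ 1 rn0 dri.
have dQ := is_deriveM dbrho dV.
have dF := is_deriveM (dX k t) dQ.
have dF' : is_derive t (1 : R) (radial k i beta a) _ := dF.
apply: (is_derive_eq dF').
rewrite /radial /GRing.scale mulrfctE /= -/rho.
clearbody rho.
move: (beta rho) (beta' rho) (t ^+ k.-1) => b1 b2 T.
case: i {dri rn0 dV dQ dF dF'} => [|i] /=.
  by rewrite !exprS !expr0; field; rewrite gt_eqF.
rewrite !exprS; move: (rho ^+ i) (exprn_gt0 i r0) => Q Q0.
by field; rewrite !gt_eqF.
Qed.

Lemma radial_bounded_upto n k i beta : smooth_upto n beta -> supported beta ->
  exists2 C, 0 <= C & forall a, 0 <= a -> bounded_upto n C (radial k i beta a).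
Proof.
elim: n k i beta => [|n IH] k i beta sb b0.
  have [C C0 bC] := radial_le k i sb b0.
  by exists C => // a a0; split=> //; exact: bC.
have [C C0 bC] := radial_le k i (smooth_upto_continuous sb) b0.
have [beta' [db sb']] := sb.
have [C1 C10 b1] := IH k.-1 i beta (smooth_uptoW sb) b0.
have [C2 C20 b2] := IH k.+1 i.+1 beta' sb' (supported_derive db b0).
have [C3 C30 b3] := IH k.+1 i.+2 beta (smooth_uptoW sb) b0.
pose D := `|k%:R| * C1 + (C2 + `|- i%:R| * C3).
have D0 : 0 <= D by rewrite !addr_ge0// mulr_ge0.
exists (C + D) => [|a a0]; first by rewrite addr_ge0.
split; first by move=> t; rewrite (le_trans (bC a a0 t))// lerDl.
eexists; split; first exact: radial_derive a0 db b0.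
apply: (@bounded_uptoS _ D); first by rewrite lerDr.
apply: bounded_uptoD; first by apply: bounded_uptoZ; exact: b1.
apply: bounded_uptoD; first exact: b2.
by apply: bounded_uptoZ; exact: b3.
Qed.

End smooth_functions.

(** * Summation by parts on the lattice *)

Section lattice_difference.
Context (R : realType) (d : nat).
Implicit Types (l : 'rV[int]_d) (A : 'rV[int]_d -> R) (x : 'rV[R]_d) (i : 'I_d).

Definition coord_vec i : 'rV[int]_d := delta_mx 0 i.

Definition lattice_difference i A : 'rV[int]_d -> R :=
  fun l => A l - A (l + coord_vec i).

Lemma iter_lattice_difference M i A l (g : R -> R) (t h : R) :
  (forall z : nat, A (l + coord_vec i *+ z) = g (t + z%:R * h)) ->
  iter M (lattice_difference i) A l = iter M (difference h) g t.
Proof.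
elim: M A g => [|M IH] A g Ag.
  by have := Ag 0%N; rewrite mulr0n addr0 mul0r addr0.
rewrite !iterSr; apply: IH => z.
rewrite /lattice_difference /difference Ag -addrA -mulrSr Ag.
by rewrite -[z.+1%:R]natr1 mulrDl mul1r addrA.
Qed.

Definition box_supported (n : nat) A := forall l, A l != 0 -> forall i, `|l 0 i| <= n%:Z.

Lemma box_supported_difference n i A :
  box_supported n A -> box_supported n.+1 (lattice_difference i A).
Proof.
move=> sA l; rewrite /lattice_difference => Al j.
have [A0|An] := eqVneq (A l) 0; last by have := sA _ An j; lia.
have /sA/(_ j) : A (l + coord_vec i) != 0.
  by apply: contra_neq Al => ->; rewrite A0 subr0.
by rewrite !mxE eqxx /=; case: (j == i) => /=; lia.
Qed.

Lemma sum_shift (s : seq 'rV[int]_d) (e : 'rV[int]_d) (F : 'rV[int]_d -> R) :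
  uniq s -> (forall l, F l != 0 -> (l \in s) && (l - e \in s)) ->
  \sum_(l <- s) F (l + e) = \sum_(l <- s) F l.
Proof.
move=> us sF; pose s' := [seq l + e | l <- s].
have us' : uniq s' by rewrite map_inj_uniq// => a b /addIr.
have F0 (t t' : seq 'rV[int]_d) : (forall l, F l != 0 -> l \in t') ->
    \sum_(l <- t) F l = \sum_(l <- [seq l <- t | l \in t']) F l.
  move=> tF; rewrite big_filter [LHS](bigID (mem t'))/= [X in _ + X]big1 ?addr0// => l.
  by apply: contraNeq => /tF.
transitivity (\sum_(l <- s') F l); first by rewrite big_map.
rewrite (F0 s' s); last by move=> l /sF/andP[].
rewrite (F0 s s'); last first.
  by move=> l /sF/andP[_ h]; apply/mapP; exists (l - e); rewrite ?subrK.
apply: perm_big; apply: uniq_perm; rewrite ?filter_uniq// => l.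
by rewrite !mem_filter andbC.
Qed.

Lemma freq_dot_coord i x : freq_dot (coord_vec i) x = x 0 i.
Proof.
rewrite /freq_dot (bigD1 i)//= mxE !eqxx mul1r big1 ?addr0// => j ji.
by rewrite mxE (negbTE ji) andbF mul0r.
Qed.

(** The product of [2 sin (x_i / 2)] with a cosine is a difference of two cosines whose arguments
    differ by [x_i]; a shift of the frequency moves the difference onto [A]. The phase stays common
    to all frequencies, so the step can be iterated. *)
Lemma tpoly_difference n n' i A (c : R) x : box_supported n A -> (n < n')%N ->
  2 * sin (x 0 i / 2) * tpoly (int_box d n') A (fun=> c) x =
  tpoly (int_box d n') (lattice_difference i A)
    (fun=> c + x 0 i / 2 - pi / 2) x.
Proof.
move=> sA nn'; set c' := c + _ - _.
pose F l := A l * cos (freq_dot l x - x 0 i + c').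
transitivity (\sum_(l <- int_box d n') (A l * cos (freq_dot l x + c') - F l)).
  rewrite /tpoly mulr_sumr; apply: eq_bigr => l _; rewrite /F -mulrBr mulrCA; congr (_ * _).
  rewrite /c'; move: (freq_dot l x) (x 0 i) => u t.
  have -> : u + c = (u + c + t / 2 - pi / 2) - t / 2 + pi / 2 :> R by ring.
  have -> : u + (c + t / 2 - pi / 2) = (u + c - pi / 2) + t / 2 by ring.
  have -> : u + c + t / 2 - pi / 2 - t / 2 + pi / 2 = (u + c - pi / 2) + pi / 2 by ring.
  have -> : u - t + (c + t / 2 - pi / 2) = (u + c - pi / 2) - t / 2 by field.
  rewrite cosDpihalf (cosD (u + c - pi / 2)) (cosB (u + c - pi / 2)).
  by ring.
rewrite sumrB -(@sum_shift _ (coord_vec i) F) ?uniq_int_box//; last first.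
  move=> l Fl; have /sA lA : A l != 0 by apply: contra_neq Fl; rewrite /F => ->; rewrite mul0r.
  apply/andP; split; apply: mem_int_box => j; first by have := lA j; lia.
  by rewrite !mxE eqxx /=; case: (j == i); have := lA j; lia.
rewrite -sumrB; apply: eq_bigr => l _.
by rewrite /F freq_dotDl freq_dot_coord addrK mulrBl.
Qed.

Lemma tpoly_iter_difference M n n' i A (c : R) x :
  box_supported n A -> (n + M <= n')%N -> exists c' : R,
  (2 * sin (x 0 i / 2)) ^+ M * tpoly (int_box d n') A (fun=> c) x =
  tpoly (int_box d n') (iter M (lattice_difference i) A) (fun=> c') x.
Proof.
elim: M n A c => [|M IH] n A c sA nM; first by exists c; rewrite expr0 mul1r.
have [|c' E] := IH n.+1 _ (c + x 0 i / 2 - pi / 2) (box_supported_difference (i := i) sA).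
  by rewrite addSnnS.
exists c'; rewrite exprSr -mulrA (tpoly_difference _ _ _ sA); last by lia.
by rewrite E -iterSr.
Qed.

Lemma tpoly_decay M n n' i A (c K : R) x : box_supported n A -> (n + M <= n')%N ->
  (forall l, `|iter M (lattice_difference i) A l| <= K) ->
  `|sin (x 0 i / 2)| ^+ M * `|tpoly (int_box d n') A (fun=> c) x| <=
  K * (n'.*2.+1)%:R ^+ d.
Proof.
move=> sA nM AK; have [c' E] := tpoly_iter_difference i c x sA nM.
apply: le_trans (sum_int_box_le n' AK); apply: le_trans (tpoly_le _ _ (fun=> c') x).
rewrite -E normrM normrX; apply: ler_wpM2r => //; apply: lerXn2r; rewrite ?nnegrE//.
by rewrite normrM ger0_norm// ler_peMl// ler1n.
Qed.

Lemma tpoly_support s s' A (c : 'rV[int]_d -> R) x : uniq s -> uniq s' ->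
  (forall l, A l != 0 -> (l \in s) && (l \in s')) -> tpoly s A c x = tpoly s' A c x.
Proof.
move=> us us' As.
have F0 t : tpoly t A c x = tpoly [seq l <- t | A l != 0] A c x.
  rewrite /tpoly big_filter [LHS](bigID (fun l => A l != 0))/= [X in _ + X]big1 ?addr0// => l.
  by move=> /negPn/eqP ->; rewrite mul0r.
rewrite F0 [RHS]F0; apply: perm_big; apply: uniq_perm; rewrite ?filter_uniq// => l.
by rewrite !mem_filter; case: eqP => //= /eqP/As/andP[-> ->].
Qed.

End lattice_difference.

(** * Decay of radial kernels *)

Section kernel_decay.
Context (R : realType) (d : nat) (m : 'I_d -> nat).
Variables (u v : R) (beta : R -> R).
Hypotheses (u_gt0 : 0 < u) (v_ge0 : 0 <= v) (sb : supported u v beta).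
Local Notation mm := (multi_norm m).
Implicit Types (l : 'rV[int]_d) (x : 'rV[R]_d) (i : 'I_d) (Q : R).

Definition radial_mult Q l : R := freq_mono R m l * beta (freq_norm R l / Q).

Lemma radial_mult_norm Q l : 0 < Q -> radial_mult Q l != 0 -> freq_norm R l <= v * Q.
Proof.
move=> Q0; apply: contraNle => lv; rewrite /radial_mult sb ?mulr0//; right.
by rewrite ltr_pdivlMr.
Qed.

(** In the variable rescaled by [Q] a lattice step has length [Q^-1], so each difference of the
    multiplier will gain a factor [Q^-1]. The other coordinates are frozen in the product and in the
    parameter [a] of [radial]. *)
Lemma radial_mult_line Q l i (z : nat) : 0 < Q ->
  radial_mult Q (l + coord_vec i *+ z) =
  Q ^+ mm * \prod_(j < d | j != i) ((l 0 j)%:~R / Q) ^+ m j *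
  radial (m i) 0 beta (\sum_(j < d | j != i) ((l 0 j)%:~R / Q) ^+ 2)
    ((l 0 i)%:~R / Q + z%:R * Q^-1).
Proof.
move=> Q0; set l' := l + _; set t := _ / Q + _.
have li : (l' 0 i)%:~R = t * Q :> R.
  rewrite /l' /t -mulrDl divfK ?gt_eqF// !mxE mulmxnE mxE !eqxx /= intrD.
  by rewrite rmorphMn.
have lj j : j != i -> (l' 0 j)%:~R = (l 0 j)%:~R / Q * Q :> R.
  by move=> ji; rewrite divfK ?gt_eqF// !mxE mulmxnE mxE (negbTE ji) andbF mul0rn addr0.
rewrite /radial_mult /radial expr0 divr1 [RHS]mulrA; congr (_ * beta _).
  have -> : Q ^+ mm = Q ^+ m i * \prod_(j < d | j != i) Q ^+ m j.
    by rewrite /multi_norm expr_sum (bigD1 i).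
  rewrite /freq_mono (bigD1 i)//= li exprMn.
  rewrite -[RHS]mulrA [_ * t ^+ m i]mulrC mulrACA -big_split/=.
  rewrite [Q ^+ m i * _]mulrC; congr (_ * _).
  by apply: eq_bigr => j ji; rewrite lj// exprMn mulrC.
rewrite -[Q in LHS]gtr0_norm// -sqrtr_sqr /freq_norm -sqrtrV ?sqr_ge0//.
rewrite -sqrtrM ?sum_sqr_ge0//; congr Num.sqrt.
rewrite mulr_suml (bigD1 i)//= li exprMn mulfK ?expf_neq0 ?gt_eqF//; congr (_ + _).
apply: eq_bigr => j ji; rewrite lj// exprMn mulfK ?expf_neq0 ?gt_eqF//.
Qed.

Lemma iter_difference_radial_mult_le M i : smooth_upto M beta ->
  exists2 C, 0 <= C & forall Q, 0 < Q -> forall l,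
    `|iter M (lattice_difference i) (radial_mult Q) l| <= C * Q ^+ mm / Q ^+ M.
Proof.
move=> smb; have [C C0 bC] := radial_bounded_upto u_gt0 v_ge0 (m i) 0 smb sb.
pose P := Num.max 1 v ^+ (\sum_(j < d | j != i) m j).
have P0 : 0 <= P by rewrite exprn_ge0// le_max ler01.
exists (P * C) => [|Q Q0 l]; first exact: mulr_ge0.
have QV : 0 <= Q^-1 by rewrite invr_ge0 ltW.
have Qm : 0 <= Q ^+ mm by rewrite exprn_ge0// ltW.
set a := \sum_(j < d | j != i) ((l 0 j)%:~R / Q) ^+ 2.
have a0 : 0 <= a by apply: sumr_ge0 => j _; exact: sqr_ge0.
set w := \prod_(j < d | j != i) ((l 0 j)%:~R / Q) ^+ m j.
pose g t := Q ^+ mm * w * radial (m i) 0 beta a t.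
rewrite (@iter_lattice_difference _ _ _ _ _ _ g ((l 0 i)%:~R / Q) Q^-1); last first.
  by move=> z; exact: radial_mult_line.
have -> : P * C * Q ^+ mm / Q ^+ M = `|Q ^+ mm * P| * C * Q^-1 ^+ M.
  by rewrite ger0_norm ?mulr_ge0// exprVn; congr (_ / _); rewrite mulrAC [P * _]mulrC.
(* where another coordinate leaves the support, [radial] vanishes on the line *)
have [wP|Pw] := leP `|w| P.
  apply: iter_difference_le => //; apply: (@bounded_uptoS _ _ (`|Q ^+ mm * w| * C)).
    by rewrite ler_wpM2r// !normrM (ger0_norm P0) ler_wpM2l.
  by apply: bounded_uptoZ; exact: bC.
have g0 : g = fun t => 0 * radial (m i) 0 beta a t.
  apply/funext => t; rewrite mul0r; have [j ji vj] : exists2 j, j != i & v < `|(l 0 j)%:~R / Q|.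
    apply: contrapT => H; move: Pw; rewrite ltNge => /negP; apply.
    rewrite /w /P normr_prod expr_sum; apply: ler_prod => j ji.
    rewrite normr_ge0 normrX; apply: lerXn2r; rewrite ?nnegrE ?le_max ?ler01//.
    by apply/orP; right; rewrite leNgt; apply/negP => vj; apply: H; exists j.
  rewrite /g /radial sb ?mul0r ?mulr0//; right; apply: lt_le_trans vj _.
  rewrite -sqrtr_sqr ler_wsqrtr// /a (bigD1 j)//= addrCA lerDl addr_ge0 ?sqr_ge0//.
  by apply: sumr_ge0 => k _; exact: sqr_ge0.
rewrite g0; apply: iter_difference_le => //.
apply: (@bounded_uptoS _ _ (`|0 : R| * C)).
  by rewrite normr0 mul0r mulr_ge0.
by apply: bounded_uptoZ; exact: bC.
Qed.

(** Used with [M = 0] for the height of the kernel and with [M = 2 d] for its localization. The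
    phase is free, so that derivatives are covered. *)
Definition decays M i (K : R) := forall Q, 1 <= Q -> forall s, uniq s ->
  (forall l, radial_mult Q l != 0 -> l \in s) -> forall c x,
  `|Q * sin (x 0 i / 2)| ^+ M * `|tpoly s (radial_mult Q) (fun=> c) x| <=
  K * (Q ^+ mm * Q ^+ d).

Lemma radial_mult_decay M i : smooth_upto M beta -> exists K, 0 < K /\ decays M i K.
Proof.
move=> smb; have [C C0 bC] := iter_difference_radial_mult_le i smb.
(* After multiplication by [Q] this bounds the side of a cube that contains the support of the
   multiplier, enlarged by one layer for each of the [M] differences. *)
have v0 : 0 <= 2 * v + 2 * M%:R + 5 by rewrite !addr_ge0 ?mulr_ge0 ?ler0n.
pose K := C * (2 * v + 2 * M%:R + 5) ^+ d.
have K0 : 0 <= K by rewrite mulr_ge0// exprn_ge0.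
exists (K + 1); split=> [|Q Q1 s us ss c x]; first by lra.
have Q0 : 0 < Q by lra.
have QM : 0 < Q ^+ M by rewrite exprn_gt0.
have Qm : 0 < Q ^+ mm by rewrite exprn_gt0.
have Qd : 0 < Q ^+ d by rewrite exprn_gt0.
pose n := (Num.truncn (v * Q)).+1.
have vQ : 0 <= v * Q by rewrite mulr_ge0// ltW.
have sA : box_supported n (radial_mult Q).
  move=> l /(radial_mult_norm Q0) h j.
  have := le_trans (coord_le_freq_norm R l j) h.
  move=> /le_trans/(_ (ltW (truncnS_gt _))).
  by rewrite -intr_norm pmulrn ler_int.
pose n' := (n + M)%N.
have n'Q : n'.*2.+1%:R <= (2 * v + 2 * M%:R + 5) * Q.
  have /andP[h _] := truncn_itv vQ.
  have -> : n'.*2.+1%:R = 2 * ((Num.truncn (v * Q))%:R + 1 + M%:R) + 1 :> R.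
    by rewrite -natr1 -muln2 natrM /n' natrD /n -[in LHS]natr1 mulrC.
  have : M%:R <= M%:R * Q by rewrite ler_peMr// ler0n.
  by lra.
rewrite (@tpoly_support _ _ s (int_box d n')) ?uniq_int_box//; last first.
  move=> l Al; rewrite ss//=; apply: mem_int_box => j.
  by apply: le_trans (sA _ Al j) _; rewrite lez_nat leq_addr.
have H := tpoly_decay c x sA (leqnn n') (bC Q Q0).
rewrite normrM exprMn (gtr0_norm Q0) -mulrA -ler_pdivlMl//.
apply: le_trans H _.
have : C * Q ^+ mm / Q ^+ M * n'.*2.+1%:R ^+ d <= C * Q ^+ mm / Q ^+ M * ((2 * v + 2 * M%:R + 5) * Q) ^+ d.
  apply: ler_wpM2l; first by rewrite divr_ge0 ?mulr_ge0// ltW.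
  by apply: lerXn2r; rewrite ?nnegrE ?ler0n// mulr_ge0// ltW.
move=> /le_trans; apply; rewrite exprMn [leRHS]mulrC.
have -> : C * Q ^+ mm / Q ^+ M * ((2 * v + 2 * M%:R + 5) ^+ d * Q ^+ d) =
   K * (Q ^+ mm * Q ^+ d) / Q ^+ M by rewrite /K; ring.
rewrite ler_wpM2r ?invr_ge0 ?(ltW QM)// ler_wpM2r ?mulr_ge0 ?ltW//.
by rewrite ltrDl.
Qed.

(** The coordinate [y_i] of largest modulus dominates: the product is at most
    [(1 + y_i^2)^d <= 2^d (1 + |y_i|^(2 d))]. Decay of order [2 d] in each coordinate separately
    thus yields the product weight. *)
Lemma prod_oneD_le (y : 'I_d -> R) (T K : R) : (0 < d)%N -> 0 <= T -> T <= K ->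
  (forall i, `|y i| ^+ (2 * d) * T <= K) -> \prod_(i < d) (1 + y i ^+ 2) * T <= 2 ^+ d.+1 * K.
Proof.
move=> d0 T0 TK yK.
have K0 : 0 <= K by exact: le_trans TK.
have [i _ imax] : exists2 i : 'I_d, true & forall j, `|y j| <= `|y i|.
  by case: (@Order.TotalTheory.arg_maxP _ _ _ (Ordinal d0) xpredT (fun i => `|y i|)) => // i _ h;
    exists i => // j; exact: h.
apply: (@le_trans _ _ (2 ^+ d * (1 + `|y i| ^+ (2 * d)) * T)).
  apply: ler_wpM2r => //; apply: (@le_trans _ _ ((1 + `|y i| ^+ 2) ^+ d)).
    rewrite -[X in _ ^+ X](card_ord d) -prodr_const; apply: ler_prod => j _.
    rewrite addr_ge0 ?sqr_ge0//= lerD2l -real_normK ?num_real//.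
    by apply: lerXn2r; rewrite ?nnegrE.
  have [y1|y1] := leP `|y i| 1.
    apply: (@le_trans _ _ (2 ^+ d)).
      apply: lerXn2r; rewrite ?nnegrE ?addr_ge0 ?sqr_ge0//.
      have : `|y i| ^+ 2 <= 1 by rewrite exprn_ile1.
      by lra.
    by rewrite ler_peMr ?exprn_ge0// lerDl exprn_ge0.
  rewrite mulrDr mulr1 exprM -exprMn; apply: ler_wpDl; first exact: exprn_ge0.
  apply: lerXn2r; rewrite ?nnegrE ?addr_ge0 ?mulr_ge0 ?sqr_ge0//.
  have : 1 <= `|y i| ^+ 2 by rewrite exprn_ege1// ltW.
  by lra.
rewrite -mulrA mulrDl mul1r exprSr -mulrA ler_wpM2l ?exprn_ge0//.
by have := yK i; lra.
Qed.

Lemma radial_mult_weight : (0 < d)%N -> smooth_upto (2 * d) beta ->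
  exists2 K, 0 < K & forall Q, 1 <= Q -> forall s, uniq s ->
    (forall l, radial_mult Q l != 0 -> l \in s) -> forall c x,
    `|tpoly s (radial_mult Q) (fun=> c) x| <=
    K * (Q ^+ mm * Q ^+ d) * \prod_(i < d) circle_weight Q (x 0 i).
Proof.
move=> d0 smb.
have smb0 : smooth_upto 0 beta by exact: smooth_upto_continuous smb.
have [K1 [K10 h1]] := radial_mult_decay (Ordinal d0) smb0.
have /choice[KK HK] := fun i => radial_mult_decay i smb.
have KK0 i : 0 < KK i by have [] := HK i.
have h2 i : decays (2 * d) i (KK i) by have [] := HK i.
pose K := K1 + \sum_(i < d) KK i.
have KK_ge0 : 0 <= \sum_(i < d) KK i by apply: sumr_ge0 => i _; exact: ltW.
have KKi i : KK i <= K.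
  rewrite /K (bigD1 i)//= addrCA lerDl addr_ge0 ?(ltW K10)//.
  by apply: sumr_ge0 => j _; exact: ltW.
exists (2 ^+ d.+1 * K) => [|Q Q1 s us ss c x].
  by rewrite mulr_gt0 ?exprn_gt0// /K; lra.
have Qp : 0 <= Q ^+ mm * Q ^+ d by rewrite mulr_ge0// exprn_ge0//; lra.
have W0 : 0 < \prod_(i < d) (1 + (Q * sin (x 0 i / 2)) ^+ 2).
  by apply: prodr_gt0 => i _; have := sqr_ge0 (Q * sin (x 0 i / 2)); lra.
rewrite /circle_weight prodfV ler_pdivlMr// mulrC -mulrA.
apply: prod_oneD_le => //.
- have := h1 Q Q1 s us ss c x; rewrite expr0 mul1r => /le_trans; apply.
  by rewrite ler_wpM2r// /K; lra.
- move=> i; apply: le_trans (h2 i Q Q1 s us ss c x) _.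
  by rewrite ler_wpM2r.
Qed.

End kernel_decay.


(** * Localized weights on the torus *)

Section torus_weight.
Context (R : realType).

Lemma norm_sin_le (u : R) : `|sin u| <= `|u|.
Proof.
wlog u0 : u / 0 < u.
  move=> H; have [u0|u0|<-] := ltgtP 0 u; last by rewrite sin0 normr0.
    exact: H.
  by rewrite -(opprK u) sinN normrN [leRHS]normrN; apply: H; rewrite oppr_gt0.
have [c _] := MVT u0 (fun y _ => is_derive_sin y) (continuous_subspaceT (@continuous_sin R)).
rewrite sin0 !subr0 => ->; rewrite normrM ler_piMl//.
exact: cos_max.
Qed.

Lemma norm_sin_half_le (t : R) : `|t| <= 2 * pi ->
  `|sin (t / 2)| <= Num.min `|t| (2 * pi - `|t|).
Proof.
move=> t2; have -> : `|sin (t / 2)| = `|sin (`|t| / 2)|.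
  by case: (ger0P t) => // _; rewrite mulNr sinN normrN.
have := normr_ge0 t; move: `|t| t2 => a a2 a0; rewrite le_min; apply/andP; split.
  by apply: le_trans (norm_sin_le _) _; rewrite ger0_norm; lra.
have -> : sin (a / 2) = sin (pi - a / 2) by rewrite sinB sinpi cospi; ring.
by apply: le_trans (norm_sin_le _) _; rewrite ger0_norm; lra.
Qed.

Lemma norm_sin_halfD_le (x y : R) :
  `|sin (x / 2)| <= `|sin (y / 2)| + `|sin ((x - y) / 2)|.
Proof.
have -> : x / 2 = y / 2 + (x - y) / 2 by field.
rewrite sinD; apply: le_trans (ler_normD _ _) _; rewrite !normrM; apply: lerD.
  by rewrite ler_piMr// cos_max.
by rewrite ler_piMl// cos_max.
Qed.

Variable d : nat.
Implicit Types (x y : 'rV[R]_d) (Q : R).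

Definition torus_weight Q x : R := \prod_(i < d) circle_weight Q (x 0 i).

Lemma torus_weight_gt0 Q x : 0 < torus_weight Q x.
Proof. by apply: prodr_gt0 => i _; exact: circle_weight_gt0. Qed.

Lemma bounded_meas_torus_weight Q : bounded_meas (torus_weight Q).
Proof. exact: bounded_meas_torus_prod (bounded_meas_circle_weight Q). Qed.

Lemma torus_weight_integral : exists2 C : R, 0 < C &
  forall Q, 0 < Q -> \int[torus_measure R d]_x torus_weight Q x <= C / Q ^+ d.
Proof.
have [C C0 hC] := circle_weight_integral R.
exists (C ^+ d) => [|Q Q0]; first exact: exprn_gt0.
rewrite torus_integral_prod; last exact: bounded_meas_circle_weight.
rewrite -expr_div_n; apply: lerXn2r; last exact: hC.
- rewrite nnegrE; apply: Rintegral_ge0 => t _.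
  exact: ltW (circle_weight_gt0 _ _).
- by rewrite nnegrE divr_ge0// ltW.
Qed.

Lemma torus_dist_coord x y i :
  torus x -> torus y ->
  Num.min `|x 0 i - y 0 i| (2 * pi - `|x 0 i - y 0 i|) <= torus_dist x y.
Proof.
move=> tx ty; set F := fun i => Num.min `|x 0 i - y 0 i| (2 * pi - `|x 0 i - y 0 i|).
have F0 : 0 <= F i.
  rewrite le_min normr_ge0 subr_ge0 /= ler_norml.
  by have /andP[x0 x2] := tx i; have /andP[y0 y2] := ty i; apply/andP; split; lra.
rewrite -[leLHS]ger0_norm// -sqrtr_sqr ler_wsqrtr// (bigD1 i)//= lerDl.
by apply: sumr_ge0 => j _; exact: sqr_ge0.
Qed.

(** At distance of order [1 / Q] the weight changes by a bounded factor, since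
    [1 + (p' + D)^2 <= 2 (1 + D^2) (1 + p'^2)] in each coordinate. *)
Lemma torus_weight_compare Q x y (D : R) : torus x -> torus y -> 0 < Q ->
  Q * torus_dist x y <= D ->
  torus_weight Q y <= (2 * (1 + D ^+ 2)) ^+ d * torus_weight Q x.
Proof.
move=> tx ty Q0 QD.
rewrite -[X in _ ^+ X](card_ord d) -prodr_const /torus_weight -big_split/=.
apply: ler_prod => i _; rewrite (ltW (circle_weight_gt0 _ _))/=.
have D0 : 0 <= D by apply: le_trans QD; rewrite mulr_ge0 ?sqrtr_ge0// ltW.
have h : `|Q * sin (x 0 i / 2)| <= `|Q * sin (y 0 i / 2)| + D.
  rewrite !normrM (gtr0_norm Q0); apply: le_trans (ler_wpM2l (ltW Q0) (norm_sin_halfD_le _ (y 0 i))) _.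
  rewrite mulrDr lerD2l; apply: le_trans QD; apply: ler_wpM2l; first exact: ltW.
  apply: le_trans (torus_dist_coord i tx ty); apply: norm_sin_half_le.
  rewrite ler_norml.
  by have /andP[x0 x2] := tx i; have /andP[y0 y2] := ty i; apply/andP; split; lra.
rewrite /circle_weight -[(_ * sin (x 0 i / 2)) ^+ 2]real_normK ?num_real//.
rewrite -[(_ * sin (y 0 i / 2)) ^+ 2]real_normK ?num_real//.
move: `|_| `|Q * sin (y 0 i / 2)| (normr_ge0 (Q * sin (x 0 i / 2))) (normr_ge0 (Q * sin (y 0 i / 2))) h.
move=> p p' p0 p'0 h.
have a0 : 0 < 1 + p ^+ 2 by have := sqr_ge0 p; lra.
have b0 : 0 < 1 + p' ^+ 2 by have := sqr_ge0 p'; lra.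
rewrite ler_pdivlMr// ler_pdivrMl//.
have : p ^+ 2 <= (p' + D) ^+ 2 by apply: lerXn2r; rewrite ?nnegrE ?addr_ge0.
have := sqr_ge0 (p' - D); have := sqr_ge0 (p' * D).
by rewrite !exprMn; lra.
Qed.

Lemma indicator_integral (A : set 'rV[R]_d) (a : R) : measurable A ->
  torus_measure R d A = a%:E ->
  bounded_meas (\1_A : 'rV[R]_d -> R) /\ \int[torus_measure R d]_x (\1_A x) = a.
Proof.
move=> mA Aa; split.
  split; first exact: measurable_indic.
  by exists 1 => x; rewrite indicE; case: (_ \in _); rewrite ?normr1 ?normr0.
rewrite -[RHS]/(fine a%:E) -Aa /Rintegral; congr fine.
by rewrite integral_indic// setIT.
Qed.

End torus_weight.

Section weight_sampling.
Context (R : realType) (d : nat) (N : needlet_system R d).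
Local Notation B := (ndB N).

(** As [ndlam N k] is the area of a pixel, the sum is the integral of a function constant on pixels,
    which the comparison of weights bounds by the integral of the weight. *)
Lemma sample_torus_weight : exists2 C : R, 0 < C & forall j0 j, near_level j0 j ->
  \sum_(k < ndK N j) ndlam N k * torus_weight (B ^+ j0) (ndxi N k) <= C / B ^+ (j0 * d).
Proof.
have [CW CW0 hW] := torus_weight_integral R d.
have [Cd Cd0 hd] := ndpix_diam N.
have B0 := ndB_gt0 N.
(* A pixel has diameter at most [Cd / B^j] and [B^j0 <= B^(j + 1)], so in units of [B^(- j0)] it has
   size at most [Cd * B]. *)
pose D := Cd * B; pose K := (2 * (1 + D ^+ 2)) ^+ d.
have K0 : 0 < K by rewrite exprn_gt0// mulr_gt0//; have := sqr_ge0 D; lra.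
exists (K * CW) => [|j0 j /andP[_ j0j]]; first exact: mulr_gt0.
set Q := B ^+ j0; have Q0 : 0 < Q := ndBX_gt0 N j0.
have bI (k : 'I_(ndK N j)) := indicator_integral (ndpix_measurable k) (ndpix_area k).
have pixT (k : 'I_(ndK N j)) x : ndpix N k x -> torus x.
  by move=> kx; rewrite -(ndpix_cover N j); exists k.
have pt x : \sum_(k < ndK N j) torus_weight Q (ndxi N k) * \1_(ndpix N k) x <= K * torus_weight Q x.
  have Kw : 0 <= K * torus_weight Q x by rewrite mulr_ge0 ?(ltW K0)// ltW// torus_weight_gt0.
  have [[k kx]|nx] := pselect (exists k : 'I_(ndK N j), ndpix N k x); last first.
    rewrite big1// => k _; rewrite indicE memNset ?mulr0// => kx.
    by apply: nx; exists k.
  rewrite (bigD1 k)//= big1 ?addr0 => [|k' k'k]; last first.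
    rewrite indicE memNset ?mulr0// => k'x; move/eqP: k'k; apply.
    have := @ndpix_disjoint _ _ N j; move=> /(_ k' k I I); apply; by exists x.
  rewrite indicE mem_set// mulr1; apply: torus_weight_compare => //.
  - exact: pixT kx.
  - exact: ndxi_torus.
  - have := hd j k x (ndxi N k) kx (ndpix_center k).
    move=> /(ler_wpM2l (ltW Q0))/le_trans; apply.
    rewrite /D mulrCA ler_wpM2l ?(ltW Cd0)// ler_pdivrMr ?ndBX_gt0// -exprS.
    by rewrite ler_weXn2l// ltW// ndB_gt1.
have -> : \sum_(k < ndK N j) ndlam N k * torus_weight Q (ndxi N k) =
    \int[torus_measure R d]_x (\sum_(k < ndK N j) torus_weight Q (ndxi N k) * \1_(ndpix N k) x).
  rewrite bounded_integral_sum => [|k _ _]; last first.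
    by apply: bounded_measZ; have [] := bI k.
  apply: eq_bigr => k _; rewrite bounded_integralZ; last by have [] := bI k.
  by have [_ ->] := bI k; rewrite mulrC.
have bw := @bounded_meas_torus_weight R d Q.
have bs : bounded_meas (fun x : 'rV[R]_d =>
    \sum_(k < ndK N j) torus_weight Q (ndxi N k) * \1_(ndpix N k) x).
  by apply: bounded_meas_sum => k _ _; apply: bounded_measZ; have [] := bI k.
have := bounded_le_integral (torus_measure R d) bs (bounded_measZ K bw) pt.
move=> /le_trans; apply.
rewrite bounded_integralZ// -mulrA; apply: ler_wpM2l; first exact: ltW.
by rewrite exprM; exact: hW.
Qed.

End weight_sampling.

(** * The sparse packet *)

Section sparse_packet.
Context (R : realType) (d : nat) (N : needlet_system R d).
Hypothesis d_gt0 : (0 < d)%N.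
Local Notation B := (ndB N).
Local Notation mu := (torus_measure R d).
Local Notation box j := (int_box d (band_radius N j)).
Implicit Types (l : 'rV[int]_d) (m : 'I_d -> nat) (beta : R -> R).

Lemma radial_packet m beta :
  (forall n, smooth_upto n beta) -> supported B^-1 B beta ->
  exists2 C, 0 < C & forall j0 s, uniq s ->
    (forall l, radial_mult m beta (B ^+ j0) l != 0 -> l \in s) -> forall c : R,
    (forall j, near_level j0 j -> \sum_(k < ndK N j) ndlam N k *
      `|tpoly s (radial_mult m beta (B ^+ j0)) (fun=> c) (ndxi N k)| <=
      C * B ^+ (j0 * multi_norm m)) /\
    \int[mu]_x `|tpoly s (radial_mult m beta (B ^+ j0)) (fun=> c) x| <=
      C * B ^+ (j0 * multi_norm m).
Proof.
move=> smb sb; have B0 := ndB_gt0 N.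
have BV : 0 < B^-1 by rewrite invr_gt0.
have [K K0 hK] := radial_mult_weight m BV (ltW B0) sb d_gt0 (smb _).
have [C1 C10 h1] := sample_torus_weight N.
have [C2 C20 h2] := torus_weight_integral R d.
exists (K * (C1 + C2)) => [|j0 s us ss c]; first by rewrite mulr_gt0// addr_gt0.
set Q := B ^+ j0; have Q0 : 0 < Q := ndBX_gt0 N j0.
have Qm : 0 < Q ^+ multi_norm m by rewrite exprn_gt0.
have Qd : 0 < Q ^+ d by rewrite exprn_gt0.
have KQ : 0 <= K * (Q ^+ multi_norm m * Q ^+ d) by rewrite !mulr_ge0// ltW.
have hT := hK Q (ndBX_ge1 N j0) s us ss c.
have fin C' : 0 <= C' -> C' <= C1 + C2 ->
    K * (Q ^+ multi_norm m * Q ^+ d) * (C' / Q ^+ d) <= K * (C1 + C2) * B ^+ (j0 * multi_norm m).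
  move=> C'0 C'C; rewrite exprM -/Q.
  have -> : K * (Q ^+ multi_norm m * Q ^+ d) * (C' / Q ^+ d) = K * C' * Q ^+ multi_norm m.
    by move: (Q ^+ d) Qd (Q ^+ multi_norm m) => X X0 Y; field; rewrite gt_eqF.
  by rewrite ler_wpM2r ?(ltW Qm)// ler_wpM2l// ltW.
split=> [j nj|].
  apply: le_trans (fin C1 (ltW C10) _); last by rewrite lerDl ltW.
  have h1j := h1 j0 j nj; rewrite exprM -/Q in h1j.
  apply: le_trans (ler_wpM2l KQ h1j).
  rewrite mulr_sumr; apply: ler_sum => k _; rewrite mulrCA.
  by rewrite ler_wpM2l ?(ltW (ndlam_gt0 k))//; exact: hT.
apply: le_trans (fin C2 (ltW C20) _); last by rewrite lerDr ltW.
apply: le_trans (ler_wpM2l KQ (h2 Q Q0)).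
have bw := @bounded_meas_torus_weight R d Q.
rewrite -bounded_integralZ//; apply: bounded_le_integral; last exact: hT.
- by apply: bounded_meas_norm; exact: bounded_meas_tpoly.
- exact: bounded_measZ.
Qed.

Lemma smooth_ndb n : smooth_upto n (ndb N).
Proof. by apply: smooth_upto_derive1n; exact: ndb_smooth. Qed.

Lemma supported_ndb : supported B^-1 B (ndb N).
Proof. by move=> x [/ltW|/ltW] h; apply: ndb_out; [left|right]. Qed.

Lemma freq_mono_zero l : freq_mono R (fun=> 0%N) l = 1.
Proof. by rewrite /freq_mono big1. Qed.

Lemma multi_norm_zero : multi_norm (fun _ : 'I_d => 0%N) = 0%N.
Proof. by rewrite /multi_norm big1. Qed.

(** The product of two windows is again a radial profile at scale [B^j0], but it depends on
    [a = B^j0 / B^j]. Near levels leave only [a = B], [1] and [B^-1], so three applications of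
    [radial_packet] give a constant uniform in the levels. *)
Lemma band_product_packet m : exists2 C, 0 < C & forall j0 j (c : R), near_level j0 j ->
  \sum_(k < ndK N j) ndlam N k * `|tpoly (box j0)
      (fun l => freq_mono R m l * (band_mult N j0 l * band_mult N j l)) (fun=> c) (ndxi N k)| <=
    C * B ^+ (j0 * multi_norm m).
Proof.
have B0 := ndB_gt0 N.
pose S j0 j (c : R) := \sum_(k < ndK N j) ndlam N k * `|tpoly (box j0)
  (fun l => freq_mono R m l * (band_mult N j0 l * band_mult N j l)) (fun=> c) (ndxi N k)|.
have H (a : R) : exists2 C, 0 < C & forall j0 j c, near_level j0 j ->
    B ^+ j0 / B ^+ j = a -> S j0 j c <= C * B ^+ (j0 * multi_norm m).
  have sm n : smooth_upto n (fun x => ndb N x * ndb N (a * x)).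
    by apply: smooth_uptoM; [|apply: smooth_upto_scale]; exact: smooth_ndb.
  have sp : supported B^-1 B (fun x => ndb N x * ndb N (a * x)).
    by move=> x /supported_ndb ->; rewrite mul0r.
  have [C C0 hC] := radial_packet m sm sp.
  exists C => // j0 j c nj ja.
  have E : (fun l => freq_mono R m l * (band_mult N j0 l * band_mult N j l)) =
      radial_mult m (fun x => ndb N x * ndb N (a * x)) (B ^+ j0).
    apply/funext => l; rewrite /radial_mult /band_mult -ja; congr (_ * (_ * ndb N _)).
    move: (B ^+ j) (B ^+ j0) (ndBX_gt0 N j) (ndBX_gt0 N j0) => P Q P0 Q0.
    by field; rewrite !gt_eqF.
  rewrite /S E; have [|h _] := hC j0 _ (uniq_int_box d (band_radius N j0)) _ c; last exact: h.
  move=> l; rewrite /radial_mult !mulf_eq0 !negb_or => /andP[_ /andP[bl _]].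
  exact/freq_band_box/band_mult_neq0.
have [C1 C10 h1] := H B; have [C2 C20 h2] := H 1; have [C3 C30 h3] := H B^-1.
exists (C1 + C2 + C3) => [|j0 j c nj]; first by rewrite !addr_gt0.
have Bm := ltW (ndBX_gt0 N (j0 * multi_norm m)).
have : [|| j0 == j.+1, j == j0 | j == j0.+1].
  by move: nj; rewrite /near_level => /andP[? ?]; lia.
case/or3P => /eqP E.
- apply: le_trans (h1 j0 j c nj _) _; first by rewrite E exprS mulfK ?gt_eqF ?ndBX_gt0.
  by rewrite ler_wpM2r// -addrA lerDl addr_ge0// ltW.
- apply: le_trans (h2 j0 j c nj _) _; first by rewrite E divff ?gt_eqF ?ndBX_gt0.
  by rewrite ler_wpM2r// addrAC lerDr addr_ge0// ltW.
- apply: le_trans (h3 j0 j c nj _) _.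
    by rewrite E exprS invfM mulrCA divff ?mulr1 ?gt_eqF ?ndBX_gt0.
  by rewrite ler_wpM2r// lerDr addr_ge0// ltW.
Qed.

Lemma sum_subset_le (s s' : seq 'rV[int]_d) (F : 'rV[int]_d -> R) : uniq s -> uniq s' ->
  {subset s <= s'} -> (forall l, 0 <= F l) -> \sum_(l <- s) F l <= \sum_(l <- s') F l.
Proof.
move=> us us' ss F0; rewrite [leRHS](bigID (mem s))/=.
have -> : \sum_(l <- s) F l = \sum_(l <- s' | l \in s) F l.
  rewrite -[RHS]big_filter; apply: perm_big; apply: uniq_perm; rewrite ?filter_uniq// => l.
  by rewrite mem_filter; case: (boolP (l \in s)) => //= /ss ->.
by rewrite lerDl; apply: sumr_ge0 => l _.
Qed.

(** The partition of unity forbids [b] to vanish identically; continuity does the rest. *)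
Lemma ndb_bump : exists u0 e del : R, [/\ 0 < u0, 0 < e, 0 < del &
  forall x, u0 <= x <= u0 + e -> del <= ndb N x].
Proof.
have [x bx] : exists x, ndb N x != 0.
  apply: contrapT => H; have b0 x : ndb N x = 0.
    by apply/eqP/negPn/negP => bx; apply: H; exists x.
  have := ndb_unity N (ndB_gt1 N).
  rewrite (_ : (fun n : nat => _) = cst 0); last first.
    by apply/funext => n; rewrite big1// => j _; rewrite b0 expr0n.
  move=> h; have := cvg_unique (@norm_hausdorff _ _) h (cvg_cst (0 : R)).
  by move=> E; have := oner_neq0 R; rewrite E eqxx.
have bp : 0 < ndb N x by rewrite lt_def bx ndb_ge0.
have /andP[xB _] := ndb_support bx.
have x0 : 0 < x by apply: lt_le_trans xB; rewrite invr_gt0 ndB_gt0.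
have := @continuous_ndb _ _ N x => /(_ [set y | ndb N x / 2 < y]).
case=> [|e /= e0 He]; first by apply: lt_nbhsr; lra.
exists x, (e / 2), (ndb N x / 2); split => //; [lra|lra|].
move=> y /andP[xy ye]; apply: ltW; apply: He => /=.
by rewrite distrC ger0_norm; lra.
Qed.

(** Only a grid of lattice points near the diagonal is counted, with all coordinates between
    [u0 Q / sqrt d] and [(u0 + e) Q / sqrt d]. There the window is at least [del], every coordinate
    has order [Q], and the number of points has order [Q^d]. *)
Lemma lattice_energy_ge m : exists2 c : R, 0 < c & exists j1, forall j0, (j1 <= j0)%N ->
  c * (B ^+ (j0 * d) * (B ^+ (j0 * multi_norm m)) ^+ 2) <=
  \sum_(l <- box j0) (band_mult N j0 l * freq_mono R m l) ^+ 2.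
Proof.
have [u0 [e [del [u00 e0 del0 bump]]]] := ndb_bump.
have B1 := ndB_gt1 N.
pose sd : R := Num.sqrt d%:R.
have sd0 : 0 < sd by rewrite sqrtr_gt0 ltr0n.
exists ((e / 2 / sd) ^+ d * (del * (u0 / sd) ^+ multi_norm m) ^+ 2).
  apply: mulr_gt0; apply: exprn_gt0; first by rewrite divr_gt0// divr_gt0.
  by apply: mulr_gt0 => //; rewrite exprn_gt0// divr_gt0.
have [j1 hj1] := ndBX_large N (2 * sd / e); exists j1 => j0 jj0.
set Q := B ^+ j0; have Q0 : 0 < Q := ndBX_gt0 N j0.
(* For such [Q] the integer part [n1] keeps at least half of [e * Q / sd]. *)
have Qe : 1 < Q * (e / 2 / sd).
  have : 2 * sd / e < Q by exact: hj1.
  move=> h; have -> : Q * (e / 2 / sd) = Q / (2 * sd / e) by field; rewrite !gt_eqF.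
  by rewrite ltr_pdivlMr ?mul1r// divr_gt0// mulr_gt0.
have p1 : 0 <= u0 * Q / sd by rewrite divr_ge0 ?mulr_ge0// ltW.
have p2 : 0 <= e * Q / sd by rewrite divr_ge0 ?mulr_ge0// ltW.
pose a0 := (Num.truncn (u0 * Q / sd)).+1; pose n1 := Num.truncn (e * Q / sd).
have a0_gt : u0 * Q / sd < a0%:R by exact: truncnS_gt.
have a0_le : a0%:R <= u0 * Q / sd + 1.
  by rewrite /a0 -natr1 lerD2r; have /andP[] := truncn_itv p1.
have /andP[n1_le n1_gt] := truncn_itv p2; rewrite -/n1 in n1_le n1_gt.
have n1_ge : e / 2 / sd * Q <= n1%:R.
  have -> : e / 2 / sd * Q = e * Q / sd - Q * (e / 2 / sd) by field; rewrite gt_eqF.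
  by move: n1_gt; rewrite -natr1; lra.
pose pt (f : {ffun 'I_d -> 'I_n1}) : 'rV[int]_d := \row_i (a0 + f i)%N%:Z.
pose S := [seq pt f | f : {ffun 'I_d -> 'I_n1}].
have uS : uniq S.
  rewrite map_inj_uniq ?enum_uniq// => f g /rowP fg; apply/ffunP => i.
  by have := fg i; rewrite !mxE => /eqP; rewrite eqz_nat eqn_add2l => /eqP/val_inj.
have coordE f i : ((pt f) 0 i)%:~R = (a0 + f i)%:R :> R by rewrite mxE.
have coord_ge f i : u0 * Q / sd <= ((pt f) 0 i)%:~R.
  by rewrite coordE natrD; apply: (le_trans (ltW a0_gt)); rewrite lerDl.
have coord_le f i : ((pt f) 0 i)%:~R <= (u0 + e) * Q / sd.
  have -> : (u0 + e) * Q / sd = u0 * Q / sd + e * Q / sd by field; rewrite gt_eqF.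
  rewrite coordE natrD.
  have : (f i)%:R + 1 <= n1%:R :> R by rewrite natr1 ler_nat ltn_ord.
  by move: a0_le n1_le; lra.
have norm_pt f : u0 <= freq_norm R (pt f) / Q <= u0 + e.
  have sq (t : R) : 0 <= t -> Num.sqrt (\sum_(i < d) (t / sd) ^+ 2) = t.
    move=> t0; rewrite sumr_const card_ord -[X in Num.sqrt X]mulr_natr exprMn -mulrA.
    rewrite exprVn sqr_sqrtr ?ler0n// mulVf ?mulr1 ?sqrtr_sqr ?ger0_norm//.
    by rewrite pnatr_eq0 -lt0n.
  have uQ : 0 <= u0 * Q by rewrite mulr_ge0// ltW.
  have ueQ : 0 <= (u0 + e) * Q by rewrite mulr_ge0// ltW// addr_gt0.
  rewrite ler_pdivlMr// ler_pdivrMr// -{1}(sq (u0 * Q))// -(sq ((u0 + e) * Q))//.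
  apply/andP; split; rewrite /freq_norm ler_wsqrtr//; apply: ler_sum => i _.
    apply: lerXn2r; rewrite ?nnegrE//; exact: le_trans (coord_ge f i).
  apply: lerXn2r; rewrite ?nnegrE ?divr_ge0 ?(ltW sd0)//.
  exact: le_trans (coord_ge f i).
have bpt f : del <= band_mult N j0 (pt f) by exact: bump.
have SS : {subset S <= box j0}.
  move=> l /mapP[f _ ->]; apply/freq_band_box/band_mult_neq0.
  by rewrite gt_eqF// (lt_le_trans del0).
have F0 l : 0 <= (band_mult N j0 l * freq_mono R m l) ^+ 2 by exact: sqr_ge0.
apply: le_trans (sum_subset_le uS (uniq_int_box d _) SS F0).
pose L : R := (del * (u0 * Q / sd) ^+ multi_norm m) ^+ 2.
apply: (@le_trans _ _ (\sum_(l <- S) L)).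
  rewrite big_const_seq count_predT size_map -cardE card_ffun !card_ord iter_addr addr0.
  rewrite -[leRHS]mulr_natl natrX.
  have -> : (e / 2 / sd) ^+ d * (del * (u0 / sd) ^+ multi_norm m) ^+ 2 *
      (B ^+ (j0 * d) * (B ^+ (j0 * multi_norm m)) ^+ 2) = (e / 2 / sd * Q) ^+ d * L.
    rewrite /L !exprM -/Q [u0 * Q / sd]mulrAC [(e / 2 / sd * Q) ^+ d]exprMn.
    rewrite [(u0 / sd * Q) ^+ _]exprMn.
    move: ((e / 2 / sd) ^+ d) ((u0 / sd) ^+ _) (Q ^+ d) (Q ^+ _) => x1 x2 x3 x4.
    by ring.
  rewrite ler_wpM2r ?sqr_ge0//; apply: lerXn2r; rewrite ?nnegrE ?ler0n//.
  by rewrite mulr_ge0 ?(ltW Q0)// !divr_ge0// ltW.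
rewrite big_seq [leRHS]big_seq; apply: ler_sum => _ /mapP[f _ ->].
rewrite /L; apply: lerXn2r; rewrite ?nnegrE.
- by rewrite mulr_ge0 ?exprn_ge0// ltW.
- rewrite mulr_ge0//; first by rewrite (le_trans (ltW del0)).
  by apply: prodr_ge0 => i _; rewrite exprn_ge0// (le_trans p1 (coord_ge f i)).
- apply: ler_pM => //; [exact: ltW|exact: exprn_ge0|].
  rewrite /freq_mono /multi_norm expr_sum; apply: ler_prod => i _.
  rewrite exprn_ge0//=; apply: lerXn2r; rewrite ?nnegrE//.
  exact: le_trans p1 (coord_ge f i).
Qed.

Lemma sparse_packet m : exists C : R, 0 < C /\ exists j1 : nat,
  forall j0, (j1 <= j0)%N -> wave_packet N m j0 (B ^+ (j0 * d)) C (band_mult N j0).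
Proof.
have [M M0 bM] := ndb_le N; have B0 := ndB_gt0 N.
have [C1 C10 h1] := band_product_packet (fun=> 0%N).
have [C2 C20 h2] := band_product_packet m.
have [C3 C30 h3] := radial_packet m smooth_ndb supported_ndb.
have [c c0 [j1 h4]] := lattice_energy_ge m.
have P0 := @pi2X_gt0 R d.
have B23 : 0 < (2 * B + 3) ^+ d by rewrite exprn_gt0//; lra.
pose C5 := M * (2 * B + 3) ^+ d.
have C50 : 0 < C5 by rewrite mulr_gt0.
pose C4 := 2 / (2 * pi) ^+ d / c.
have C40 : 0 < C4 by rewrite !divr_gt0.
(* One constant for each bound in [wave_packet]: [C5] for the height, [C1] and [C2] for the samples
   of the packet and of its derivative, [C3] for the [L^1] norm, [C4] for the energy. *)
pose C := C5 + C1 + C2 + C3 + C4.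
exists C; split; first by rewrite /C; lra.
exists j1 => j0 jj0.
have Bm := ltW (ndBX_gt0 N (j0 * multi_norm m)).
have Bd := ndBX_gt0 N (j0 * d).
split.
- exact: band_multN.
- by move=> l; exact: band_mult_neq0.
- have bl l : `|band_mult N j0 l| <= M by exact: band_mult_le.
  apply: le_trans (sum_int_box_le (band_radius N j0) bl) _.
  apply: (@le_trans _ _ (C5 * B ^+ (j0 * d))).
    rewrite -mulrA ler_wpM2l ?(ltW M0)// exprM -exprMn.
    by apply: lerXn2r (band_radius_le N j0); rewrite nnegrE ?ler0n// mulr_ge0 ?(ltW (ndBX_gt0 _ _))//; lra.
  by rewrite ler_wpM2r ?(ltW Bd)// /C; lra.
- move=> j nj; have := h1 j0 j 0 nj; rewrite multi_norm_zero muln0 expr0 mulr1 => h.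
  apply: (@le_trans _ _ C1); last by rewrite /C; lra.
  apply: le_trans h; apply: eq_ler.
  apply: eq_bigr => k _; congr (_ * `|_ (ndxi N k)|).
  by apply: eq_tpoly => l _ //; rewrite freq_mono_zero mul1r.
- move=> j nj; apply: (@le_trans _ _ (C2 * B ^+ (j0 * multi_norm m))); last first.
    by rewrite ler_wpM2r// /C; lra.
  apply: le_trans (h2 j0 j _ nj); apply: eq_ler.
  apply: eq_bigr => k _; congr (_ * `|_ (ndxi N k)|).
  by apply: eq_tpoly => l _ //; rewrite mulrCA mulrA mulrC.
- apply: (@le_trans _ _ (C3 * B ^+ (j0 * multi_norm m))); last first.
    by rewrite ler_wpM2r// /C; lra.
  have [|_ h] := h3 j0 _ (uniq_int_box d (band_radius N j0)) _ ((multi_norm m)%:R * (pi / 2)).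
    move=> l; rewrite /radial_mult mulf_eq0 negb_or => /andP[_ bl].
    exact/freq_band_box/band_mult_neq0.
  apply: le_trans h; apply: eq_ler.
  congr Rintegral; apply/funext => x; congr (`|_ x|).
  by apply: eq_tpoly => l _ //; rewrite mulrC.
- have := packet_norm2_ge N m j0 (band_multN N j0); set I := Rintegral _ _ _ => hI.
  have := h4 _ jj0; set X := B ^+ (j0 * d) * _ => hX.
  have X0 : 0 <= X by rewrite mulr_ge0 ?sqr_ge0// ltW.
  have C0 : 0 < C by rewrite /C; lra.
  apply: le_trans (ler_wpM2l (ltW C0) hI).
  have PC : 0 <= (2 * pi) ^+ d / 2 :> R by rewrite divr_ge0// ltW.
  apply: le_trans (ler_wpM2l (ltW C0) (ler_wpM2l PC hX)).
  apply: (@le_trans _ _ (C4 * ((2 * pi) ^+ d / 2 * (c * X)))).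
    apply: eq_ler; rewrite /C4.
    by field; rewrite !gt_eqF.
  by rewrite ler_wpM2r ?mulr_ge0 ?(ltW c0)// /C; lra.
Qed.

End sparse_packet.

(** * Rates *)

Section rate_lower_bound.
Context (R : realType) (d : nat) (N : needlet_system R d) (m : 'I_d -> nat).
Hypothesis m_gt0 : (0 < multi_norm m)%N.
Variables (kappa : R) (eta : R -> R -> R) (s r : R) (q : \bar R) (G : R) (v : R).
Hypotheses (kappa_gt0 : 0 < kappa) (etaP : threshold_rule eta).
Hypotheses (r_gt1 : 1 < r) (q_ge1 : (1 <= q)%E) (G_gt0 : 0 < G).
Hypotheses (v_ge0 : 0 <= v) (v_lt : v / r < s).
Local Notation B := (ndB N).
Local Notation mm := (multi_norm m).
Local Notation sigma := (s + (multi_norm m)%:R).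

(* At the level [j] with [n ~ B^(j * rate_dim)], a packet of height [B^(j * v)] whose
   coefficients have the size [n^(-1/2)] of the noise just fits in the Besov ball;
   [v = 0] is the dense and [v = d] the sparse regime. *)
Definition rate_dim : R := 2 * sigma + d%:R - 2 * (v / r).

Lemma rate_dim_gt0 : 0 < rate_dim.
Proof.
have m0 : 0 < mm%:R :> R by rewrite ltr0n.
have d0 : 0 <= d%:R :> R by [].
have := v_lt; rewrite /rate_dim.
by move: (v / r) (mm%:R : R) (d%:R : R) m0 d0 => w M D m0 d0 h; lra.
Qed.

Lemma s_gt0 : 0 < s.
Proof. by apply: le_lt_trans v_lt; rewrite divr_ge0// ltW// (lt_trans ltr01). Qed.

Lemma calibrated_level j1 : exists2 E : R, 1 <= E & forall n, (2 <= n)%N ->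
  exists j0, [/\ (j1 <= j0)%N, B ^+ j0 <= E * n%:R `^ rate_dim^-1 &
    n%:R `^ rate_dim^-1 <= B * B ^+ j0].
Proof.
have B1 := ndB_gt1 N; have B0 := ndB_gt0 N; have D0 := rate_dim_gt0.
(* The level will be [j1] plus the integer part of the ideal real level; [B^j1] pays for the
   shift. *)
exists (B ^+ j1) => [|n n2]; first exact: ndBX_ge1.
have lB : 0 < ln B by rewrite ln_gt0.
have n0 : 0 < n%:R :> R by rewrite ltr0n ltnW.
have ln0 : 0 <= ln n%:R :> R by rewrite ln_ge0// ler1n ltnW.
pose x := ln n%:R / ln B / rate_dim.
have x0 : 0 <= x by rewrite !divr_ge0// ltW.
have tE : n%:R `^ rate_dim^-1 = B `^ x.
  rewrite /powR !gt_eqF// /x; congr expR.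
  by field; rewrite !gt_eqF.
have /andP[h1 h2] := truncn_itv x0.
exists (j1 + Num.truncn x)%N; rewrite leq_addr tE; split=> //.
  rewrite exprD ler_wpM2l ?(ltW (ndBX_gt0 _ _))// -powR_mulrn ?(ltW B0)//.
  by apply: ler_powR => //; exact: ltW.
rewrite -exprS; apply: (@le_trans _ _ (B `^ (Num.truncn x).+1%:R)).
  by apply: ler_powR; exact: ltW.
rewrite powR_mulrn ?(ltW B0)//; apply: ler_weXn2l; [exact: ltW|by rewrite ltnS leq_addl].
Qed.

Hypothesis packets : exists C : R, 0 < C /\ exists j1 : nat,
  forall j0, (j1 <= j0)%N -> exists H, wave_packet N m j0 (B `^ (j0%:R * v)) C H.

Let risk_bounds A A' n := forall X : (forall f : density R d, iid_sample n f),
  exists (f : density R d) (g : 'rV[R]_d -> R),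
  [/\ besov_ball N sigma r q G f, is_Dmulti m f g,
    (forall p, 1 <= p -> ((A `^ p * A')%:E <= Lp_risk N m kappa eta p (X f) g)%E) &
    (A%:E <= Loo_risk N m kappa eta (X f) g)%E].

(** With [B^j0] of order [n^(1 / rate_dim)], the first power of [n] is the height of the missed
    derivative and the second is [1 / V]. *)
Let conclusion K n := risk_bounds (K * n%:R `^ (- ((s - v / r) / rate_dim)))
  (K * n%:R `^ (- (v / rate_dim))) n.

Let conclusion_weaken n K A A' : 0 < K ->
  K * n%:R `^ (- ((s - v / r) / rate_dim)) <= A -> K * n%:R `^ (- (v / rate_dim)) <= A' ->
  risk_bounds A A' n -> conclusion K n.
Proof.
move=> K0 h1 h2 H X; have [f [g [bf dg hp hoo]]] := H X.
have K1 : 0 <= K * n%:R `^ (- ((s - v / r) / rate_dim)) by rewrite mulr_ge0 ?powR_ge0// ltW.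
have K2 : 0 <= K * n%:R `^ (- (v / rate_dim)) by rewrite mulr_ge0 ?powR_ge0// ltW.
exists f, g; split => // [p p1|].
  apply: le_trans (hp p p1); rewrite lee_fin; apply: ler_pM => //; first exact: powR_ge0.
  by apply: ge0_ler_powR; rewrite ?nnegrE//; [lra|exact: le_trans h1].
by apply: le_trans hoo; rewrite lee_fin.
Qed.

Lemma sample_powR_le1 n e : (2 <= n)%N -> 0 <= e -> n%:R `^ (- (e / rate_dim)) <= 1.
Proof.
move=> n2 e0; rewrite -[leRHS](powRr0 n%:R); apply: ler_powR; first by rewrite ler1n ltnW.
by rewrite oppr_le0 divr_ge0// ltW// rate_dim_gt0.
Qed.

Lemma rate_lower_bound_small n0 : exists2 K : R, 0 < K & forall n, (2 <= n < n0)%N ->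
  conclusion K n.
Proof.
have [C [C0 [j1 pk]]] := packets; have B0 := ndB_gt0 N.
have sig0 : 0 <= sigma by rewrite addr_ge0// ltW// s_gt0.
have [K [K0 hK]] := @packet_lower_bound R d N m m_gt0 kappa eta sigma r q kappa_gt0 etaP
  sig0 r_gt1 q_ge1 C C0.
(* One level above all cutoffs with [n < n0], so that a single packet serves these finitely many
   [n]. *)
pose j0 := (j1 + (\max_(i < n0) cutoff N m i).+1)%N.
have [H pH] := pk j0 (leq_addr _ _).
set V := B `^ (j0%:R * v) in pH; have V0 : 0 < V by rewrite powR_gt0.
pose Z := V `^ (1 - r^-1) * B `^ (j0%:R * sigma).
have Z0 : 0 < Z by rewrite mulr_gt0// powR_gt0.
(* On a level that is not estimated, only positivity of the density and the radius [G] limit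
   [gam]. *)
pose gam := Num.min (K * V)^-1 (G / (K * Z)).
have KVp : 0 < K * V by exact: mulr_gt0.
have KZp : 0 < K * Z by exact: mulr_gt0.
have gam0 : 0 < gam by rewrite lt_min invr_gt0 KVp divr_gt0.
have g1 : K * (gam * V) <= 1.
  by rewrite mulrCA -ler_pdivlMr ?mulr_gt0// mul1r /gam ge_min lexx.
have g2 : K * (gam * V `^ (1 - r^-1) * B `^ (j0%:R * sigma)) <= G.
  rewrite -[gam * _ * _]mulrA -/Z mulrCA -ler_pdivlMr//.
  by rewrite /gam ge_min lexx orbT.
pose A := K^-1 * (gam * V * B ^+ (j0 * mm)).
have A0 : 0 < A by rewrite !mulr_gt0 ?invr_gt0 ?exprn_gt0.
have KV : 0 < (K * V)^-1 by rewrite invr_gt0.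
exists (Num.min A (K * V)^-1) => [|n /andP[n2 nn0]]; first by rewrite lt_min A0.
have cut : (cutoff N m n < j0)%N.
  rewrite /j0 addnS ltnS; apply: leq_trans (leq_addl _ _).
  exact: (@leq_bigmax _ (fun i : 'I_n0 => cutoff N m i) (Ordinal nn0)).
have hn := hK j0 V H gam G n V0 pH gam0 n2 g1 g2 (or_introl cut).
have m0 : 0 < Num.min A (K * V)^-1 by rewrite lt_min A0.
have le1 e : 0 <= e -> Num.min A (K * V)^-1 * n%:R `^ (- (e / rate_dim)) <= Num.min A (K * V)^-1.
  by move=> e0; rewrite ler_piMr ?(ltW m0)// sample_powR_le1.
apply: (conclusion_weaken m0 _ _ hn).
- by apply: le_trans (le1 _ _) _; [rewrite subr_ge0 ltW|rewrite ge_min lexx].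
- by apply: le_trans (le1 _ _) _ => //; rewrite ge_min lexx orbT.
Qed.

Lemma rate_lower_bound_large : exists n0 : nat, exists2 K : R, 0 < K &
  forall n, (2 <= n)%N -> (n0 <= n)%N -> conclusion K n.
Proof.
have [C [C0 [j1 pk]]] := packets; have B0 := ndB_gt0 N; have B1 := ndB_gt1 N.
have sig0 : 0 <= sigma by rewrite addr_ge0// ltW// s_gt0.
have [K [K0 hK]] := @packet_lower_bound R d N m m_gt0 kappa eta sigma r q kappa_gt0 etaP
  sig0 r_gt1 q_ge1 C C0.
have [E E1 lev] := calibrated_level j1.
have D0 := rate_dim_gt0; set D := rate_dim in lev D0.
have r0 : r != 0 by rewrite gt_eqF// (lt_trans ltr01).
have dD : d%:R <= D.
  have := v_lt; have : 0 <= mm%:R :> R by [].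
  by rewrite /D /rate_dim; move: (v / r) (mm%:R : R) (d%:R : R) => w M e h1 h2; lra.
have E0 : 0 < E by lra.
(* [F] bounds the effect of rounding the level on [(B^j0)^(D / 2) / n^(1/2)]; dividing by it lets
   [c] meet both size constraints. *)
pose F := E `^ (D / 2); have F0 : 0 < F by rewrite powR_gt0.
pose c := Num.min 1 (Num.min (K * F)^-1 (G / (K * F))).
have KF : 0 < K * F by rewrite mulr_gt0.
have c0 : 0 < c by rewrite !lt_min ltr01 invr_gt0 KF divr_gt0.
have c1 : c <= 1 by rewrite ge_min lexx.
have c2 : c * F * K <= 1.
  by rewrite -mulrA [F * K]mulrC -ler_pdivlMr// mul1r !ge_min lexx !orbT.
have c3 : c * F * K <= G.
  by rewrite -mulrA [F * K]mulrC -ler_pdivlMr// !ge_min lexx !orbT.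
pose k1 := K^-1 * (c * (B `^ (d%:R / 2 + mm%:R))^-1); pose k2 := (K * E `^ v)^-1.
have k10 : 0 < k1 by rewrite !mulr_gt0 ?invr_gt0 ?powR_gt0.
have k20 : 0 < k2 by rewrite invr_gt0 mulr_gt0 ?powR_gt0.
(* Beyond this [n] one has [K / c <= sqrt (ln n)]: here the logarithm absorbs all the constants. *)
exists (Num.truncn (expR ((K / c) ^+ 2))).+1, (Num.min k1 k2) => [|n n2 nn0].
  by rewrite lt_min k10.
have [j0 [jj0 yE ty]] := lev n n2.
have [H pH] := pk j0 jj0.
set y := B ^+ j0 in yE ty; set t := n%:R `^ D^-1 in yE ty.
have y0 : 0 < y := ndBX_gt0 N j0; have y1 : 1 <= y := ndBX_ge1 N j0.
have n0 : 0 < n%:R :> R by rewrite ltr0n ltnW.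
have t0 : 0 < t by rewrite powR_gt0.
have nt : n%:R = t `^ D.
  by rewrite /t -powRrM mulVf ?gt_eqF// powRr1// ltW.
have yv x : B `^ (j0%:R * x) = y `^ x by rewrite powRrM powR_mulrn// ltW.
have yn k : B ^+ (j0 * k) = y `^ k%:R by rewrite exprM powR_mulrn// ltW.
rewrite yv in pH; set V := y `^ v in pH; have V0 : 0 < V by rewrite powR_gt0.
(* The value of [gam * V], equal to [c * (B^(j0 d) / n)^(1/2)] because [t^D = n]: coefficients at
   the noise size. *)
pose a := c * (y `^ (d%:R / 2) * t `^ (- (D / 2))).
have a0 : 0 < a by rewrite !mulr_gt0// powR_gt0.
have tD : t `^ (- (D / 2)) = (Num.sqrt n%:R)^-1.
  by rewrite powRN powRrM -nt powR12_sqrt// ltW.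
have hF e : e <= D / 2 -> c * (y `^ e * t `^ (- (D / 2))) <= c * F.
  move=> eD; rewrite ler_wpM2l ?(ltW c0)//.
  apply: (@le_trans _ _ (y `^ (D / 2) * t `^ (- (D / 2)))).
    by rewrite ler_wpM2r ?powR_ge0//; apply: ler_powR.
  rewrite powRN ler_pdivrMr ?powR_gt0// /F -powRM ?(ltW E0) ?(ltW t0)//.
  by apply: ge0_ler_powR; rewrite ?nnegrE ?divr_ge0 ?(ltW D0) ?(ltW y0) ?mulr_ge0 ?(ltW E0) ?(ltW t0).
have gam0 : 0 < a / V by rewrite divr_gt0.
have gV : a / V * V = a by rewrite divfK// gt_eqF.
have g1 : K * (a / V * V) <= 1.
  rewrite gV mulrC; apply: le_trans c2; rewrite ler_wpM2r ?(ltW K0)//.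
  by apply: hF; lra.
have g2 : K * (a / V * V `^ (1 - r^-1) * B `^ (j0%:R * sigma)) <= G.
  rewrite mulrC; apply: le_trans c3; rewrite ler_wpM2r ?(ltW K0)//.
  apply: le_trans (hF (D / 2) (lexx _)).
  apply: eq_ler.
  rewrite yv /a /V -powRN -powRrM.
  have -> : D / 2 = d%:R / 2 + (- v + (v * (1 - r^-1) + sigma)).
    by rewrite /D /rate_dim; field.
  have yn0 : y != 0 by rewrite gt_eqF.
  have yD e e' : y `^ (e + e') = y `^ e * y `^ e' by rewrite powRD// yn0 implybT.
  rewrite !(yD (d%:R / 2)) !(yD (- v)) !(yD (v * (1 - r^-1))).
  by move: (t `^ _) (y `^ (d%:R / 2)) (y `^ _) => *; ring.
have alt : (cutoff N m n < j0)%N \/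
    ((a / V * V) ^+ 2 <= B ^+ (j0 * d) / n%:R /\
     K * Num.sqrt (B ^+ (j0 * d)) <= a / V * V * (n%:R * Num.sqrt (ln n%:R / n%:R))).
  right; rewrite gV yn /a tD.
  have sy : y `^ (d%:R / 2) = Num.sqrt (y `^ d%:R) by rewrite powRrM powR12_sqrt// powR_ge0.
  have sn : 0 < Num.sqrt n%:R :> R by rewrite sqrtr_gt0.
  have ss : Num.sqrt n%:R ^+ 2 = n%:R :> R by rewrite sqr_sqrtr// ltW.
  rewrite sy; split.
    rewrite !exprMn exprVn ss sqr_sqrtr ?powR_ge0// ler_piMl ?expr_le1// ?(ltW c0)//.
    by rewrite divr_ge0 ?powR_ge0// ltW.
  have ln_n : (K / c) ^+ 2 <= ln n%:R.
    rewrite -[leLHS]expRK ler_ln ?posrE ?expR_gt0//.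
    by apply: le_trans (ltW (truncnS_gt _)) _; rewrite ler_nat.
  have ln0 : 0 <= ln n%:R :> R by rewrite (le_trans _ ln_n)// sqr_ge0.
  rewrite sqrtrM// sqrtrV ?(ltW n0)//.
  set w := Num.sqrt (y `^ d%:R); set l := Num.sqrt (ln n%:R).
  have -> : c * (w / Num.sqrt n%:R) * (n%:R * (l / Num.sqrt n%:R)) = c * l * w.
    by rewrite -{2}ss; field; rewrite gt_eqF.
  rewrite ler_wpM2r ?sqrtr_ge0// mulrC -ler_pdivrMr//.
  rewrite -[leLHS]ger0_norm ?divr_ge0 ?(ltW K0) ?(ltW c0)// -sqrtr_sqr.
  exact: ler_wsqrtr.
have hn := hK j0 V H (a / V) G n V0 pH gam0 n2 g1 g2 alt.
rewrite gV in hn.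
have nE e : n%:R `^ (- (e / D)) = t `^ (- e) by rewrite /t -powRrM mulrN mulrC.
have m0 : 0 < Num.min k1 k2 by rewrite lt_min k10.
apply: (conclusion_weaken m0 _ _ hn); rewrite nE.
- apply: (@le_trans _ _ (k1 * t `^ (- (s - v / r)))).
    by rewrite ler_wpM2r ?powR_ge0// ge_min lexx.
  rewrite /k1 /a -!mulrA ler_wpM2l ?invr_ge0 ?(ltW K0)// ler_wpM2l ?(ltW c0)//.
  rewrite yn mulrCA -powRD; last by rewrite (gt_eqF y0) implybT.
  have -> : - (s - v / r) = (d%:R / 2 + mm%:R) + - (D / 2) :> R.
    by rewrite /D /rate_dim; field.
  rewrite [t `^ (_ + _)]powRD; last by rewrite (gt_eqF t0) implybT.
  rewrite mulrA [leRHS]mulrC ler_wpM2r ?powR_ge0// mulrC ler_pdivrMr ?powR_gt0//.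
  rewrite -powRM ?(ltW y0) ?(ltW B0)// [y * B]mulrC.
  have e0 : 0 <= d%:R / 2 + mm%:R :> R by rewrite addr_ge0.
  by apply: ge0_ler_powR; rewrite ?nnegrE ?(ltW t0) ?mulr_ge0 ?(ltW B0) ?(ltW y0).
- apply: (@le_trans _ _ (k2 * t `^ (- v))).
    by rewrite ler_wpM2r ?powR_ge0// ge_min lexx orbT.
  rewrite /k2 powRN -invfM lef_pV2 ?posrE ?mulr_gt0 ?powR_gt0//.
  rewrite -mulrA ler_wpM2l ?(ltW K0)// -powRM ?(ltW E0) ?(ltW t0)//.
  by apply: ge0_ler_powR; rewrite ?nnegrE ?mulr_ge0 ?(ltW E0) ?(ltW t0) ?(ltW y0).
Qed.

Lemma rate_lower_bound : exists2 K : R, 0 < K & forall n, (2 <= n)%N -> conclusion K n.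
Proof.
have [n0 [K1 K10 h1]] := rate_lower_bound_large.
have [K2 K20 h2] := rate_lower_bound_small n0.
have m0 : 0 < Num.min K1 K2 by rewrite lt_min K10.
exists (Num.min K1 K2) => // n n2.
have [nn0|nn0] := leqP n0 n.
  apply: (conclusion_weaken m0 _ _ (h1 n n2 nn0)).
  - by rewrite ler_wpM2r ?powR_ge0// ge_min lexx.
  - by rewrite ler_wpM2r ?powR_ge0// ge_min lexx.
have h : (2 <= n < n0)%N by rewrite n2.
apply: (conclusion_weaken m0 _ _ (h2 n h)).
- by rewrite ler_wpM2r ?powR_ge0// ge_min lexx orbT.
- by rewrite ler_wpM2r ?powR_ge0// ge_min lexx orbT.
Qed.

End rate_lower_bound.

Section rates.
Context (R : realType).
Implicit Types (s m d p r : R).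

Lemma dense_rateE (K n : R) s m d p r : 0 <= K ->
  let D := 2 * (s + m) + d - 2 * (0 / r) in
  (K * n `^ (- ((s - 0 / r) / D))) `^ p * (K * n `^ (- (0 / D))) =
  K `^ p * K * n `^ (- (p * s / (2 * (s + m) + d))).
Proof.
move=> K0; rewrite /= !mul0r mulr0 !subr0 oppr0 powRr0 mulr1 powRM ?powR_ge0//.
by rewrite -powRrM mulNr mulrAC; congr (_ * _ `^ (- _)); rewrite mulrC mulrA.
Qed.

Lemma sparse_rateE (K n : R) s m d p r : 0 <= K -> 0 < n -> p != 0 -> r != 0 ->
  let D := 2 * (s + m) + d - 2 * (d / r) in D != 0 ->
  (K * n `^ (- ((s - d / r) / D))) `^ p * (K * n `^ (- (d / D))) =
  K `^ p * K *
    n `^ (- (p * (s + d * (p^-1 - r^-1)) / (2 * ((s + m) + d * (2^-1 - r^-1))))).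
Proof.
move=> K0 n0 p0 r0 D D0; rewrite powRM ?powR_ge0// -powRrM mulrACA -powRD; last first.
  by rewrite (gt_eqF n0) implybT.
have E : 2 * ((s + m) + d * (2^-1 - r^-1)) = D by rewrite /D; field.
by rewrite E; congr (_ * _ `^ _); field; rewrite p0 r0 D0.
Qed.

End rates.

Unset Implicit Arguments.
Set Printing Implicit Defensive.

Theorem theorem13 (R : realType) (d : nat) (hd : (1 <= d)%N)
    (m : 'I_d -> nat) (hm : (0 < multi_norm m)%N)
    (r : R) (hr : 1 < r) (q : \bar R) (hq : (1 <= q)%E)
    (G : R) (hG : 0 < G) (s : R) (hs : 0 < s) (hsr : 0 < s - d%:R / r)
    (N : needlet_system R d) (kappa : R) (hkappa : 0 < kappa)
    (eta : R -> R -> R)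
    (heta : eta = @hard_threshold R \/ eta = @soft_threshold R) :
  (forall p : R, 1 <= p ->
    exists2 c : R, 0 < c &
    forall n : nat, (2 <= n)%N ->
    forall X : (forall f : density R d, iid_sample n f),
    ((c * n%:R `^ (- rate s (multi_norm m)%:R d%:R p r))%:E <=
     ereal_sup [set y : \bar R | exists (f : density R d) (g : 'rV[R]_d -> R),
       [/\ besov_ball N (s + (multi_norm m)%:R) r q G f,
           is_Dmulti m f g
         & y = Lp_risk N m kappa eta p (X f) g]])%E)
  /\
  (exists2 c : R, 0 < c &
    forall n : nat, (2 <= n)%N ->
    forall X : (forall f : density R d, iid_sample n f),
    ((c * n%:R `^ (- rate_oo s (multi_norm m)%:R d%:R r))%:E <=
     ereal_sup [set y : \bar R | exists (f : density R d) (g : 'rV[R]_d -> R),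
       [/\ besov_ball N (s + (multi_norm m)%:R) r q G f,
           is_Dmulti m f g
         & y = Loo_risk N m kappa eta (X f) g]])%E).
Proof.
have etaP : threshold_rule eta.
  by case: heta => ->; [exact: hard_threshold_rule|exact: soft_threshold_rule].
have r0 : 0 < r by exact: lt_trans hr.
have n_gt0 n : (2 <= n)%N -> 0 < n%:R :> R by move=> n2; rewrite ltr0n ltnW.
have dense : exists C : R, 0 < C /\ exists j1 : nat, forall j0, (j1 <= j0)%N ->
    exists H, wave_packet N m j0 (ndB N `^ (j0%:R * 0)) C H.
  have [C [C0 [j1 h]]] := @dense_packet R d N m hd.
  by exists C; split => //; exists j1 => j0 /h; rewrite mulr0 powRr0.
have sparse : exists C : R, 0 < C /\ exists j1 : nat, forall j0, (j1 <= j0)%N ->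
    exists H, wave_packet N m j0 (ndB N `^ (j0%:R * d%:R)) C H.
  have [C [C0 [j1 h]]] := @sparse_packet R d N hd m.
  exists C; split => //; exists j1 => j0 /h w; exists (band_mult N j0).
  by rewrite -natrM powR_mulrn// ltW// ndB_gt0.
have s0r : 0 / r < s by rewrite mul0r.
have sdr : d%:R / r < s by rewrite -subr_gt0.
have [K1 K10 h1] := @rate_lower_bound R d N m hm kappa eta s r q G 0 hkappa etaP hr hq hG
  (lexx 0) s0r dense.
have [K2 K20 h2] := @rate_lower_bound R d N m hm kappa eta s r q G d%:R hkappa etaP hr hq hG
  (ler0n _ _) sdr sparse.
have D0 := rate_dim_gt0 hm sdr.
split=> [p p1|].
  have p0 : 0 < p by exact: lt_le_trans p1.
  (* Each branch is the exponent of one packet: [v = 0] in the first, [v = d] in the second. *)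
  rewrite /rate; case: ifP => _.
    exists (K1 `^ p * K1) => [|n n2 X]; first by rewrite mulr_gt0 ?powR_gt0.
    have [f [g [bf dg hp _]]] := h1 n n2 X.
    apply: (@le_trans _ _ (Lp_risk N m kappa eta p (X f) g)); last first.
      by apply: ereal_sup_ubound; exists f, g.
    by have := hp p p1; rewrite dense_rateE// ltW.
  exists (K2 `^ p * K2) => [|n n2 X]; first by rewrite mulr_gt0 ?powR_gt0.
  have [f [g [bf dg hp _]]] := h2 n n2 X.
  apply: (@le_trans _ _ (Lp_risk N m kappa eta p (X f) g)); last first.
    by apply: ereal_sup_ubound; exists f, g.
  have := hp p p1; rewrite sparse_rateE ?(ltW K20) ?(n_gt0 n n2) ?(gt_eqF p0) ?(gt_eqF r0)//.
  by rewrite gt_eqF.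
(* The exponent for [p = +oo] is that of the height of the sparse packet alone. *)
exists K2 => // n n2 X.
have [f [g [bf dg _ hoo]]] := h2 n n2 X.
apply: (@le_trans _ _ (Loo_risk N m kappa eta (X f) g)); last first.
  by apply: ereal_sup_ubound; exists f, g.
rewrite (_ : rate_oo s (multi_norm m)%:R d%:R r = (s - d%:R / r) / rate_dim m s r d%:R)//.
rewrite /rate_oo /rate_dim; congr (_ / _).
by field; rewrite gt_eqF.
Qed.
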